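(* Let $d\ge 1$. Every $f\in M^{\infty,1}(\mathbb{R}^d)$ is Fresnel integrable, and for every $g,\gamma\in\mathcal{S}(\mathbb{R}^d)$ such that $\langle\gamma,g\rangle\neq 0$ we have $$\widetilde{\int_{\mathbb{R}^d}} e^{\frac{i}{2\hbar}|x|^2}f(x)\,dx=\frac{1}{\langle\gamma,g\rangle}\int_{\mathbb{R}^{2d}}V_gF_+(x,\xi)\,\mathcal{V}_\gamma f(x,\xi)\,dx\,d\xi .$$
   Context: Fix $\hbar\in(0,1]$; powers of $i$ are $i^{s}=e^{i\pi s/2}$, so $(2\pi i\hbar)^{-d/2}=(2\pi\hbar)^{-d/2}e^{-i\pi d/4}$. $\langle f,g\rangle=\int_{\mathbb{R}^d} f\overline{g}\,dy$, extended to $f\in\mathcal{S}'(\mathbb{R}^d)$, $g\in\mathcal{S}(\mathbb{R}^d)$ by $\langle f,g\rangle=f(\overline g)$. For $g\in\mathcal{S}(\mathbb{R}^d)$ and $f\in\mathcal{S}'(\mathbb{R}^d)$ the Gabor transform is $V_gf(x,\xi)=\langle f,\pi(x,\xi)g\rangle$, where $\pi(x,\xi)g(y)=(2\pi\hbar)^{-d/2}e^{\frac{i}{\hbar}\xi\cdot y}g(y-x)$; for locally integrable $f$ of polynomial growth, $V_gf(x,\xi)=(2\pi\hbar)^{-d/2}\int_{\mathbb{R}^d}e^{-\frac{i}{\hbar}\xi\cdot y}f(y)\overline{g(y-x)}\,dy$. Moreover $\mathcal{V}_gf(x,\xi)=\overline{V_g\overline{f}(x,\xi)}$, i.e. $(2\pi\hbar)^{-d/2}\int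 e^{\frac{i}{\hbar}\xi\cdot y}f(y)g(y-x)\,dy$ for functions. The Sjöstrand class $M^{\infty,1}(\mathbb{R}^d)$ is the set of $f\in\mathcal{S}'(\mathbb{R}^d)$ such that $\|f\|_{M^{\infty,1}_{(g)}}=\int_{\mathbb{R}^d}\sup_{x\in\mathbb{R}^d}|V_gf(x,\xi)|\,d\xi<\infty$ for some (equivalently every) $g\in\mathcal{S}(\mathbb{R}^d)\setminus\{0\}$. Its elements are identified with bounded continuous functions. A function $f:\mathbb{R}^d\to\mathbb{C}$ is Fresnel integrable if for all $\varphi\in\mathcal{S}(\mathbb{R}^d)$ with $\varphi(0)=1$ the limit $\widetilde{\int_{\mathbb{R}^d}}e^{\frac{i}{2\hbar}|x|^2}f(x)\,dx:=\lim_{\varepsilon\downarrow0}(2\pi i\hbar)^{-d/2}\int_{\mathbb{R}^d}e^{\frac{i}{2\hbar}|x|^2}f(x)\varphi(\varepsilon x)\,dx$ exists and is independent of $\varphi$. $F_+(x)=(2\pi i\hbar)^{-d/2}e^{\frac{i}{2\hbar}|x|^2}$, $x\in\mathbb{R}^d$. *)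

(* Defs.v *)
From HB Require Import structures.
From mathcomp Require Import all_boot all_order all_algebra.
From mathcomp Require Import complex.
From mathcomp Require Import all_classical all_reals all_analysis.
Set Implicit Arguments.
Unset Strict Implicit.
Unset Printing Implicit Defensive.
Import Order.TTheory GRing.Theory Num.Theory.
Import numFieldNormedType.Exports.
Local Open Scope classical_set_scope.
Local Open Scope ring_scope.

Section measurable_rV.
Context (R : realType) (d : nat).

(* The product sigma-algebra, i.e. the Borel sets of R^d. *)
Let coord : 'I_d -> 'rV[R]_d -> R := fun i x => x ord0 i.

Let rV_set0 : g_sigma_preimage coord set0.
Proof. exact: sigma_algebra0. Qed.

Let rV_setC A : g_sigma_preimage coord A -> g_sigma_preimage coord (~` A).
Proof. exact: sigma_algebraC. Qed.

Let rV_bigcup (F : _^nat) : (forall i, g_sigma_preimage coord (F i)) ->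
  g_sigma_preimage coord (\bigcup_i (F i)).
Proof. exact: sigma_algebra_bigcup. Qed.

HB.instance Definition _ := @isMeasurable.Build default_measure_display
  'rV[R]_d (g_sigma_preimage coord) rV_set0 rV_setC rV_bigcup.

Lemma measurable_coord (i : 'I_d) :
  measurable_fun [set: 'rV[R]_d] (coord i).
Proof.
move=> _ Y mY; rewrite setTI; apply: sub_sigma_algebra => /=.
rewrite -bigcup_seq/=; exists i => /=; first by rewrite mem_index_enum.
by exists Y => //; rewrite setTI.
Qed.

Lemma measurable_fun_rVP d1 (T1 : measurableType d1) (f : T1 -> 'rV[R]_d) :
  measurable_fun [set: T1] f <->
  forall i, measurable_fun [set: T1] (coord i \o f).
Proof.
split=> [mf i|mf]; first exact: measurableT_comp (measurable_coord i) mf.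
have : g_sigma_preimage (fun i => coord i \o f) `<=` measurable.
  apply: smallest_sub; first exact: sigma_algebra_measurable.
  rewrite -bigcup_seq; apply: bigcup_sub => i _ A [B mB <-].
  exact: mf.
rewrite g_sigma_preimage_comp => prefS _ A mA.
by apply: prefS; exists A.
Qed.

End measurable_rV.

Section lebesgue_rV_step.
Context (R : realType) (n : nat).
Variable mu : {sigma_finite_measure set 'rV[R]_n -> \bar R}.

Definition rV_cons (p : measurableTypeR R * 'rV[R]_n) : 'rV[R]_n.+1 :=
  \row_j oapp (p.2 ord0) p.1 (unlift ord0 j).

Definition rV_uncons (x : 'rV[R]_n.+1) : measurableTypeR R * 'rV[R]_n :=
  (x ord0 ord0, \row_k x ord0 (lift ord0 k)).

Lemma rV_consK : cancel rV_cons rV_uncons.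
Proof.
move=> [a x]; rewrite /rV_uncons /rV_cons !mxE unlift_none /=; congr pair.
by apply/rowP => k; rewrite !mxE liftK.
Qed.

Lemma measurable_rV_cons : measurable_fun setT rV_cons.
Proof.
apply/measurable_fun_rVP => i /=.
case: (unliftP ord0 i) => [k|] ->.
- rewrite (_ : _ \o _ = (fun x : 'rV[R]_n => x ord0 k) \o snd).
    exact: measurableT_comp (measurable_coord k) measurable_snd.
  by apply/funext => p /=; rewrite mxE liftK.
- rewrite (_ : _ \o _ = fst); first exact: measurable_fst.
  by apply/funext => p /=; rewrite mxE unlift_none.
Qed.

Lemma measurable_rV_uncons : measurable_fun setT rV_uncons.
Proof.
apply/measurable_fun_pairP; split; first exact: (measurable_coord ord0).
apply/measurable_fun_rVP => i.
rewrite (_ : _ \o _ = fun x : 'rV[R]_n.+1 => x ord0 (lift ord0 i)).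
  exact: measurable_coord.
by apply/funext => x /=; rewrite mxE.
Qed.

Definition lebesgue_rV_step : set 'rV[R]_n.+1 -> \bar R :=
  pushforward (@lebesgue_measure R \x mu)%E rV_cons.

HB.instance Definition _ := Measure.copy lebesgue_rV_step
  (measure_function_pushforward__canonical__measure_function_Measure
    (@lebesgue_measure R \x mu)%E measurable_rV_cons).

Let sigma_finite_step : sigma_finite setT lebesgue_rV_step.
Proof.
have /sigma_finiteP[F [TF ndF Foo]] := sigma_finiteT (@lebesgue_measure R).
have /sigma_finiteP[G [TG ndG Goo]] := sigma_finiteT mu.
exists (fun k => rV_uncons @^-1` (F k `*` G k)).
  rewrite -preimage_bigcup [X in _ @^-1` X](_ : _ = setT) ?preimage_setT//.
  rewrite -setXTT TF TG predeqE => -[x y]; split.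
    by move=> [n' _ []/= ? ?]; split; exists n'.
  move=> [/= [a _ Fax] [b _ Gby]]; exists (maxn a b) => //; split.
  - by move: x Fax; exact/subsetPset/ndF/leq_maxl.
  - by move: y Gby; exact/subsetPset/ndG/leq_maxr.
move=> k; have [mF Fk] := Foo k; have [mG Gk] := Goo k; split.
  by rewrite -[X in measurable X]setTI; apply: measurable_rV_uncons => //; exact: measurableX.
rewrite /lebesgue_rV_step /pushforward -comp_preimage.
rewrite (_ : _ \o _ = id); last by apply/funext => p /=; rewrite rV_consK.
by rewrite preimage_id product_measure1E// lte_mul_pinfty// ge0_fin_numE.
Qed.

HB.instance Definition _ := Measure_isSigmaFinite.Build _ _ _
  lebesgue_rV_step sigma_finite_step.

End lebesgue_rV_step.

(* Lebesgue measure on R^d: Dirac mass at the only point for d = 0, and the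
   image of the product of the measures on R and R^n for d = n.+1. *)
Fixpoint lebesgue_rV (R : realType) (d : nat) :
    {sigma_finite_measure set 'rV[R]_d -> \bar R} :=
  match d with
  | 0 => \d_(0 : 'rV[R]_0)
  | n.+1 => lebesgue_rV_step (lebesgue_rV R n)
  end.

Lemma lebesgue_rV_box (R : realType) (d : nat) (A : 'I_d -> set R) :
  (forall i, measurable (A i)) ->
  lebesgue_rV R d [set x | forall i, A i (x ord0 i)] =
  (\prod_(i < d) @lebesgue_measure R (A i))%E.
Proof.
elim: d A => [|n IHn] A mA.
  rewrite big_ord0 /= diracE; apply/eqP; rewrite -[X in _ == X]/(1%:R%:E) eqe.
  by rewrite mem_set//; case.
rewrite big_ord_recl -(IHn (fun i => A (lift ord0 i)))//=.
have mB : measurable [set x : 'rV[R]_n | forall i, A (lift ord0 i) (x ord0 i)].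
  rewrite (_ : [set _ | _] =
      \big[setI/setT]_(i < n) ((fun x : 'rV[R]_n => x ord0 i) @^-1` A (lift ord0 i))).
    apply: bigsetI_measurable => i _; rewrite -[X in measurable X]setTI.
    exact: measurable_coord.
  rewrite -bigcap_seq; apply/seteqP; split=> x /= xA i; first by move=> _; exact: xA.
  by apply: xA; rewrite /= mem_index_enum.
rewrite /lebesgue_rV_step /pushforward -product_measure1E//; last exact: mA.
congr (_ _); apply/seteqP; split=> -[a x] /= xA.
  split; first by have := xA ord0; rewrite mxE unlift_none.
  by move=> i; have := xA (lift ord0 i); rewrite mxE liftK.
case: xA => Aa Ax i; rewrite mxE; case: unliftP => [k|] -> //=.
Qed.

Local Open Scope complex_scope.

(* The modulus topology on R[i]. *)
HB.instance Definition _ (R : rcfType) :=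
  NormedModule.copy R[i] ((R[i] : numFieldType) : normedModType R[i]).

Definition cmod (R : rcfType) (z : R[i]) : R := Normc.normc z.

Definition cexpi (R : realType) (t : R) : R[i] := cos t +i* sin t.

Definition cintegrable d (T : measurableType d) (R : realType)
    (mu : {measure set T -> \bar R}) (f : T -> R[i]) : Prop :=
  mu.-integrable setT (EFin \o (@complex.Re R \o f)) /\
  mu.-integrable setT (EFin \o (@complex.Im R \o f)).

Definition cintegral d (T : measurableType d) (R : realType)
    (mu : {measure set T -> \bar R}) (f : T -> R[i]) : R[i] :=
  (\int[mu]_x complex.Re (f x)) +i* (\int[mu]_x complex.Im (f x)).

Section Schwartz.
Context (R : realType) (d : nat).
Implicit Types (f g : 'rV[R]_d -> R[i]) (x y xi : 'rV[R]_d).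

Definition dot x y : R := \sum_(i < d) x ord0 i * y ord0 i.

Definition cderivable (i : 'I_d) f x : Prop :=
  derivable (@complex.Re R \o f) x (delta_mx ord0 i) /\
  derivable (@complex.Im R \o f) x (delta_mx ord0 i).

Definition cpartial (i : 'I_d) f : 'rV[R]_d -> R[i] := fun x =>
  'D_(delta_mx ord0 i) (@complex.Re R \o f) x +i*
  'D_(delta_mx ord0 i) (@complex.Im R \o f) x.

(* [cpartials [:: i1; ..; ik] f] is the iterated partial derivative
   d_i1 (... (d_ik f)); these words of indices range over all d^beta f. *)
Definition cpartials (b : seq 'I_d) f := foldr cpartial f b.

Definition smooth f : Prop := forall b : seq 'I_d,
  continuous (cpartials b f) /\ forall i x, cderivable i (cpartials b f) x.

Definition monomial (a : 'I_d -> nat) x : R := \prod_(i < d) x ord0 i ^+ a i.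

Definition schwartz f : Prop := smooth f /\
  forall (a : 'I_d -> nat) (b : seq 'I_d), exists M : R,
    forall x, `|monomial a x| * cmod (cpartials b f x) <= M.

(* These sets are a basis of closed neighborhoods of 0 for the Frechet topology
   of the Schwartz space. *)
Definition seminorms_le (N : nat) (e : R) f : Prop :=
  forall (a : 'I_d -> nat) (b : seq 'I_d),
    (\sum_(i < d) a i <= N)%N -> (size b <= N)%N ->
    forall x, `|monomial a x| * cmod (cpartials b f x) <= e.

(* A tempered distribution is represented by a functional on all functions,
   of which only the values on Schwartz functions are ever relevant. *)
Definition functional := ('rV[R]_d -> R[i]) -> R[i].
Implicit Types T : functional.

Definition tempered T : Prop :=
  (forall (c : R[i]) f g, schwartz f -> schwartz g ->
     T (fun x => c * f x + g x) = c * T f + T g) /\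
  (forall f, schwartz f -> forall e : R, 0 < e ->
     exists N (delta : R), 0 < delta /\
     forall g, schwartz g -> seminorms_le N delta (fun x => g x - f x) ->
       cmod (T g - T f) <= e).

Definition distr_of f : functional :=
  fun phi => cintegral (lebesgue_rV R d) (fun y => f y * phi y).

Definition represents f T : Prop :=
  forall phi, schwartz phi -> T phi = distr_of f phi.

(* <T, g> = T(conj g) *)
Definition pairing T g : R[i] := T (fun y => (g y)^*).

Definition inner f g : R[i] :=
  cintegral (lebesgue_rV R d) (fun y => f y * (g y)^*).

(* conj T, the distribution phi |-> conj (T (conj phi)) *)
Definition conj_distr T : functional :=
  fun phi => (T (fun y => (phi y)^*))^*.

End Schwartz.

Section Gabor.
Context (R : realType) (d : nat) (hbar : R).
Implicit Types (f g : 'rV[R]_d -> R[i]) (x y xi : 'rV[R]_d) (T : functional R d).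

Definition time_freq_shift x xi g : 'rV[R]_d -> R[i] := fun y =>
  ((2 * pi * hbar) `^ (- (d%:R / 2)))%:C *
  cexpi (dot xi y / hbar) * g (y - x).

Definition gabor g T x xi : R[i] := pairing T (time_freq_shift x xi g).

(* conj (V_g (conj T)), the calligraphic transform *)
Definition gabor_bar g T x xi : R[i] := (gabor g (conj_distr T) x xi)^*.

Definition sjostrand_norm g T : \bar R :=
  (\int[lebesgue_rV R d]_xi
     ereal_sup [set (cmod (gabor g T x xi))%:E | x in setT])%E.

Definition sjostrand T : Prop := tempered T /\
  exists g, [/\ schwartz g, g <> cst 0 & (sjostrand_norm g T < +oo)%E].

(* (2 pi i hbar)^(-d/2) = (2 pi hbar)^(-d/2) exp(-i pi d / 4) *)
Definition fresnel_const : R[i] :=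
  ((2 * pi * hbar) `^ (- (d%:R / 2)))%:C * cexpi (- (pi * d%:R / 4)).

Definition fresnel_phase x : R[i] := cexpi (dot x x / (2 * hbar)).

Definition F_plus x : R[i] := fresnel_const * fresnel_phase x.

Definition fresnel_regularized f (phi : 'rV[R]_d -> R[i]) (e : R) x : R[i] :=
  fresnel_phase x * f x * phi (e *: x).

(* The regularized integrals have to converge absolutely, so that the limit is
   not taken over the default value of a divergent Lebesgue integral. *)
Definition has_fresnel_integral f (l : R[i]) : Prop :=
  forall phi, schwartz phi -> phi 0 = 1 ->
    (forall e : R, 0 < e ->
       cintegrable (lebesgue_rV R d) (fresnel_regularized f phi e)) /\
    (fresnel_const * cintegral (lebesgue_rV R d) (fresnel_regularized f phi e)
       @[e --> 0^'+] --> l).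

Definition fresnel_integrable f : Prop := exists l, has_fresnel_integral f l.

(* Arbitrary when f is not Fresnel integrable. *)
Definition fresnel_integral f : R[i] := get (has_fresnel_integral f).

End Gabor.

(* Main.v *)
Require Import Defs.
From HB Require Import structures.
From mathcomp Require Import all_boot all_order all_algebra.
From mathcomp Require Import complex ring lra.
From mathcomp Require Import all_classical all_reals all_analysis.
From mathcomp Require Import measurable_realfun.
Set Implicit Arguments.
Unset Strict Implicit.
Unset Printing Implicit Defensive.
Import Order.TTheory GRing.Theory Num.Theory.
Import numFieldNormedType.Exports.
Local Open Scope classical_set_scope.
Local Open Scope ring_scope.
Local Open Scope complex_scope.

(** Write [G h] for the Fourier integral [int h(y) e^(i xi.y / hbar) dy] and
    [tau_x k = k(. - x)].  For [theta] integrable, Fubini and Fourier inversion give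

      int int G(f tau_x g)(xi) G(theta tau_x k)(- xi) dx dxi
        = (2 pi hbar)^d (int g k) (int f theta).

    Membership of [f] in the Sjostrand class bounds [G(f tau_x g)(xi)] by an
    integrable [S(xi)] for one window [g].  The identity with [theta] a modulated
    translate of another window [g1] transfers such a bound to [g1].  The identity
    with [theta] the Fresnel phase damped by [phi(eps y)], and [k = conj g], writes
    the regularized Fresnel integral as a double integral.  Its second factor is,
    uniformly in [eps], bounded by a multiple of [prod_j (1 + (x + zeta)_j^2)^-1] at
    frequency [zeta = - xi]: after [y = u + x] the quadratic phase turns into a
    shift of the frequency by [x], and integration by parts gives the decay.
    Dominated convergence as [eps -> 0] concludes. *)

(** * Complex-valued functions and integrals *)

(** Two obstacles shape the proof. The products f tau_x g are continuous and integrable but inherit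
    no smoothness from f, so inversion cannot rest on Schwartz regularity. It is obtained by Abel
    summation with exp(-|xi_1| - ... - |xi_d|), whose transform is a product of Cauchy kernels of
    known mass. Secondly, the bound on f is integrable in xi but only uniform in x, so the
    convergence of the double integral in x has to come from the second factor. Decay in zeta alone
    would not give it; decay in x + zeta does, since S(xi) times an integrable function of x - xi is
    the integrand of a convolution.

    The weight prod_j (1 + x_j^2) is preferred to 1 + |x|^2 because integrals and transforms then
    factor over the coordinates. Its inverse is reached with two integrations by parts per
    coordinate, whence the order d + d of smoothness. Since every estimate has to be uniform in
    translations and dampings, functions are treated as families indexed by a parameter. *)

Section complex_facts.
Context {R : realType}.
Implicit Types (z w : R[i]) (a b t : R).

Lemma cplx_eta z : z = complex.Re z +i* complex.Im z.
Proof. by case: z. Qed.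

Lemma cplx_eq z w : complex.Re z = complex.Re w -> complex.Im z = complex.Im w -> z = w.
Proof. by case: z w => ? ? [? ?] /= -> ->. Qed.

Lemma ReM z w : complex.Re (z * w) =
  complex.Re z * complex.Re w - complex.Im z * complex.Im w.
Proof. by case: z w => ? ? [? ?]. Qed.

Lemma ImM z w : complex.Im (z * w) =
  complex.Re z * complex.Im w + complex.Im z * complex.Re w.
Proof. by case: z w => ? ? [? ?]. Qed.

Lemma ReD z w : complex.Re (z + w) = complex.Re z + complex.Re w.
Proof. by case: z w => ? ? [? ?]. Qed.

Lemma ImD z w : complex.Im (z + w) = complex.Im z + complex.Im w.
Proof. by case: z w => ? ? [? ?]. Qed.

Lemma ReN z : complex.Re (- z) = - complex.Re z.
Proof. by case: z. Qed.

Lemma ImN z : complex.Im (- z) = - complex.Im z.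
Proof. by case: z. Qed.

Lemma ReJ z : complex.Re (conjc z) = complex.Re z.
Proof. by case: z. Qed.

Lemma ImJ z : complex.Im (conjc z) = - complex.Im z.
Proof. by case: z. Qed.

Lemma cmodE z : (cmod z)%:C = `|z|.
Proof. by []. Qed.

Lemma cmod_ge0 z : 0 <= cmod z.
Proof. by case: z => a b; exact: sqrtr_ge0. Qed.

Lemma cmodM z w : cmod (z * w) = cmod z * cmod w.
Proof. exact: Normc.normcM. Qed.

Lemma cmodD z w : cmod (z + w) <= cmod z + cmod w.
Proof. by rewrite -lecR rmorphD /= !cmodE ler_normD. Qed.

Lemma cmodN z : cmod (- z) = cmod z.
Proof. by apply: complexI; rewrite !cmodE normrN. Qed.

Lemma cmod_dist z w : `|cmod z - cmod w| <= cmod (z - w).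
Proof.
rewrite ler_norml lerNl opprB !lerBlDr; apply/andP; split.
  by rewrite -(cmodN (z - w)) opprB (le_trans _ (cmodD _ _))// subrK.
by rewrite (le_trans _ (cmodD _ _))// subrK.
Qed.

Lemma cmodJ z : cmod (conjc z) = cmod z.
Proof. by case: z => a b; rewrite /cmod /= sqrrN. Qed.

Lemma cmod0 : cmod (0 : R[i]) = 0.
Proof. by apply: complexI; rewrite cmodE normr0. Qed.

Lemma cmod1 : cmod (1 : R[i]) = 1.
Proof. by apply: complexI; rewrite cmodE normr1. Qed.

Lemma cmod_eq0 z : (cmod z == 0) = (z == 0).
Proof. by rewrite -(normr_eq0 z) -cmodE (inj_eq (@complexI _)). Qed.

Lemma cmod_real a : cmod a%:C = `|a|.
Proof. by rewrite /cmod /= expr0n /= addr0 sqrtr_sqr. Qed.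

Lemma Re_le_cmod z : `|complex.Re z| <= cmod z.
Proof. by rewrite /cmod; case: z => a b /=; rewrite -sqrtr_sqr ler_wsqrtr// lerDl sqr_ge0. Qed.

Lemma Im_le_cmod z : `|complex.Im z| <= cmod z.
Proof. by rewrite /cmod; case: z => a b /=; rewrite -sqrtr_sqr ler_wsqrtr// lerDr sqr_ge0. Qed.

Lemma cmod_le_ReIm z : cmod z <= `|complex.Re z| + `|complex.Im z|.
Proof.
rewrite [z in X in X <= _]cplx_eta.
have -> : complex.Re z +i* complex.Im z = (complex.Re z)%:C + 'i * (complex.Im z)%:C.
  by apply: cplx_eq; rewrite ?ReD ?ImD ?ReM ?ImM /=; ring.
rewrite (le_trans (cmodD _ _))// cmodM !cmod_real /cmod /=.
by rewrite expr0n expr1n add0r sqrtr1 mul1r.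
Qed.

Lemma cmulJ z : z * conjc z = (cmod z ^+ 2)%:C.
Proof.
case: z => a b; apply: cplx_eq; rewrite ?ReM ?ImM /cmod /=; last by ring.
by rewrite sqr_sqrtr ?addr_ge0 ?sqr_ge0//; ring.
Qed.

Lemma cmod_cexpi t : cmod (cexpi t) = 1.
Proof. by rewrite /cmod /= cos2Dsin2 sqrtr1. Qed.

Lemma cexpiD a b : cexpi (a + b) = cexpi a * cexpi b.
Proof.
by apply: cplx_eq; rewrite ?ReM ?ImM /= ?cosD ?sinD //; ring.
Qed.

Lemma cexpi0 : cexpi 0 = 1 :> R[i].
Proof. by rewrite /cexpi cos0 sin0. Qed.

Lemma cexpiJ t : conjc (cexpi t) = cexpi (- t).
Proof. by rewrite /cexpi /= cosN sinN. Qed.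

End complex_facts.

Section complex_topology.
Context {R : realType}.

Lemma ccvgP (T : Type) (F : set_system T) {FF : Filter F} (f : T -> R[i]) (l : R[i]) :
  f @ F --> l <-> ((@complex.Re R \o f) @ F --> complex.Re l /\
                   (@complex.Im R \o f) @ F --> complex.Im l).
Proof.
split.
- move=> /cvgrPdist_lt fl; split; apply/cvgrPdist_lt => e e0.
  + have := fl e%:C; rewrite ltcR => /(_ e0); apply: filterS => t.
    rewrite -cmodE ltcR; apply: le_lt_trans => /=.
    by rewrite -ReN -ReD Re_le_cmod.
  + have := fl e%:C; rewrite ltcR => /(_ e0); apply: filterS => t.
    rewrite -cmodE ltcR; apply: le_lt_trans => /=.
    by rewrite -ImN -ImD Im_le_cmod.
- move=> [/cvgrPdist_lt fRe /cvgrPdist_lt fIm]; apply/cvgrPdist_lt => -[e e'].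
  (* Positivity in [R[i]] forces a zero imaginary part, so the radius is a real number [e]. *)
  rewrite ltcE /= => /andP[/eqP -> e0].
  have e20 : 0 < e / 2 by rewrite divr_gt0.
  have := fRe _ e20; have := fIm _ e20; apply: filterS2 => t /= Ht1 Ht2.
  rewrite -cmodE -[_ +i* 0]/(e%:C) ltcR (le_lt_trans (cmod_le_ReIm _))//.
  rewrite ReD ImD ReN ImN [ltRHS]splitr ltrD//.
Qed.

Lemma ccontinuousP (T : topologicalType) (f : T -> R[i]) :
  continuous f <-> (continuous (@complex.Re R \o f) /\ continuous (@complex.Im R \o f)).
Proof.
split=> [cf|[c1 c2]].
  by split=> x; have /ccvgP[] := cf x.
by move=> x; apply/ccvgP; split; [exact: c1|exact: c2].
Qed.

Lemma continuous_cmod (T : topologicalType) (f : T -> R[i]) :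
  continuous f -> continuous (fun x => cmod (f x)).
Proof.
move=> cf x; apply/cvgrPdist_lt => e e0.
have /cvgrPdist_lt := cf x.
move=> /(_ e%:C); rewrite ltcR => /(_ e0); apply: filterS => t.
rewrite -cmodE ltcR; apply: le_lt_trans => /=.
exact: cmod_dist.
Qed.

Lemma continuous_addR (T : topologicalType) (f g : T -> R) :
  continuous f -> continuous g -> continuous (fun x => f x + g x).
Proof. by move=> cf cg x; apply: cvgD; [exact: cf|exact: cg]. Qed.

Lemma continuous_mulR (T : topologicalType) (f g : T -> R) :
  continuous f -> continuous g -> continuous (fun x => f x * g x).
Proof. by move=> cf cg x; apply: cvgM; [exact: cf|exact: cg]. Qed.

Lemma continuous_cstR (T : topologicalType) (c : R) : continuous (fun _ : T => c).
Proof. by move=> x; exact: cvg_cst. Qed.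

Lemma continuous_mulC (T : topologicalType) (f g : T -> R[i]) :
  continuous f -> continuous g -> continuous (fun x => f x * g x).
Proof.
move=> /ccontinuousP[f1 f2] /ccontinuousP[g1 g2]; apply/ccontinuousP; split.
- rewrite (_ : _ \o _ = fun x => (@complex.Re R \o f) x * (@complex.Re R \o g) x +
     - 1 * ((@complex.Im R \o f) x * (@complex.Im R \o g) x)).
    apply: continuous_addR; first exact: continuous_mulR.
    by apply: continuous_mulR; [exact: continuous_cstR|exact: continuous_mulR].
  by apply/funext => x /=; rewrite ReM mulN1r.
- rewrite (_ : _ \o _ = fun x => (@complex.Re R \o f) x * (@complex.Im R \o g) x +
     (@complex.Im R \o f) x * (@complex.Re R \o g) x).
    by apply: continuous_addR; exact: continuous_mulR.
  by apply/funext => x /=; rewrite ImM.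
Qed.

Lemma continuous_addC (T : topologicalType) (f g : T -> R[i]) :
  continuous f -> continuous g -> continuous (fun x => f x + g x).
Proof.
move=> /ccontinuousP[f1 f2] /ccontinuousP[g1 g2]; apply/ccontinuousP; split.
- rewrite (_ : _ \o _ = fun x => (@complex.Re R \o f) x + (@complex.Re R \o g) x).
    exact: continuous_addR.
  by apply/funext => x /=; rewrite ReD.
- rewrite (_ : _ \o _ = fun x => (@complex.Im R \o f) x + (@complex.Im R \o g) x).
    exact: continuous_addR.
  by apply/funext => x /=; rewrite ImD.
Qed.

Lemma continuous_realC (T : topologicalType) (f : T -> R) :
  continuous f -> continuous (fun x => (f x)%:C).
Proof. by move=> cf; apply/ccontinuousP; split=> //; exact: continuous_cstR. Qed.

Lemma continuous_cstC (T : topologicalType) (c : R[i]) : continuous (fun _ : T => c).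
Proof. by apply/ccontinuousP; split; exact: continuous_cstR. Qed.

Lemma continuous_conjC (T : topologicalType) (f : T -> R[i]) :
  continuous f -> continuous (fun x => conjc (f x)).
Proof.
move=> /ccontinuousP[f1 f2]; apply/ccontinuousP; split.
- by rewrite (_ : _ \o _ = @complex.Re R \o f)//; apply/funext => x /=; rewrite ReJ.
- rewrite (_ : _ \o _ = fun x => -1 * (@complex.Im R \o f) x).
    by apply: continuous_mulR => //; exact: continuous_cstR.
  by apply/funext => x /=; rewrite ImJ mulN1r.
Qed.

Lemma continuous_compR (T : topologicalType) (f : T -> R) (g : R -> R) :
  continuous f -> continuous g -> continuous (fun x => g (f x)).
Proof. by move=> cf cg x; exact: (continuous_comp (cf x) (cg _)). Qed.

Lemma continuous_cexpi (T : topologicalType) (f : T -> R) :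
  continuous f -> continuous (fun x => cexpi (f x)).
Proof.
move=> cf; apply/ccontinuousP; split=> x /=.
- exact: (continuous_compR cf (@continuous_cos _)).
- exact: (continuous_compR cf (@continuous_sin _)).
Qed.

End complex_topology.

Section complex_measurability.
Context {R : realType} d (T : measurableType d).
Implicit Types (f g : T -> R[i]) (t u : T -> R).

(** Componentwise, to match [cintegrable] and [cintegral], which treat the real and imaginary parts
    separately. *)
Definition cmeas f := measurable_fun [set: T] (@complex.Re R \o f) /\
  measurable_fun [set: T] (@complex.Im R \o f).

Lemma cmeas_cst (c : R[i]) : cmeas (fun _ => c).
Proof. by split; apply: measurable_cst. Qed.

Lemma cmeas_real t : measurable_fun setT t -> cmeas (fun x => (t x)%:C).
Proof. by move=> mt; split=> //=; apply: measurable_cst. Qed.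

Lemma cmeasD f g : cmeas f -> cmeas g -> cmeas (fun x => f x + g x).
Proof.
move=> [f1 f2] [g1 g2]; split.
- rewrite (_ : _ \o _ = (@complex.Re R \o f) \+ (@complex.Re R \o g)); first exact: measurable_funD.
  by apply/funext => x /=; rewrite ReD.
- rewrite (_ : _ \o _ = (@complex.Im R \o f) \+ (@complex.Im R \o g)); first exact: measurable_funD.
  by apply/funext => x /=; rewrite ImD.
Qed.

Lemma cmeasM f g : cmeas f -> cmeas g -> cmeas (fun x => f x * g x).
Proof.
move=> [f1 f2] [g1 g2]; split.
- rewrite (_ : _ \o _ = ((@complex.Re R \o f) \* (@complex.Re R \o g)) \-
     ((@complex.Im R \o f) \* (@complex.Im R \o g))).
    by apply: measurable_funB; exact: measurable_funM.
  by apply/funext => x /=; rewrite ReM.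
- rewrite (_ : _ \o _ = ((@complex.Re R \o f) \* (@complex.Im R \o g)) \+
     ((@complex.Im R \o f) \* (@complex.Re R \o g))).
    by apply: measurable_funD; exact: measurable_funM.
  by apply/funext => x /=; rewrite ImM.
Qed.

Lemma cmeasB f g : cmeas f -> cmeas g -> cmeas (fun x => f x - g x).
Proof.
move=> mf mg; rewrite (_ : (fun _ => _) = fun x => f x + (-1) * g x); last first.
  by apply/funext => x; rewrite mulN1r.
by apply: cmeasD => //; apply: cmeasM => //; exact: cmeas_cst.
Qed.

Lemma cmeasJ f : cmeas f -> cmeas (fun x => conjc (f x)).
Proof.
move=> [f1 f2]; split.
- by rewrite (_ : _ \o _ = @complex.Re R \o f)//; apply/funext => x /=; rewrite ReJ.
- rewrite (_ : _ \o _ = \- (@complex.Im R \o f)); first exact: measurable_funN.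
  by apply/funext => x /=; rewrite ImJ.
Qed.

Lemma cmeas_cexpi t : measurable_fun setT t -> cmeas (fun x => cexpi (t x)).
Proof.
move=> mt; split=> /=.
- apply: (@measurableT_comp _ _ _ _ _ _ (@cos R)) => //.
  by apply: continuous_measurable_fun; exact: continuous_cos.
- apply: (@measurableT_comp _ _ _ _ _ _ (@sin R)) => //.
  by apply: continuous_measurable_fun; exact: continuous_sin.
Qed.

Lemma measurable_cmod f : cmeas f -> measurable_fun setT (fun x => cmod (f x)).
Proof.
move=> [f1 f2].
rewrite (_ : (fun _ => _) = @Num.sqrt R \o
   ((fun x => complex.Re (f x) ^+ 2) \+ (fun x => complex.Im (f x) ^+ 2))).
  apply: (@measurableT_comp _ _ _ _ _ _ (@Num.sqrt R)).
    by apply: continuous_measurable_fun; exact: sqrt_continuous.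
  by apply: measurable_funD; exact: measurable_funX.
by apply/funext => x; rewrite /cmod /Normc.normc /=; case: (f x).
Qed.

End complex_measurability.

Lemma cmeas_comp {R : realType} d1 (T1 : measurableType d1) d2 (T2 : measurableType d2)
    (f : T2 -> R[i]) (phi : T1 -> T2) :
  cmeas f -> measurable_fun setT phi -> cmeas (fun x => f (phi x)).
Proof. move=> [f1 f2] mphi; split.
- exact: (measurableT_comp f1 mphi).
- exact: (measurableT_comp f2 mphi). Qed.

Section complex_integral.
Context {R : realType} d (T : measurableType d).
Variable mu : {measure set T -> \bar R}.
Implicit Types (f g : T -> R[i]) (t u : T -> R).

Lemma cintegrable_cmeas f : cintegrable mu f -> cmeas f.
Proof. by move=> [/measurable_int/measurable_EFinP ? /measurable_int/measurable_EFinP ?]. Qed.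

Lemma integrable_le t u : measurable_fun setT t -> mu.-integrable setT (EFin \o u) ->
  (forall x, `|t x| <= u x) -> mu.-integrable setT (EFin \o t).
Proof.
move=> mt iu tu; apply: le_integrable iu => //; first exact/measurable_EFinP.
by move=> x _ /=; rewrite lee_fin (le_trans (tu x))// ler_norm.
Qed.

Lemma cintegrable_le f u : cmeas f -> mu.-integrable setT (EFin \o u) ->
  (forall x, cmod (f x) <= u x) -> cintegrable mu f.
Proof.
move=> [f1 f2] iu fu; split.
- by apply: integrable_le iu _ => // x; exact: le_trans (Re_le_cmod _) (fu x).
- by apply: integrable_le iu _ => // x; exact: le_trans (Im_le_cmod _) (fu x).
Qed.

Lemma integrable_cmod f : cintegrable mu f ->
  mu.-integrable setT (EFin \o (fun x => cmod (f x))).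
Proof.
move=> fi; have [f1 f2] := fi.
apply: (@integrable_le _ (fun x => `|complex.Re (f x)| + `|complex.Im (f x)|)).
- exact/measurable_cmod/cintegrable_cmeas.
- rewrite (_ : _ \o _ = (abse \o (EFin \o (@complex.Re R \o f))) \+
    (abse \o (EFin \o (@complex.Im R \o f))))%E//.
  by apply: integrableD => //; exact: integrable_abse.
- by move=> x; rewrite ger0_norm ?cmod_ge0// cmod_le_ReIm.
Qed.

Lemma cintegrable_bound f (P : T -> R[i]) : cmeas f -> cintegrable mu P ->
  (forall x, cmod (f x) <= cmod (P x)) -> cintegrable mu f.
Proof. by move=> mf /integrable_cmod iP fP; exact: cintegrable_le fP. Qed.

Lemma cintegrable_real t : mu.-integrable setT (EFin \o t) ->
  cintegrable mu (fun x => (t x)%:C).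
Proof. by move=> it; split=> //=; exact: integrable0. Qed.

Lemma cintegralD f g : cintegrable mu f -> cintegrable mu g ->
  cintegral mu (fun x => f x + g x) = cintegral mu f + cintegral mu g.
Proof.
move=> [f1 f2] [g1 g2]; apply: cplx_eq; rewrite ?ReD ?ImD /=.
- by rewrite -RintegralD//; apply: eq_Rintegral => x _; rewrite ReD.
- by rewrite -RintegralD//; apply: eq_Rintegral => x _; rewrite ImD.
Qed.

Lemma cintegralZ (c : R[i]) f : cintegrable mu f ->
  cintegral mu (fun x => c * f x) = c * cintegral mu f.
Proof.
move=> [f1 f2]; apply: cplx_eq; rewrite ?ReM ?ImM /=.
- rewrite -!RintegralZl// -RintegralB//.
  + by apply: eq_Rintegral => x _; rewrite ReM.
  + by have := integrableZl measurableT (complex.Re c) f1.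
  + by have := integrableZl measurableT (complex.Im c) f2.
- rewrite -!RintegralZl// -RintegralD//.
  + by apply: eq_Rintegral => x _; rewrite ImM.
  + by have := integrableZl measurableT (complex.Re c) f2.
  + by have := integrableZl measurableT (complex.Im c) f1.
Qed.

Lemma cintegrableZ (c : R[i]) f : cintegrable mu f ->
  cintegrable mu (fun x => c * f x).
Proof.
move=> fi; have := integrableZl measurableT (cmod c) (integrable_cmod fi).
move=> ic; apply: cintegrable_le ic _.
  by apply: cmeasM; [exact: cmeas_cst|exact: cintegrable_cmeas].
by move=> x; rewrite cmodM.
Qed.

Lemma cintegrableD f g : cintegrable mu f -> cintegrable mu g ->
  cintegrable mu (fun x => f x + g x).
Proof.
move=> fi gi; have := integrableD measurableT (integrable_cmod fi) (integrable_cmod gi).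
move=> ic; apply: cintegrable_le ic _; last by move=> x; exact: cmodD.
by apply: cmeasD; exact: cintegrable_cmeas.
Qed.

Lemma cintegralB f g : cintegrable mu f -> cintegrable mu g ->
  cintegral mu (fun x => f x - g x) = cintegral mu f - cintegral mu g.
Proof.
move=> fi gi; rewrite -[in RHS]mulN1r -cintegralZ// -cintegralD//.
  by congr cintegral; apply/funext => x; rewrite mulN1r.
exact: cintegrableZ.
Qed.

(* The sharp constant 1 would need a rotation argument; the constant never matters. *)
Lemma cmod_cintegral_le f u : cmeas f -> mu.-integrable setT (EFin \o u) ->
  (forall x, cmod (f x) <= u x) -> cmod (cintegral mu f) <= 2 * \int[mu]_x u x.
Proof.
move=> mf iu fu; have [f1 f2] := cintegrable_le mf iu fu.
rewrite (le_trans (cmod_le_ReIm _))//= mulr_natl mulr2n lerD//.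
- rewrite (le_trans (le_normr_Rintegral measurableT f1))//.
  apply: le_Rintegral => //; first exact: integrable_abse f1.
  by move=> x _; exact: le_trans (Re_le_cmod _) (fu x).
- rewrite (le_trans (le_normr_Rintegral measurableT f2))//.
  apply: le_Rintegral => //; first exact: integrable_abse f2.
  by move=> x _; exact: le_trans (Im_le_cmod _) (fu x).
Qed.

Lemma cdominated_convergence (f_ : nat -> T -> R[i]) f u :
  (forall n, cmeas (f_ n)) -> cmeas f ->
  (forall x, f_ ^~ x @ \oo --> f x) ->
  mu.-integrable setT (EFin \o u) ->
  (forall n x, cmod (f_ n x) <= u x) ->
  (fun n => cintegral mu (f_ n)) @ \oo --> cintegral mu f.
Proof.
move=> mf_ mf ff iu fu.
(* [p] stands for the real or the imaginary part; both are bounded by the modulus and so inherit the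
   majorant [u]. *)
have real_case (p : R[i] -> R) : (forall z, `|p z| <= cmod z) ->
    (forall x, p (f_ n x) @[n --> \oo] --> p (f x)) ->
    (forall n, measurable_fun setT (p \o f_ n)) -> measurable_fun setT (p \o f) ->
    (\int[mu]_x p (f_ n x)) @[n --> \oo] --> \int[mu]_x p (f x).
  move=> pz pf mpf_ mpf.
  have [|||||i1 _ i2] := @dominated_convergence _ _ _ mu setT measurableT
    (fun n => EFin \o (p \o f_ n)) (EFin \o (p \o f)) (EFin \o u).
  - by move=> n; exact/measurable_EFinP.
  - exact/measurable_EFinP.
  - by apply: aeW => x _ /=; apply/fine_cvgP; split; [exact: nearW|exact: pf].
  - exact: iu.
  - by apply: aeW => x n _ /=; rewrite lee_fin (le_trans (pz _)).
  - by apply: fine_cvg => //; rewrite /Rintegral fineK//; exact: integrable_fin_num.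
apply/ccvgP; split.
- apply: (real_case (@complex.Re R)) => [z|x|n|].
  + exact: Re_le_cmod.
  + by have /ccvgP[] := ff x.
  + exact: (mf_ n).1.
  + exact: mf.1.
- apply: (real_case (@complex.Im R)) => [z|x|n|].
  + exact: Im_le_cmod.
  + by have /ccvgP[] := ff x.
  + exact: (mf_ n).2.
  + exact: mf.2.
Qed.

End complex_integral.

Section complex_fubini.
Context {R : realType} d1 (T1 : measurableType d1) d2 (T2 : measurableType d2).
Variable m1 : {sigma_finite_measure set T1 -> \bar R}.
Variable m2 : {sigma_finite_measure set T2 -> \bar R}.
Implicit Types (t u : T1 * T2 -> R) (f : T1 * T2 -> R[i]).

(** The inner integral may fail to be finite on a null set, where [fine] makes it 0; the two outer
    integrands still agree almost everywhere. *)
Lemma Rfubini12 t : (m1 \x m2)%E.-integrable setT (EFin \o t) ->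
  \int[(m1 \x m2)%E]_z t z = \int[m1]_x \int[m2]_y t (x, y).
Proof.
move=> it; rewrite /Rintegral -(integral12_prod_meas1 it); congr fine.
have mF := measurable_fubini_F it.
apply: ae_eq_integral => //.
- apply/measurable_EFinP; apply: (measurableT_comp (fine_measurable _)) => //.
- apply: filterS (ae_integrable1 it) => x ix _.
  by rewrite /= fineK//; exact: integrable_fin_num ix.
Qed.

Lemma Rfubini21 t : (m1 \x m2)%E.-integrable setT (EFin \o t) ->
  \int[(m1 \x m2)%E]_z t z = \int[m2]_y \int[m1]_x t (x, y).
Proof.
move=> it; rewrite /Rintegral -(integral21_prod_meas1 it); congr fine.
have mG := measurable_fubini_G it.
apply: ae_eq_integral => //.
- apply/measurable_EFinP; apply: (measurableT_comp (fine_measurable _)) => //.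
- apply: filterS (ae_integrable2 it) => y iy _.
  by rewrite /= fineK//; exact: integrable_fin_num iy.
Qed.

Lemma cfubini12 f : cintegrable (m1 \x m2)%E f ->
  cintegral (m1 \x m2)%E f = cintegral m1 (fun x => cintegral m2 (fun y => f (x, y))).
Proof. by move=> [f1 f2]; apply: cplx_eq => /=; rewrite Rfubini12. Qed.

Lemma cfubini21 f : cintegrable (m1 \x m2)%E f ->
  cintegral (m1 \x m2)%E f = cintegral m2 (fun y => cintegral m1 (fun x => f (x, y))).
Proof. by move=> [f1 f2]; apply: cplx_eq => /=; rewrite Rfubini21. Qed.

(** Tonelli gives the measurability of the integrals of the positive and negative parts separately,
    so the statement holds even where the inner integral diverges. *)
Lemma measurable_Rintegral t : measurable_fun setT t ->
  measurable_fun setT (fun x => \int[m2]_y t (x, y)).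
Proof.
move=> mt; apply: (measurableT_comp (fine_measurable _)) => //.
have mEt : measurable_fun setT (EFin \o t) by exact/measurable_EFinP.
rewrite (_ : (fun _ => _) = (fun x => \int[m2]_y (EFin \o t)^\+ (x, y)) \-
    (fun x => \int[m2]_y (EFin \o t)^\- (x, y)))%E.
  apply: emeasurable_funB.
  - by apply: measurable_fun_fubini_tonelli_F => //; exact: measurable_funepos.
  - by apply: measurable_fun_fubini_tonelli_F => //; exact: measurable_funeneg.
by apply/funext => x; rewrite [LHS]integralE; congr (_ - _)%E;
  apply: eq_integral => y _; rewrite unlock.
Qed.

Lemma cmeas_cintegral f : cmeas f -> cmeas (fun x => cintegral m2 (fun y => f (x, y))).
Proof. by move=> [f1 f2]; split; [exact: measurable_Rintegral f1|exact: measurable_Rintegral f2]. Qed.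

(** Tonelli's criterion for a nonnegative [u], with real iterated integrals: the integrability of
    each slice makes the inner [Rintegral] equal to the extended one. *)
Lemma integrable_prod12 u : measurable_fun setT u -> (forall z, 0 <= u z) ->
  (forall x, m2.-integrable setT (fun y => (u (x, y))%:E)) ->
  m1.-integrable setT (fun x => (\int[m2]_y u (x, y))%:E) ->
  (m1 \x m2)%E.-integrable setT (EFin \o u).
Proof.
move=> mu u0 i2 i1; apply/integrable12ltyP; first exact/measurable_EFinP.
have /integrableP[_] := i1; apply: le_lt_trans.
rewrite le_eqVlt; apply/orP; left; apply/eqP; apply: eq_integral => x _.
rewrite gee0_abs ?lee_fin ?Rintegral_ge0//.
rewrite /Rintegral fineK; last exact: integrable_fin_num (i2 x).
by apply: eq_integral => y _; rewrite gee0_abs ?lee_fin.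
Qed.

Lemma integrable_prod21 u : measurable_fun setT u -> (forall z, 0 <= u z) ->
  (forall y, m1.-integrable setT (fun x => (u (x, y))%:E)) ->
  m2.-integrable setT (fun y => (\int[m1]_x u (x, y))%:E) ->
  (m1 \x m2)%E.-integrable setT (EFin \o u).
Proof.
move=> mu u0 i2 i1; apply/integrable21ltyP; first exact/measurable_EFinP.
have /integrableP[_] := i1; apply: le_lt_trans.
rewrite le_eqVlt; apply/orP; left; apply/eqP; apply: eq_integral => x _.
rewrite gee0_abs ?lee_fin ?Rintegral_ge0//.
rewrite /Rintegral fineK; last exact: integrable_fin_num (i2 x).
by apply: eq_integral => y _; rewrite gee0_abs ?lee_fin.
Qed.

Lemma integrable_tensor (a : T1 -> R) (b : T2 -> R) :
  m1.-integrable setT (EFin \o a) -> m2.-integrable setT (EFin \o b) ->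
  (forall x, 0 <= a x) -> (forall y, 0 <= b y) ->
  (m1 \x m2)%E.-integrable setT (EFin \o (fun z => a z.1 * b z.2)).
Proof.
move=> ia ib a0 b0.
have ma := measurable_int _ ia; have mb := measurable_int _ ib.
apply: integrable_prod12 => /=.
- apply: measurable_funM.
  + by apply: (measurableT_comp (f := a)) => //; exact/measurable_EFinP.
  + by apply: (measurableT_comp (f := b)) => //; exact/measurable_EFinP.
- by move=> z; rewrite mulr_ge0.
- by move=> x; have := integrableZl measurableT (a x) ib.
- under eq_fun do rewrite RintegralZl// mulrC.
  by have := integrableZl measurableT (\int[m2]_y b y) ia.
Qed.

Lemma cintegrable_tensor (a : T1 -> R[i]) (b : T2 -> R[i]) :
  cintegrable m1 a -> cintegrable m2 b ->
  cintegrable (m1 \x m2)%E (fun z => a z.1 * b z.2).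
Proof.
move=> ia ib; have := integrable_tensor (integrable_cmod ia) (integrable_cmod ib)
  (fun _ => cmod_ge0 _) (fun _ => cmod_ge0 _).
move=> /cintegrable_le; apply; last by move=> z; rewrite cmodM.
by apply: cmeasM; [exact: cmeas_comp (cintegrable_cmeas ia) _|
  exact: cmeas_comp (cintegrable_cmeas ib) _].
Qed.

Lemma cintegral_tensor (a : T1 -> R[i]) (b : T2 -> R[i]) :
  cintegrable m1 a -> cintegrable m2 b ->
  cintegral (m1 \x m2)%E (fun z => a z.1 * b z.2) = cintegral m1 a * cintegral m2 b.
Proof.
move=> ia ib; rewrite cfubini12/=; last exact: cintegrable_tensor.
under eq_fun do rewrite cintegralZ// mulrC.
by rewrite cintegralZ// mulrC.
Qed.

End complex_fubini.

Section change_of_variable.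
Context {R : realType} d1 (T1 : measurableType d1) d2 (T2 : measurableType d2).
Variables (m1 : {measure set T1 -> \bar R}) (m2 : {measure set T2 -> \bar R}).
Variables (phi : T1 -> T2) (c : R).
Hypothesis mphi : measurable_fun setT phi.
Hypothesis phiE : forall u : T2 -> \bar R, measurable_fun setT u ->
  (forall y, (0 <= u y)%E) ->
  (\int[m1]_x u (phi x) = c%:E * \int[m2]_y u y)%E.

(** The formula is assumed for nonnegative functions, where it can be proved by Tonelli or by
    uniqueness of measures. Integrability follows from its case [|t|], the real and complex formulas
    by splitting into positive and negative parts. *)
Lemma integrable_change (t : T2 -> R) : m2.-integrable setT (EFin \o t) ->
  m1.-integrable setT (EFin \o (t \o phi)).
Proof.
move=> /integrableP[mt it]; apply/integrableP; split.
  exact: (measurableT_comp mt mphi).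
rewrite (phiE (u := fun y => `|(t y)%:E|%E))//; last exact: measurableT_comp.
have : (\int[m2]_y `|(t y)%:E| \is a fin_num)%E.
  by rewrite ge0_fin_numE// integral_ge0.
by move=> /fineK <-; rewrite -EFinM ltry.
Qed.

Lemma Rintegral_change (t : T2 -> R) : m2.-integrable setT (EFin \o t) ->
  \int[m1]_x t (phi x) = c * \int[m2]_y t y.
Proof.
move=> it; have mt := measurable_int _ it.
have ipos := integrable_funepos measurableT it.
have ineg := integrable_funeneg measurableT it.
rewrite /Rintegral integralE (integralE _ _ (fun y => (t y)%:E)).
have -> : (\int[m1]_x (fun x => (t (phi x))%:E)^\+ x = c%:E * \int[m2]_y (EFin \o t)^\+ y)%E.
  rewrite -phiE; [|exact: measurable_funepos mt|by []].
  by apply: eq_integral => x _; rewrite unlock.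
have -> : (\int[m1]_x (fun x => (t (phi x))%:E)^\- x = c%:E * \int[m2]_y (EFin \o t)^\- y)%E.
  rewrite -phiE; [|exact: measurable_funeneg mt|by []].
  by apply: eq_integral => x _; rewrite unlock.
have /fineK <- := integrable_fin_num measurableT ipos.
have /fineK <- := integrable_fin_num measurableT ineg.
by rewrite /= -?EFinM -?EFinB /= mulrBr.
Qed.

Lemma cintegrable_change (f : T2 -> R[i]) : cintegrable m2 f ->
  cintegrable m1 (fun x => f (phi x)).
Proof. by move=> [f1 f2]; split; [exact: integrable_change f1|exact: integrable_change f2]. Qed.

Lemma cintegral_change (f : T2 -> R[i]) : cintegrable m2 f ->
  cintegral m1 (fun x => f (phi x)) = c%:C * cintegral m2 f.
Proof.
move=> [f1 f2]; apply: cplx_eq; rewrite ?ReM ?ImM /=.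
- by rewrite (Rintegral_change f1) mul0r subr0.
- by rewrite (Rintegral_change f2) mul0r addr0.
Qed.

End change_of_variable.

(** * Lebesgue measure on R^d *)

Section borel_rV.
Context {R : realType} {d : nat}.

Lemma measurable_box (A : 'I_d -> set R) : (forall i, measurable (A i)) ->
  measurable [set x : 'rV[R]_d | forall i, A i (x ord0 i)].
Proof.
move=> mA; rewrite (_ : [set _ | _] =
    \big[setI/setT]_(i < d) ((fun x : 'rV[R]_d => x ord0 i) @^-1` A i)).
  apply: bigsetI_measurable => i _; rewrite -[X in measurable X]setTI.
  exact: measurable_coord.
rewrite -bigcap_seq; apply/seteqP; split=> x /= xA i; first by move=> _; exact: xA.
by apply: xA; rewrite /= mem_index_enum.
Qed.

Lemma rV_ballP (x y : 'rV[R]_d) e : 0 < e ->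
  ball x e y <-> forall i, `|x ord0 i - y ord0 i| < e.
Proof.
move=> e0; split=> [[_ xy] i|xy]; first exact: xy.
by split=> // i j; rewrite ord1; exact: xy.
Qed.

Lemma rV_rat_approx (x : 'rV[R]_d) (e : R) : 0 < e ->
  exists q : 'rV[rat]_d, forall i, `|x ord0 i - ratr (q ord0 i)| < e.
Proof.
move=> e0.
have /choice[q qx] : forall i : 'I_d, exists r : rat, `|x ord0 i - ratr r| < e.
  move=> i; have : x ord0 i - e < x ord0 i + e by rewrite ltrD2l gtrN.
  move=> /rat_in_itvoo[r]; rewrite in_itv/= => /andP[r1 r2]; exists r.
  by rewrite distrC ltr_distl r1 r2.
by exists (\row_i q i) => i; rewrite mxE.
Qed.

(** The sigma-algebra is generated by the coordinates, so an open set has to be exhibited as a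
    countable union of boxes: the cubes with rational centre and radius 1/(n+1) that are contained
    in [U]. *)
Lemma open_measurable_rV (U : set 'rV[R]_d) : open U -> measurable U.
Proof.
move=> oU.
pose B (p : 'rV[rat]_d * nat) := [set x : 'rV[R]_d | forall i,
  ball (ratr (p.1 ord0 i) : R) (p.2.+1%:R^-1) (x ord0 i)].
have -> : U = \bigcup_(p in [set: 'rV[rat]_d * nat]) (if `[< B p `<=` U >] then B p else set0).
  apply/seteqP; split=> x; last by move=> [p _]; case: ifPn => // /asboolP + Bx; apply.
  move=> Ux; have /nbhs_ballP[e /= e0 xe] := open_nbhs_nbhs (conj oU Ux).
  (* Radius below [e / 2]: a cube of this radius that contains [x] lies in the [e]-ball around
     [x]. *)
  have [n ne] : exists n : nat, n.+1%:R^-1 < e / 2.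
    have e20 : 0 < e / 2 by rewrite divr_gt0.
    have [n _ /(_ n (leqnn n))] := near_infty_natSinv_lt (PosNum e20).
    by exists n.
  have [|q qx] := @rV_rat_approx x n.+1%:R^-1; first by rewrite invr_gt0.
  exists (q, n) => //; rewrite ifT; first by move=> i; rewrite /ball/= distrC; exact: qx.
  apply/asboolP => y By; apply: xe; apply/rV_ballP => // i.
  have := By i; rewrite /ball/= => Byi.
  rewrite -(subrK (ratr (q ord0 i)) (x ord0 i)) -addrA.
  rewrite (le_lt_trans (ler_normD _ _))// [ltRHS]splitr ltrD//.
    exact: lt_trans (qx i) ne.
  exact: lt_trans Byi ne.
apply: countable_bigcupT_measurable => // p; case: ifPn => // _.
by apply: (@measurable_box (fun i => ball (ratr (p.1 ord0 i) : R) p.2.+1%:R^-1)) => i; exact: measurable_ball.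
Qed.

Lemma continuous_measurable_rV (f : 'rV[R]_d -> R) :
  continuous f -> measurable_fun setT f.
Proof.
move=> /continuousP cf; apply: (measurability _ (RGenOpens.measurableE R)).
move=> _ [_ [a [b ->] <-]]; rewrite setTI; apply: open_measurable_rV.
exact/cf/interval_open.
Qed.

Lemma continuous_cmeas (f : 'rV[R]_d -> R[i]) : continuous f -> cmeas f.
Proof.
by move=> /ccontinuousP[f1 f2]; split; exact: continuous_measurable_rV.
Qed.

End borel_rV.

Section lebesgue_affine.
Context {R : realType}.
Local Open Scope ereal_scope.

(** The image of Lebesgue measure under x -> c x + a, scaled by |c|, agrees with Lebesgue measure on
    half-open intervals, hence equals it by uniqueness. *)
Lemma lebesgue_affine (c a : R) (u : measurableTypeR R -> \bar R) : (c != 0)%R ->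
  measurable_fun setT u -> (forall x, 0 <= u x) ->
  \int[@lebesgue_measure R]_x u (c * x + a)%R =
  (`|c|^-1)%:E * \int[@lebesgue_measure R]_x u x.
Proof.
move=> c0 mu u0; pose phi : measurableTypeR R -> measurableTypeR R := fun x => (c * x + a)%R.
have mphi : measurable_fun setT phi.
  by apply: measurable_funD => //; exact: mulrl_measurable.
have c_ge0 : (0 <= `|c|)%R by [].
pose m : {measure set _ -> \bar R} :=
  mscale (NngNum c_ge0)
    (measure_function_pushforward__canonical__measure_function_Measure
      (@lebesgue_measure R) mphi).
have loc (p q : R) : @lebesgue_measure R `]p, q]%classic = (if p < q then q - p else 0)%R%:E.
  by rewrite lebesgue_measure_itv/= lte_fin; case: ifPn.
have lco (p q : R) : @lebesgue_measure R `[p, q[%classic = (if p < q then q - p else 0)%R%:E.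
  by rewrite lebesgue_measure_itv/= lte_fin; case: ifPn.
have mE X : ocitv X -> @lebesgue_measure R X = m X.
  move=> [[x y] _ <-] /=.
  transitivity (`|c|%:E * @lebesgue_measure R (phi @^-1` `]x, y]%classic)); last by [].
  have [cpos|cneg|/eqP] := ltgtP 0%R c; last by rewrite eq_sym (negbTE c0).
  - rewrite (_ : phi @^-1` _ = `](x - a) / c, (y - a) / c]%classic)%R; last first.
      apply/seteqP; split => z; rewrite /phi /= !in_itv /= ltr_pdivrMr// ler_pdivlMr//;
      by rewrite ltrBlDr lerBrDr mulrC.
    rewrite !loc -EFinM; congr EFin; rewrite ltr_pM2r ?invr_gt0// ltrD2r.
    case: ifPn => _; last by rewrite mulr0.
    by rewrite gtr0_norm//; field; rewrite gt_eqF.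
  (* A negative slope reverses the interval, so the preimage is closed on the left and open on the
     right. *)
  - rewrite (_ : phi @^-1` _ = `[(y - a) / c, (x - a) / c[%classic)%R; last first.
      apply/seteqP; split => z; rewrite /phi /= !in_itv /= ltr_ndivlMr// ler_ndivrMr//;
      by rewrite ltrBlDr lerBrDr mulrC andbC.
    rewrite loc lco -EFinM; congr EFin; rewrite ltr_nM2r ?invr_lt0// ltrD2r.
    case: ifPn => _; last by rewrite mulr0.
    by rewrite ltr0_norm//; field; rewrite lt_eqF.
have -> : \int[@lebesgue_measure R]_x u x = \int[m]_x u x.
  by apply: eq_measure_integral => A mA _; exact: lebesgue_measure_unique.
rewrite ge0_integral_mscale//= muleA -EFinM mulVf ?normr_eq0// mul1e.
by rewrite ge0_integral_pushforward.
Qed.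

Lemma lebesgue_affineZ (k c a : R) (u : measurableTypeR R -> \bar R) :
  (0 <= k)%R -> (c != 0)%R -> measurable_fun setT u -> (forall x, 0 <= u x) ->
  \int[@lebesgue_measure R]_x (k%:E * u (c * x + a)%R) =
  (k * `|c|^-1)%:E * \int[@lebesgue_measure R]_x u x.
Proof.
move=> k0 c0 mu u0; rewrite ge0_integralZl//.
  by rewrite lebesgue_affine// muleA -EFinM.
by apply: (measurableT_comp mu); apply: measurable_funD => //; exact: mulrl_measurable.
Qed.

Lemma integral_lebesgue_rVS n (u : 'rV[R]_n.+1 -> \bar R) :
  measurable_fun setT u -> (forall x, 0 <= u x) ->
  \int[lebesgue_rV R n.+1]_x u x =
  \int[(@lebesgue_measure R \x lebesgue_rV R n)%E]_p u (rV_cons p).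
Proof.
move=> mu u0; rewrite /= /lebesgue_rV_step ge0_integral_pushforward//.
exact: measurable_rV_cons.
Qed.

Lemma measurable_rV_affine d (c : R) (a : 'rV[R]_d) :
  measurable_fun setT (fun x : 'rV[R]_d => (c *: x + a)%R).
Proof.
apply/measurable_fun_rVP => i.
rewrite (_ : _ \o _ = fun x : 'rV[R]_d => (c * x ord0 i + a ord0 i)%R).
  apply: measurable_funD => //; apply: measurable_funM => //.
  exact: measurable_coord.
by apply/funext => x; rewrite /= !mxE.
Qed.

(** Induction on the dimension: Tonelli separates the head coordinate, and each coordinate
    contributes one factor |c|^-1. *)
Lemma lebesgue_rV_affine d (c : R) (a : 'rV[R]_d) (u : 'rV[R]_d -> \bar R) :
  (c != 0)%R -> measurable_fun setT u -> (forall x, 0 <= u x) ->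
  \int[lebesgue_rV R d]_x u (c *: x + a)%R =
  (`|c|^-1 ^+ d)%:E * \int[lebesgue_rV R d]_x u x.
Proof.
move=> c0; elim: d a u => [|n IH] a u mu u0.
  rewrite expr0 mul1e; apply: eq_integral => x _; congr u.
  by apply/rowP; case.
have mua : measurable_fun setT (fun x : 'rV[R]_n.+1 => u (c *: x + a)%R).
  exact: measurableT_comp mu (measurable_rV_affine _ _).
rewrite !integral_lebesgue_rVS// !fubini_tonelli1//; last 2 first.
- exact: measurableT_comp mu (@measurable_rV_cons R n).
- exact: measurableT_comp mua (@measurable_rV_cons R n).
pose a' := (\row_k a ord0 (lift ord0 k))%R : 'rV[R]_n.
have consE t x : (c *: rV_cons (t, x) + a)%R = rV_cons (c * t + a ord0 ord0, c *: x + a')%R.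
  apply/rowP => i; rewrite !mxE /=; case: (unliftP ord0 i) => [k|] -> /=; by rewrite ?mxE.
have mcons t : measurable_fun setT (fun x : 'rV[R]_n => u (rV_cons (t, x))).
  apply: (measurableT_comp mu); apply: (measurableT_comp (@measurable_rV_cons R n)).
  exact: measurable_pair1.
pose U (t : measurableTypeR R) := \int[lebesgue_rV R n]_y u (rV_cons (t, y)).
have mU : measurable_fun setT U.
  apply: (@measurable_fun_fubini_tonelli_F _ _ _ _ _ _ (u \o @rV_cons R n)) => [|p].
    exact: measurableT_comp mu (@measurable_rV_cons R n).
  exact: u0.
have U0 t : 0 <= U t by apply: integral_ge0.
transitivity (\int[@lebesgue_measure R]_t ((`|c|^-1 ^+ n)%:E * U (c * t + a ord0 ord0)%R)).
  apply: eq_integral => t _; rewrite /fubini_F /U -(IH a')//.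
  by apply: eq_integral => y _; rewrite consE.
by rewrite lebesgue_affineZ ?exprn_ge0// exprSr.
Qed.

End lebesgue_affine.

Section product_functions.
Context {R : realType}.

(** The factor [1%:E] gives the formula the shape of the change of variable hypothesis, with
    [c = 1]. *)
Lemma lebesgue_rV_uncons n (u : measurableTypeR R * 'rV[R]_n -> \bar R) :
  measurable_fun setT u -> (forall x, (0 <= u x)%E) ->
  (\int[lebesgue_rV R n.+1]_x u (rV_uncons x) =
   1%:E * \int[(@lebesgue_measure R \x lebesgue_rV R n)%E]_p u p)%E.
Proof.
move=> mu u0; rewrite (integral_lebesgue_rVS (u := u \o @rV_uncons R n))//.
- by rewrite mul1e; apply: eq_integral => p _; rewrite /= rV_consK.
- exact: measurableT_comp mu (@measurable_rV_uncons R n).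
- by move=> x; exact: u0.
Qed.

(** Integrability and value are proved together, since the tensor formula for the head coordinate
    needs the integrability of the tail. For d = 0 the measure is a Dirac mass and the empty product
    is 1. *)
Lemma cintegral_prod d (k : 'I_d -> R -> R[i]) :
  (forall i, cintegrable (@lebesgue_measure R) (k i)) ->
  cintegrable (lebesgue_rV R d) (fun x => \prod_i k i (x ord0 i)) /\
  cintegral (lebesgue_rV R d) (fun x => \prod_i k i (x ord0 i)) =
  \prod_i cintegral (@lebesgue_measure R) (k i).
Proof.
elim: d k => [|n IH] k ik.
  rewrite big_ord0 (_ : (fun _ => _) = (fun _ => 1)); last first.
    by apply/funext => x; rewrite big_ord0.
  have int0 (t : R) : (\int[lebesgue_rV R 0]_x t%:E = t%:E)%E.
    transitivity (\d_((0 : 'rV[R]_0)%R) [set: 'rV[R]_0] * t%:E)%E.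
      by apply: integral_dirac.
    by rewrite diracT mul1e.
  have i1 : (lebesgue_rV R 0).-integrable setT (EFin \o cst (1 : R)).
    apply/integrableP; split.
      by apply/measurable_EFinP; exact: measurable_cst.
    under eq_integral do rewrite /= normr1.
    by rewrite int0 ltry.
  split; first exact: (cintegrable_real i1).
  by apply: cplx_eq; rewrite /= /Rintegral /= int0.
have [IH1 IH2] := IH (fun i => k (lift ord0 i)) (fun i => ik _).
pose F (p : measurableTypeR R * 'rV[R]_n) :=
  k ord0 p.1 * \prod_i k (lift ord0 i) (p.2 ord0 i).
have iF : cintegrable (@lebesgue_measure R \x lebesgue_rV R n)%E F.
  by have := cintegrable_tensor (ik ord0) IH1.
have FE : (fun x : 'rV[R]_n.+1 => \prod_i k i (x ord0 i)) = (fun x => F (rV_uncons x)).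
  apply/funext => x; rewrite big_ord_recl /F /=; congr (_ * _).
  by apply: eq_bigr => i _; rewrite mxE.
rewrite FE; split; first exact: cintegrable_change (@measurable_rV_uncons _ _) (@lebesgue_rV_uncons n) _ iF.
rewrite (cintegral_change (@lebesgue_rV_uncons n) iF) mul1r.
have -> : cintegral (@lebesgue_measure R \x lebesgue_rV R n)%E F = _ :=
  cintegral_tensor (ik ord0) IH1.
by rewrite IH2 big_ord_recl.
Qed.

End product_functions.

(** * Integrals on the line: the Cauchy and Laplace kernels *)

Section line_integrals.
Context {R : realType}.
Let mu := @lebesgue_measure R.

Lemma lebesgue_opp (u : measurableTypeR R -> \bar R) :
  measurable_fun setT u -> (forall x, (0 <= u x)%E) ->
  (\int[mu]_x u (- x)%R = 1%:E * \int[mu]_x u x)%E.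
Proof.
move=> mu_ u0; rewrite -[1]invr1 -[1 in X in X^-1]normr1 -normrN.
have N1 : (-1 : R) != 0 by rewrite oppr_eq0 oner_eq0.
rewrite -(lebesgue_affine 0 N1)//.
by apply: eq_integral => x _; rewrite mulN1r addr0.
Qed.

Lemma Rintegral_odd (t : R -> R) : mu.-integrable setT (EFin \o t) ->
  (forall x, t (- x) = - t x) -> \int[mu]_x t x = 0.
Proof.
move=> it todd.
have mopp : measurable_fun [set: measurableTypeR R] (fun x : measurableTypeR R => - x : measurableTypeR R).
  exact: oppr_measurable.
have := Rintegral_change lebesgue_opp it; rewrite mul1r.
under eq_Rintegral do rewrite todd -mulN1r.
rewrite RintegralZl// mulN1r => /eqP; rewrite eq_sym -subr_eq0 opprK -mulr2n.
by rewrite mulrn_eq0 /= => /eqP.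
Qed.

Lemma integral_oneDsqrV : (\int[mu]_x ((1 + x ^+ 2)^-1)%:E = pi%:E)%E.
Proof.
rewrite (ge0_symfun_integralT (f := fun x => (1 + x ^+ 2)^-1)).
- rewrite -set_itvcy (_ : (\int[_]_(x in _) _ = (pi / 2)%:E)%E); last first.
    exact: integral0y_oneDsqr.
  by rewrite -EFinM; congr EFin; field.
- by move=> x; rewrite invr_ge0 addr_ge0// sqr_ge0.
- exact: continuous_oneDsqrV.
- by move=> x /=; rewrite sqrrN.
Qed.

Lemma integrable_oneDsqrV : mu.-integrable setT (EFin \o (fun x => (1 + x ^+ 2)^-1)).
Proof.
apply/integrableP; split.
  by apply/measurable_EFinP; apply: continuous_measurable_fun; exact: continuous_oneDsqrV.
under eq_integral.
  move=> x _; rewrite gee0_abs; last by rewrite lee_fin invr_ge0 addr_ge0// sqr_ge0.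
  over.
by rewrite integral_oneDsqrV ltry.
Qed.

Lemma continuous_expN : continuous (fun t : R => expR (- t)).
Proof.
apply: (continuous_compR (f := fun t => - t)); last exact: continuous_expR.
exact: opp_continuous.
Qed.

Lemma continuous_expNnorm : continuous (fun t : R => expR (- `|t|)).
Proof.
apply: (continuous_compR (g := fun t => expR (- t))); last exact: continuous_expN.
exact: norm_continuous.
Qed.

(** The added 1 makes the integrand nonnegative, so that evenness and the fundamental theorem of
    calculus on the half-line apply before integrability is known. Both the mass and the Fourier
    transform of exp(-|t|) are then read off. *)
Lemma integral_expNnorm_cos1 (v : R) :
  (\int[mu]_t (expR (- `|t|) * (cos (t * v) + 1))%:E =
   (2 / (1 + v ^+ 2) + 2)%:E)%E.
Proof.
have cosge0 (t : R) : 0 <= cos (t * v) + 1 by rewrite -lerBlDr sub0r cos_geN1.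
have ccos : continuous (fun t : R => cos (t * v) + 1).
  have cmulv : continuous (fun t : R => t * v).
    by move=> x; apply: cvgM; [exact: cvg_id|exact: cvg_cst].
  move=> t; apply: cvgD; last exact: cvg_cst.
  exact: (continuous_compR cmulv (@continuous_cos R)).
rewrite (ge0_symfun_integralT (f := fun t => expR (- `|t|) * (cos (t * v) + 1))); first last.
- by move=> t /=; rewrite normrN mulNr cosN.
- by move=> t; apply: cvgM; [exact: continuous_expNnorm|exact: ccos].
- by move=> t; rewrite mulr_ge0// expR_ge0.
have v0 : 1 + v ^+ 2 != 0 by rewrite gt_eqF// ltr_pwDl// sqr_ge0.
(* An antiderivative of exp(-t) (cos (t v) + 1) that vanishes at infinity, with F(0) = - 1 / (1 +
   v^2) - 1. *)
pose F (t : R) := expR (- t) * ((v * sin (t * v) - cos (t * v)) / (1 + v ^+ 2) - 1).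
have dF (t : R) : is_derive t 1 F (expR (- t) * (cos (t * v) + 1)).
  rewrite /F.
  apply: is_derive_eq; rewrite /GRing.scale /=; field.
  exact: v0.
have Fbound (t : R) : `|F t| <= expR (- t) * ((`|v| + 1) / (1 + v ^+ 2) + 1).
  rewrite /F normrM ger0_norm ?expR_ge0// ler_wpM2l ?expR_ge0//.
  rewrite (le_trans (ler_normB _ _))// normr1 lerD2r normrM.
  rewrite [X in _ * X]ger0_norm ?invr_ge0 ?addr_ge0 ?sqr_ge0// ler_wpM2r ?invr_ge0 ?addr_ge0 ?sqr_ge0//.
  rewrite (le_trans (ler_normB _ _))// lerD ?cos_max// normrM.
  by rewrite ler_piMr// sin_max.
rewrite -set_itvcy.
have -> : (\int[mu]_(t in `[0%R, +oo[) (expR (- `|t|) * (cos (t * v) + 1))%:E =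
    \int[mu]_(t in `[0%R, +oo[) (expR (- t) * (cos (t * v) + 1))%:E)%E.
  apply: eq_integral.
  by move=> t; rewrite inE/= in_itv/= andbT => t0; rewrite ger0_norm.
rewrite (ge0_continuous_FTC2y (F := F) (l := 0)).
- rewrite -EFinB -EFinM; congr EFin; rewrite /F oppr0 expR0 mul0r sin0 cos0.
  by field.
- by move=> t _; rewrite mulr_ge0// expR_ge0.
- apply: continuous_subspaceT => t; apply: cvgM; last exact: ccos.
  exact: continuous_expN.
- apply/norm_cvg0P; set K := (`|v| + 1) / (1 + v ^+ 2) + 1 in Fbound.
  apply: (@squeeze_cvgr _ _ _ _ (fun=> 0) (fun t => expR (- t) * K)).
  + by apply: nearW => t /=; rewrite normr_ge0 /= Fbound.
  + exact: cvg_cst.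
  + rewrite -(mul0r K); apply: cvgM; last exact: cvg_cst.
    exact: cvgr_expR.
- by move=> t _; apply: ex_derive.
- by apply: cvg_at_right_filter; apply: differentiable_continuous; apply/derivable1_diffP; apply: ex_derive.
- by move=> t _; rewrite derive1E derive_val.
Qed.

Lemma integral_expNnorm : (\int[mu]_t (expR (- `|t|))%:E = 2%:E)%E.
Proof.
(* For v = 0 the integrand is 2 exp(-|t|) and the value is 4. *)
have := integral_expNnorm_cos1 0.
under eq_integral do rewrite mulr0 cos0 mulrC EFinM.
rewrite ge0_integralZl//; first last.
- apply/measurable_EFinP; apply: continuous_measurable_fun.
  exact: continuous_expNnorm.
rewrite expr0n addr0 divr1.
case: (\int[mu]_t _)%E => [r| |]//.
- by rewrite -EFinM => -[r4]; congr EFin; lra.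
- by rewrite gt0_muley// lte_fin.
- by rewrite gt0_muleNy// lte_fin.
Qed.

Lemma integrable_expNnorm : mu.-integrable setT (EFin \o (fun t => expR (- `|t|))).
Proof.
apply/integrableP; split.
  by apply/measurable_EFinP; apply: continuous_measurable_fun; exact: continuous_expNnorm.
under eq_integral.
  move=> x _; rewrite gee0_abs; last by rewrite lee_fin expR_ge0.
  over.
by rewrite integral_expNnorm ltry.
Qed.

Lemma cintegrable_expNnorm (v : R) :
  cintegrable mu (fun t => (expR (- `|t|))%:C * cexpi (t * v)).
Proof.
apply: cintegrable_le integrable_expNnorm _.
  apply: cmeasM; first by apply: cmeas_real; apply: continuous_measurable_fun; exact: continuous_expNnorm.
  by apply: cmeas_cexpi; apply: measurable_funM.
by move=> t; rewrite cmodM cmod_cexpi mulr1 cmod_real ger0_norm ?expR_ge0.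
Qed.

(** The real part is [integral_expNnorm_cos1] minus the mass 2 of the kernel; the imaginary part is
    the integral of an odd function. *)
Lemma cintegral_expNnorm (v : R) :
  cintegral mu (fun t => (expR (- `|t|))%:C * cexpi (t * v)) = (2 / (1 + v ^+ 2))%:C.
Proof.
have [iRe iIm] := cintegrable_expNnorm v; apply: cplx_eq => /=.
- have := integral_expNnorm_cos1 v.
  pose g (t : R) := (expR (- `|t|))%:C * cexpi (t * v).
  under eq_integral => t _.
    rewrite (_ : _%:E = (complex.Re (g t))%:E + (expR (- `|t|))%:E)%E; last first.
      by rewrite /g ReM /= mul0r subr0 mulrDr mulr1 EFinD.
    over.
  rewrite integralD//; last exact: integrable_expNnorm.
  rewrite integral_expNnorm /Rintegral.
  have /fineK <- := integrable_fin_num measurableT iRe.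
  by rewrite -EFinD => -[/addIr].
- apply: Rintegral_odd => // t.
  by rewrite /= !mul0r !addr0 normrN mulNr sinN mulrN.
Qed.

End line_integrals.

Section dot_facts.
Context {R : realType} {d : nat}.
Implicit Types (x y z : 'rV[R]_d) (c : R).

Lemma dotC x y : dot x y = dot y x.
Proof. by apply: eq_bigr => i _; rewrite mulrC. Qed.

Lemma dotDr x y z : dot x (y + z) = dot x y + dot x z.
Proof. by rewrite -big_split; apply: eq_bigr => i _; rewrite mxE mulrDr. Qed.

Lemma dotDl x y z : dot (y + z) x = dot y x + dot z x.
Proof. by rewrite dotC dotDr !(dotC x). Qed.

Lemma dotZr c x y : dot x (c *: y) = c * dot x y.
Proof. by rewrite /dot mulr_sumr; apply: eq_bigr => i _; rewrite mxE mulrCA. Qed.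

Lemma dotZl c x y : dot (c *: x) y = c * dot x y.
Proof. by rewrite dotC dotZr dotC. Qed.

Lemma dotNr x y : dot x (- y) = - dot x y.
Proof. by rewrite -scaleN1r dotZr mulN1r. Qed.

Lemma dotNl x y : dot (- x) y = - dot x y.
Proof. by rewrite dotC dotNr dotC. Qed.

Lemma dot0r x : dot x 0 = 0.
Proof. by apply: big1 => i _; rewrite mxE mulr0. Qed.

Lemma continuous_coord (i : 'I_d) : continuous (fun x : 'rV[R]_d => x ord0 i).
Proof. exact: coord_continuous. Qed.

Lemma continuous_sum_ord (T : topologicalType) n (f : 'I_n -> T -> R) :
  (forall i, continuous (f i)) -> continuous (fun x : T => \sum_(i < n) f i x).
Proof.
elim: n f => [|n IH] f cf.
  by under eq_fun do rewrite big_ord0; exact: continuous_cstR.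
under eq_fun do rewrite big_ord_recl.
by apply: continuous_addR; [exact: cf|apply: IH => i; exact: cf].
Qed.

Lemma continuous_prod_ord (T : topologicalType) n (f : 'I_n -> T -> R) :
  (forall i, continuous (f i)) -> continuous (fun x : T => \prod_(i < n) f i x).
Proof.
elim: n f => [|n IH] f cf.
  by under eq_fun do rewrite big_ord0; exact: continuous_cstR.
under eq_fun do rewrite big_ord_recl.
by apply: continuous_mulR; [exact: cf|apply: IH => i; exact: cf].
Qed.

Lemma continuous_dot x : continuous (dot x).
Proof.
apply: continuous_sum_ord => i; apply: continuous_mulR.
  exact: continuous_cstR.
exact: continuous_coord.
Qed.

Lemma continuous_dotxx : continuous (fun x : 'rV[R]_d => dot x x).
Proof.
by apply: continuous_sum_ord => i; apply: continuous_mulR; exact: continuous_coord.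
Qed.

Lemma measurable_dot d1 (T : measurableType d1) (f g : T -> 'rV[R]_d) :
  measurable_fun setT f -> measurable_fun setT g ->
  measurable_fun setT (fun t => dot (f t) (g t)).
Proof.
move=> mf mg; rewrite /dot; apply: measurable_sum => i.
by apply: measurable_funM;
  [exact: (measurableT_comp (measurable_coord i) mf)|
   exact: (measurableT_comp (measurable_coord i) mg)].
Qed.

Lemma measurable_rV_sub d1 (T : measurableType d1) (f g : T -> 'rV[R]_d) :
  measurable_fun setT f -> measurable_fun setT g ->
  measurable_fun setT (fun t => f t - g t).
Proof.
move=> mf mg; apply/measurable_fun_rVP => i.
rewrite (_ : _ \o _ = fun t => f t ord0 i - g t ord0 i); last first.
  by apply/funext => t; rewrite /= !mxE.
apply: measurable_funB.
- exact: (measurableT_comp (measurable_coord i) mf).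
- exact: (measurableT_comp (measurable_coord i) mg).
Qed.

End dot_facts.

Section weight.
Context {R : realType} {d : nat}.
Implicit Types (x y : 'rV[R]_d).

Definition weight x : R := \prod_(i < d) (1 + x ord0 i ^+ 2).

Lemma weight_ge1 x : 1 <= weight x.
Proof.
by rewrite /weight; elim/big_ind: _ => // [a b a1 b1|i _];
  [exact: mulr_ege1|rewrite lerDl sqr_ge0].
Qed.

Lemma weight_gt0 x : 0 < weight x.
Proof. exact: lt_le_trans (weight_ge1 x). Qed.

Lemma weight_neq0 x : weight x != 0.
Proof. by rewrite gt_eqF// weight_gt0. Qed.

Lemma weightV_ge0 x : 0 <= (weight x)^-1.
Proof. by rewrite invr_ge0 ltW// weight_gt0. Qed.

Lemma weightV_le1 x : (weight x)^-1 <= 1.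
Proof. by rewrite invf_le1 ?weight_gt0// weight_ge1. Qed.

Lemma cmod_weightV x : cmod ((weight x)^-1)%:C = (weight x)^-1.
Proof. by rewrite cmod_real ger0_norm// weightV_ge0. Qed.

Lemma weightN x : weight (- x) = weight x.
Proof. by apply: eq_bigr => i _; rewrite mxE sqrrN. Qed.

Lemma coord_le_weight x i : `|x ord0 i| <= weight x.
Proof.
have h : `|x ord0 i| <= 1 + x ord0 i ^+ 2.
  by rewrite -real_normK ?num_real//; nra.
apply: (le_trans h); rewrite /weight (bigD1 i)//= ler_peMr ?addr_ge0 ?sqr_ge0//.
by elim/big_ind: _ => // [a b a1 b1|j _];
  [exact: mulr_ege1|rewrite lerDl sqr_ge0].
Qed.

(** Peetre's inequality for the product weight. In each coordinate 2 (1 + a^2) (1 + b^2) - (1 + (a +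
    b)^2) = 1 + (a - b)^2 + 2 (a b)^2. *)
Lemma weightD x y : weight (x + y) <= 2 ^+ d * (weight x * weight y).
Proof.
rewrite /weight -big_split -[in X in _ ^+ X](card_ord d) -prodr_const -big_split /=.
apply: ler_prod => i _; rewrite addr_ge0 ?sqr_ge0//= mxE.
by have := sqr_ge0 (x ord0 i - y ord0 i);
  have := sqr_ge0 (x ord0 i * y ord0 i); rewrite !expr2; nra.
Qed.

Lemma continuous_weight : continuous weight.
Proof.
apply: continuous_prod_ord => i; apply: continuous_addR.
  exact: continuous_cstR.
by apply: continuous_mulR; exact: continuous_coord.
Qed.

Lemma continuous_weightV : continuous (fun x => (weight x)^-1).
Proof. by move=> x; exact: (cvgV (weight_neq0 x) (@continuous_weight x)). Qed.

Lemma weightV_prod x : ((weight x)^-1)%:C = \prod_i ((1 + x ord0 i ^+ 2)^-1)%:C.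
Proof. by rewrite /weight -prodfV rmorph_prod. Qed.

Lemma cintegrable_weightV : cintegrable (lebesgue_rV R d) (fun x => ((weight x)^-1)%:C).
Proof.
under eq_fun do rewrite weightV_prod.
apply: (cintegral_prod (k := fun _ t => ((1 + t ^+ 2)^-1)%:C) _).1 => _.
exact: (cintegrable_real integrable_oneDsqrV).
Qed.

Lemma integrable_weightV : (lebesgue_rV R d).-integrable setT (EFin \o (fun x => (weight x)^-1)).
Proof. by have [+ _] := cintegrable_weightV. Qed.

Lemma cintegral_weightV : cintegral (lebesgue_rV R d) (fun x => ((weight x)^-1)%:C) = (pi ^+ d)%:C.
Proof.
under eq_fun do rewrite weightV_prod.
have /= -> := (@cintegral_prod R d (fun _ t => ((1 + t ^+ 2)^-1)%:C)
  (fun _ => cintegrable_real integrable_oneDsqrV)).2.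
rewrite prodr_const card_ord rmorphXn /=; congr (_ ^+ _).
apply: cplx_eq => /=.
  by rewrite /Rintegral integral_oneDsqrV.
by rewrite /Rintegral integral0.
Qed.

End weight.

Section rV_change_of_variable.
Context {R : realType} {d : nat}.
Implicit Types (f : 'rV[R]_d -> R[i]) (t : 'rV[R]_d -> R) (a x : 'rV[R]_d).
Let mu := lebesgue_rV R d.

Lemma cintegrable_affine c a f : c != 0 -> cintegrable mu f ->
  cintegrable mu (fun x => f (c *: x + a)).
Proof.
move=> c0; apply: cintegrable_change; first exact: measurable_rV_affine.
by move=> u; exact: (lebesgue_rV_affine a c0).
Qed.

Lemma cintegral_affine c a f : c != 0 -> cintegrable mu f ->
  cintegral mu (fun x => f (c *: x + a)) = (`|c|^-1 ^+ d)%:C * cintegral mu f.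
Proof. by move=> c0; apply: cintegral_change => u; exact: (lebesgue_rV_affine a c0). Qed.

Lemma integrable_translate a t : mu.-integrable setT (EFin \o t) ->
  mu.-integrable setT (EFin \o (fun x => t (x + a))).
Proof.
move=> it; have := cintegrable_affine a (oner_neq0 R) (cintegrable_real it).
by move=> [+ _]; under [X in _ -> integrable _ _ (_ \o X)]eq_fun do rewrite -[X in t (X + _)]scale1r.
Qed.

Lemma cintegral_translate a f : cintegrable mu f ->
  cintegral mu (fun x => f (x + a)) = cintegral mu f.
Proof.
move=> fi; rewrite -[RHS]mul1r -[1]/(1%:C) -(expr1n _ d) -[1 in RHS]invr1.
rewrite -[1 in X in X^-1]normr1 -(cintegral_affine a (oner_neq0 R))//.
by under [in RHS]eq_fun do rewrite scale1r.
Qed.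

Lemma cintegrable_translate a f : cintegrable mu f ->
  cintegrable mu (fun x => f (x + a)).
Proof.
move=> fi; have := cintegrable_affine a (oner_neq0 R) fi.
by under eq_fun do rewrite scale1r.
Qed.

Lemma cintegrable_reflect a f : cintegrable mu f -> cintegrable mu (fun x => f (a - x)).
Proof.
move=> fi; have N1 : (-1 : R) != 0 by rewrite oppr_eq0 oner_eq0.
have := cintegrable_affine a N1 fi.
by under eq_fun do rewrite scaleN1r addrC.
Qed.

Lemma cintegral_reflect a f : cintegrable mu f ->
  cintegral mu (fun x => f (a - x)) = cintegral mu f.
Proof.
move=> fi; have N1 : (-1 : R) != 0 by rewrite oppr_eq0 oner_eq0.
have := cintegral_affine a N1 fi.
under eq_fun do rewrite scaleN1r addrC.
by move=> ->; rewrite normrN normr1 invr1 expr1n mul1r.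
Qed.

End rV_change_of_variable.

(** * Fourier inversion *)

Section fourier.
Context {R : realType} {d : nat}.
Variable hbar : R.
Hypothesis hbar_gt0 : 0 < hbar.
Implicit Types (h : 'rV[R]_d -> R[i]) (x y xi : 'rV[R]_d).
Let mu := lebesgue_rV R d.

Definition character xi y : R[i] := cexpi (dot xi y / hbar).

(* The kernel carries the sign of the calligraphic transform and no
   normalizing constant. *)
Definition fourier h xi : R[i] := cintegral mu (fun y => h y * character xi y).

Lemma cmod_character xi y : cmod (character xi y) = 1.
Proof. exact: cmod_cexpi. Qed.

Lemma characterDl xi eta y : character (xi + eta) y = character xi y * character eta y.
Proof. by rewrite /character dotDl mulrDl cexpiD. Qed.

Lemma characterDr xi x y : character xi (x + y) = character xi x * character xi y.
Proof. by rewrite /character dotDr mulrDl cexpiD. Qed.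

Lemma characterNl xi y : character (- xi) y = conjc (character xi y).
Proof. by rewrite /character dotNl mulNr cexpiJ. Qed.

Lemma characterNr xi y : character xi (- y) = conjc (character xi y).
Proof. by rewrite /character dotNr mulNr cexpiJ. Qed.

Lemma continuous_character xi : continuous (character xi).
Proof.
apply: continuous_cexpi; apply: continuous_mulR; first exact: continuous_dot.
exact: continuous_cstR.
Qed.

Lemma cmeas_character d1 (T : measurableType d1) (f g : T -> 'rV[R]_d) :
  measurable_fun setT f -> measurable_fun setT g ->
  cmeas (fun t => character (f t) (g t)).
Proof.
move=> mf mg; apply: cmeas_cexpi; apply: measurable_funM => //.
exact: measurable_dot.
Qed.

Lemma cintegrable_mul_unimod d1 (T : measurableType d1) (m : {measure set T -> \bar R})
    (f u : T -> R[i]) : cintegrable m f -> cmeas u -> (forall t, cmod (u t) = 1) ->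
  cintegrable m (fun t => f t * u t).
Proof.
move=> fi mu1 u1; apply: (cintegrable_bound _ fi).
  by apply: cmeasM => //; exact: (cintegrable_cmeas fi).
by move=> t; rewrite cmodM u1 mulr1.
Qed.

Lemma cintegrable_character h xi : cintegrable mu h ->
  cintegrable mu (fun y => h y * character xi y).
Proof.
move=> hi; apply: cintegrable_mul_unimod => //; last by move=> y; exact: cmod_character.
exact: cmeas_character.
Qed.

(** Measurability when both the integrand and the frequency depend on the parameter, as they do in
    windowed integrals. *)
Lemma cmeas_fourier d1 (T : measurableType d1) (H : T * 'rV[R]_d -> R[i])
    (f : T -> 'rV[R]_d) : cmeas H -> measurable_fun setT f ->
  cmeas (fun t => fourier (fun y => H (t, y)) (f t)).
Proof.
move=> mH mf.
apply: (@cmeas_cintegral _ _ T _ _ mu (fun z => H z * character (f z.1) z.2)).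
by apply: cmeasM => //; apply: cmeas_character => //; exact: measurableT_comp mf _.
Qed.

(* A summability kernel whose Fourier transform is an explicit multiple of the
   inverse of [weight]. *)
Definition abel xi : R := \prod_(i < d) expR (- `|xi ord0 i|).

Lemma abel_ge0 xi : 0 <= abel xi.
Proof. by apply: prodr_ge0 => i _; exact: expR_ge0. Qed.

Lemma abel_le1 xi : abel xi <= 1.
Proof.
apply: prodr_ile1 => i _; rewrite expR_ge0 /=.
by rewrite -expR0 ler_expR oppr_le0.
Qed.

Lemma continuous_abel : continuous abel.
Proof.
apply: continuous_prod_ord => i.
exact: (continuous_compR (@continuous_coord R d i) continuous_expNnorm).
Qed.

Lemma abel0 : abel 0 = 1.
Proof. by apply: big1 => i _; rewrite mxE normr0 oppr0 expR0. Qed.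

Lemma abel_dot_prod v xi : (abel xi)%:C * cexpi (dot xi v) =
  \prod_i ((expR (- `|xi ord0 i|))%:C * cexpi (xi ord0 i * v ord0 i)).
Proof.
rewrite big_split /= /abel rmorph_prod; congr (_ * _).
exact: (big_morph (@cexpi R) (@cexpiD R) (@cexpi0 R)).
Qed.

Lemma cintegrable_abel_dot v : cintegrable mu (fun xi => (abel xi)%:C * cexpi (dot xi v)).
Proof.
under eq_fun do rewrite abel_dot_prod.
apply: (cintegral_prod (k := fun i t => (expR (- `|t|))%:C * cexpi (t * v ord0 i)) _).1 => i.
exact: cintegrable_expNnorm.
Qed.

Lemma cintegral_abel_dot v :
  cintegral mu (fun xi => (abel xi)%:C * cexpi (dot xi v)) = (2 ^+ d / weight v)%:C.
Proof.
under eq_fun do rewrite abel_dot_prod.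
rewrite (cintegral_prod (k := fun i t => (expR (- `|t|))%:C * cexpi (t * v ord0 i)) _).2; last first.
  by move=> i; exact: cintegrable_expNnorm.
under eq_bigr do rewrite cintegral_expNnorm.
rewrite -rmorph_prod big_split /= prodr_const card_ord prodfV; congr ((_ * _)%:C).
Qed.

Lemma cintegrable_abel : cintegrable mu (fun xi => (abel xi)%:C).
Proof.
by have := cintegrable_abel_dot 0; under eq_fun do rewrite dot0r cexpi0 mulr1.
Qed.

(** After Fubini the xi-integral acts on the kernel alone and yields a Cauchy kernel centred at [y],
    of width hbar delta; the substitution z = hbar delta t + y moves this scale into [h]. The powers
    of delta from the two changes of variable cancel, and (2 hbar)^d remains. *)
Lemma fourier_abel_sum h y delta : 0 < delta -> cintegrable mu h ->
  cintegral mu (fun xi => fourier h xi * conjc (character xi y) * (abel (delta *: xi))%:C) =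
  ((2 * hbar) ^+ d)%:C *
  cintegral mu (fun t => h ((hbar * delta) *: t + y) * ((weight t)^-1)%:C).
Proof.
move=> delta0 hi.
have hd0 : 0 < hbar * delta by rewrite mulr_gt0.
have d0 : delta != 0 by rewrite gt_eqF.
have hdn0 : hbar * delta != 0 by rewrite gt_eqF.
pose G (p : 'rV[R]_d * 'rV[R]_d) : R[i] :=
  (abel (delta *: p.1))%:C * h p.2 * (character p.1 p.2 * conjc (character p.1 y)).
have GE xi z : G (xi, z) = (abel (delta *: xi))%:C * h z *
    (character xi z * conjc (character xi y)) by [].
have iA : cintegrable mu (fun xi => (abel (delta *: xi))%:C).
  have := cintegrable_affine 0 d0 cintegrable_abel.
  by under eq_fun do rewrite addr0.
have iG : cintegrable (mu \x mu)%E G.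
  apply: cintegrable_mul_unimod.
  - exact: (cintegrable_tensor iA hi).
  - apply: cmeasM; first exact: cmeas_character.
    by apply: cmeasJ; apply: cmeas_character => //; exact: measurable_cst.
  - by move=> p; rewrite cmodM cmodJ !cmod_character mulr1.
transitivity (cintegral (mu \x mu)%E G).
  rewrite (cfubini12 iG); congr cintegral; apply/funext => xi.
  rewrite /fourier mulrAC -mulrA mulrC -cintegralZ; last exact: cintegrable_character.
  by congr cintegral; apply/funext => z; rewrite GE; ring.
rewrite (cfubini21 iG).
(* Chosen so that the product of delta xi with [v z] is xi.(z - y) / hbar. *)
pose v z := (hbar * delta)^-1 *: (z - y).
have inner z : cintegral mu (fun xi => G (xi, z)) =
    (`|delta|^-1 ^+ d * 2 ^+ d)%:C * (h z * ((weight (v z))^-1)%:C).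
  rewrite [RHS](_ : _ = h z * ((`|delta|^-1 ^+ d)%:C * (2 ^+ d / weight (v z))%:C)); last first.
    by rewrite !rmorphM /=; ring.
  rewrite -cintegral_abel_dot -(cintegral_affine 0 d0 (cintegrable_abel_dot _)).
  rewrite -cintegralZ; last exact: (cintegrable_affine 0 d0 (cintegrable_abel_dot _)).
  congr cintegral; apply/funext => xi; rewrite GE addr0.
  rewrite -characterNr -characterDr.
  rewrite mulrCA mulrA /character dotZl dotZr; congr (_ * _ * cexpi _).
  by field; rewrite d0 gt_eqF.
have iPhi : cintegrable mu (fun z => h z * ((weight (v z))^-1)%:C).
  apply: (cintegrable_bound _ hi).
    apply: cmeasM; first exact: (cintegrable_cmeas hi).
    apply: cmeas_real; apply: (measurableT_comp (continuous_measurable_rV (@continuous_weightV R d))).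
    rewrite (_ : v = fun z => (hbar * delta)^-1 *: z + - ((hbar * delta)^-1 *: y)).
      exact: measurable_rV_affine.
    by apply/funext => z; rewrite /v scalerBr.
  move=> z; rewrite cmodM ler_piMr ?cmod_ge0// cmod_weightV.
  exact: weightV_le1.
under eq_fun do rewrite inner.
rewrite cintegralZ//.
have -> : (fun t => h ((hbar * delta) *: t + y) * ((weight t)^-1)%:C) =
    (fun t => (fun z => h z * ((weight (v z))^-1)%:C) ((hbar * delta) *: t + y)).
  by apply/funext => t; rewrite /v addrK scalerA mulVf// scale1r.
rewrite (cintegral_affine y hdn0 iPhi) mulrA -rmorphM; congr (_%:C * _).
rewrite !gtr0_norm// -!exprMn; congr (_ ^+ _).
by field; rewrite d0 gt_eqF.
Qed.

(** Both sides of [fourier_abel_sum] converge as delta -> 0: the left one is dominated by the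
    modulus of the transform, the right one by [M] times the inverse weight. The constant is (2
    hbar)^d times pi^d, the integral of the inverse weight. *)
Lemma fourier_inversion h M y : continuous h -> (forall x, cmod (h x) <= M) ->
  cintegrable mu h -> cintegrable mu (fourier h) ->
  cintegral mu (fun xi => fourier h xi * conjc (character xi y)) = ((2 * pi * hbar) ^+ d)%:C * h y.
Proof.
move=> ch hM hi fhi.
pose e (n : nat) : R := n.+1%:R^-1.
have e0 n : 0 < e n by rewrite invr_gt0.
have ecvg : e @ \oo --> (0 : R) by exact: cvg_harmonic.
have scvg (c : R) (x z : 'rV[R]_d) : ((c * e n) *: x + z) @[n --> \oo] --> z.
  rewrite -[X in _ --> X]add0r -[X in X + _](scale0r x) -[X in X *: _](mulr0 c).
  apply: cvgD; last exact: cvg_cst.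
  by apply: cvgZr_tmp; apply: cvgM => //; exact: cvg_cst.
have lhs : (fun n => cintegral mu (fun xi => fourier h xi * conjc (character xi y) * (abel (e n *: xi))%:C))
    @ \oo --> cintegral mu (fun xi => fourier h xi * conjc (character xi y)).
  have mfc : cmeas (fun xi => fourier h xi * conjc (character xi y)).
    apply: cmeasM; first exact: (cintegrable_cmeas fhi).
    by apply: cmeasJ; apply: cmeas_character => //; exact: measurable_cst.
  apply: (cdominated_convergence _ mfc _ (integrable_cmod fhi)).
  - move=> n; apply: cmeasM => //; apply: cmeas_real.
    apply: (measurableT_comp (continuous_measurable_rV continuous_abel)).
    by have := @measurable_rV_affine R d (e n) 0; under eq_fun do rewrite addr0.
  - move=> xi; rewrite -[X in _ --> X]mulr1 -[1]/(1%:C) -abel0.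
    apply: cvgM; first exact: cvg_cst.
    apply/ccvgP; split => /=; last exact: cvg_cst.
    apply: (cvg_comp (fun n => e n *: xi) abel _ (@continuous_abel 0)).
    by have := scvg 1 xi 0; under eq_fun do rewrite mul1r addr0.
  - move=> n xi; rewrite !cmodM cmodJ cmod_character mulr1 ler_piMr ?cmod_ge0//.
    by rewrite cmod_real ger0_norm ?abel_ge0// abel_le1.
have rhs : (fun n => ((2 * hbar) ^+ d)%:C *
     cintegral mu (fun t => h ((hbar * e n) *: t + y) * ((weight t)^-1)%:C))
    @ \oo --> ((2 * hbar) ^+ d)%:C * cintegral mu (fun t => h y * ((weight t)^-1)%:C).
  apply: cvgM; first exact: cvg_cst.
  have mw : cmeas (fun x : 'rV[R]_d => ((weight x)^-1)%:C).
    by apply: cmeas_real; exact: continuous_measurable_rV (@continuous_weightV R d).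
  have iM : mu.-integrable setT (EFin \o (fun x => M * (weight x)^-1)).
    exact: (integrableZl measurableT M (@integrable_weightV R d)).
  apply: (cdominated_convergence _ _ _ iM).
  - move=> n; apply: cmeasM => //.
    apply: (cmeas_comp (continuous_cmeas ch)); exact: measurable_rV_affine.
  - by apply: cmeasM => //; exact: cmeas_cst.
  - move=> t; apply: cvgM; last exact: cvg_cst.
    exact: (cvg_comp _ _ (scvg hbar t y) (ch y)).
  - move=> n t; rewrite cmodM cmod_weightV.
    by apply: ler_wpM2r => //; exact: weightV_ge0.
have lr : (fun n => cintegral mu (fun xi => fourier h xi * conjc (character xi y) * (abel (e n *: xi))%:C)) =
   (fun n => ((2 * hbar) ^+ d)%:C *
     cintegral mu (fun t => h ((hbar * e n) *: t + y) * ((weight t)^-1)%:C)).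
  by apply/funext => n; rewrite fourier_abel_sum.
move: lhs; rewrite lr => lhs.
rewrite (cvg_unique _ lhs rhs); last exact: norm_hausdorff.
rewrite cintegralZ; last exact: cintegrable_weightV.
rewrite cintegral_weightV (_ : 2 * pi * hbar = 2 * hbar * pi); last by ring.
by rewrite mulrA mulrAC -rmorphM /= -exprMn.
Qed.

End fourier.

(** * Schwartz functions and decay of Fourier integrals *)

Section line_derivative.
Context {R : realType} {V : normedModType R}.
Implicit Types (f : V -> R) (x v : V).

(** Restriction to a line, which reduces directional derivatives to ordinary ones, so that the
    one-variable chain rule and mean value theorem apply. *)
Definition line f x v : R -> R := fun t => f (t *: v + x).

Lemma is_derive_line f x v (t df : R) :
  is_derive (t *: v + x) v f df <-> is_derive t 1 (line f x v) df.
Proof.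
have E : (fun h : R => h^-1 *: ((f \o shift (t *: v + x)) (h *: v) - f (t *: v + x))) =
    (fun h : R => h^-1 *: ((line f x v \o shift t) (h *: 1) - line f x v t)).
  apply/funext => h; rewrite /line /= !scaler1 [h + t]addrC scalerDl.
  by rewrite addrA [h *: v + _]addrC.
split=> -[]; rewrite /derivable /derive.
- by rewrite E => *; split.
- by rewrite -E => *; split.
Qed.

Lemma is_derive_line0 f x v (df : R) :
  is_derive x v f df <-> is_derive (0 : R) 1 (line f x v) df.
Proof. by rewrite -is_derive_line scale0r add0r. Qed.

Lemma is_derive_compR f (F : R -> R) x v (df dF : R) :
  is_derive x v f df -> is_derive (f x) 1 F dF -> is_derive x v (F \o f) (dF * df).
Proof.
move=> /is_derive_line0 f1 F1; apply/is_derive_line0.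
apply: (@is_derive1_comp _ F (line f x v)) => //.
by rewrite /line scale0r add0r.
Qed.

Lemma is_derive_affine f x v (c df : R) (a : V) :
  is_derive (c *: x + a) v f df -> is_derive x v (fun y => f (c *: y + a)) (c * df).
Proof.
move=> f1; apply/is_derive_line0; rewrite mulrC.
have -> : line (fun y => f (c *: y + a)) x v = line f (c *: x + a) v \o ( *%R c).
  by apply/funext => t; rewrite /line /= scalerDr scalerA addrA.
apply: is_derive1_comp; first by apply/is_derive_line; rewrite mulr0 scale0r add0r.
have -> : *%R c = c \*: id by [].
by apply: is_derive_eq; rewrite /GRing.scale /= mulr1.
Qed.

End line_derivative.

Section partial_derivative.
Context {R : realType} {d : nat}.
Implicit Types (f g h k : 'rV[R]_d -> R[i]) (q r : 'rV[R]_d -> R) (i j : 'I_d).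
Local Notation e_ i := (delta_mx ord0 i : 'rV[R]_d).

Definition has_partial i f g := forall x,
  is_derive x (e_ i) (@complex.Re R \o f) (complex.Re (g x)) /\
  is_derive x (e_ i) (@complex.Im R \o f) (complex.Im (g x)).

Lemma has_partial_cderivable i f g : has_partial i f g -> forall x, cderivable i f x.
Proof. by move=> fg x; have [[f1 _] [f2 _]] := fg x; split; [exact: f1|exact: f2]. Qed.

Lemma has_partial_cpartial i f g : has_partial i f g -> cpartial i f = g.
Proof.
by move=> fg; apply/funext => x; have [[_ ?] [_ ?]] := fg x; apply: cplx_eq.
Qed.

Lemma cderivable_hpar i f : (forall x, cderivable i f x) -> has_partial i f (cpartial i f).
Proof.
by move=> df x; have [f1 f2] := df x; split; [exact: derivableP f1|exact: derivableP f2].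
Qed.

Lemma has_partial_cst i (c : R[i]) : has_partial i (fun _ => c) (fun _ => 0).
Proof. by move=> x; split; exact: is_derive_cst. Qed.

Lemma has_partialD i f g h k : has_partial i f h -> has_partial i g k ->
  has_partial i (fun x => f x + g x) (fun x => h x + k x).
Proof.
move=> fh gk x; have [f1 f2] := fh x; have [g1 g2] := gk x; rewrite ReD ImD; split.
- rewrite (_ : _ \o _ = (@complex.Re R \o f) + (@complex.Re R \o g)); first exact: is_deriveD.
  by apply/funext => y; rewrite /= ReD.
- rewrite (_ : _ \o _ = (@complex.Im R \o f) + (@complex.Im R \o g)); first exact: is_deriveD.
  by apply/funext => y; rewrite /= ImD.
Qed.

Lemma has_partialM i f g h k : has_partial i f h -> has_partial i g k ->
  has_partial i (fun x => f x * g x) (fun x => h x * g x + f x * k x).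
Proof.
move=> fh gk x; have [f1 f2] := fh x; have [g1 g2] := gk x; split.
- rewrite (_ : _ \o _ = (@complex.Re R \o f) * (@complex.Re R \o g) -
     (@complex.Im R \o f) * (@complex.Im R \o g)); last by apply/funext => y; rewrite /= ReM.
  apply: (is_derive_eq (is_deriveB (is_deriveM f1 g1) (is_deriveM f2 g2))).
  by rewrite ReD !ReM /GRing.scale /=; ring.
- rewrite (_ : _ \o _ = (@complex.Re R \o f) * (@complex.Im R \o g) +
     (@complex.Im R \o f) * (@complex.Re R \o g)); last by apply/funext => y; rewrite /= ImM.
  apply: (is_derive_eq (is_deriveD (is_deriveM f1 g2) (is_deriveM f2 g1))).
  by rewrite ImD !ImM /GRing.scale /=; ring.
Qed.

Lemma has_partialJ i f h : has_partial i f h -> has_partial i (fun x => conjc (f x)) (fun x => conjc (h x)).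
Proof.
move=> fh x; have [f1 f2] := fh x; rewrite ReJ ImJ; split.
- by rewrite (_ : _ \o _ = @complex.Re R \o f)//; apply/funext => y; rewrite /= ReJ.
- rewrite (_ : _ \o _ = - (@complex.Im R \o f)); first exact: is_deriveN.
  by apply/funext => y; rewrite /= ImJ.
Qed.

Lemma has_partial_affine i f h (c : R) (a : 'rV[R]_d) : has_partial i f h ->
  has_partial i (fun x => f (c *: x + a)) (fun x => c%:C * h (c *: x + a)).
Proof.
move=> fh x; have [f1 f2] := fh (c *: x + a); rewrite ReM ImM /= !mul0r subr0 addr0.
split.
- exact: (is_derive_affine f1).
- exact: (is_derive_affine f2).
Qed.

Lemma is_derive_coord i j x : is_derive x (e_ i) (fun y : 'rV[R]_d => y ord0 j) (i == j)%:R.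
Proof.
apply/is_derive_line0.
have -> : line (fun y : 'rV[R]_d => y ord0 j) x (e_ i) = fun t => t * (i == j)%:R + x ord0 j.
  by apply/funext => t; rewrite /line !mxE eqxx eq_sym.
by apply: is_derive_eq; rewrite !scaler1 scaler0 add0r addr0 /GRing.scale /= ?mulr1.
Qed.

Lemma has_partial_coord i j : has_partial i (fun x => (x ord0 j)%:C) (fun _ => (i == j)%:R).
Proof.
move=> x; rewrite (_ : (i == j)%:R = ((i == j)%:R : R)%:C); last by case: (i == j).
by split; [exact: is_derive_coord|exact: is_derive_cst].
Qed.

Lemma has_partial_cexpi i q r : (forall x, is_derive x (e_ i) q (r x)) ->
  has_partial i (fun x => cexpi (q x)) (fun x => 'i * (r x)%:C * cexpi (q x)).
Proof.
move=> qr x; have q1 := qr x; split.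
- apply: is_derive_eq; first exact: (is_derive_compR q1 (is_derive_cos _)).
  by rewrite !ReM !ImM /=; ring.
- apply: is_derive_eq; first exact: (is_derive_compR q1 (is_derive_sin _)).
  by rewrite !ImM !ReM /=; ring.
Qed.

Lemma is_derive_dot i (xi x : 'rV[R]_d) : is_derive x (e_ i) (dot xi) (xi ord0 i).
Proof.
apply/is_derive_line0.
have -> : line (dot xi) x (e_ i) = fun t => t * xi ord0 i + dot xi x.
  apply/funext => t; rewrite /line dotDr dotZr; congr (_ * _ + _).
  rewrite /dot (bigD1 i)//= big1 ?addr0 ?mxE ?eqxx ?mulr1// => j ji.
  by rewrite mxE eqxx (negbTE ji) mulr0.
by apply: is_derive_eq; rewrite !scaler1 scaler0 add0r addr0 /GRing.scale /= ?mulr1.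
Qed.

Lemma is_derive_dotxx i (x : 'rV[R]_d) :
  is_derive x (e_ i) (fun y => dot y y) (2 * x ord0 i).
Proof.
apply/is_derive_line0.
have de : dot x (e_ i) = x ord0 i.
  rewrite /dot (bigD1 i)//= big1 ?addr0 ?mxE ?eqxx ?mulr1// => j ji.
  by rewrite mxE eqxx (negbTE ji) mulr0.
have -> : line (fun y => dot y y) x (e_ i) =
    fun t => t * t * dot (e_ i) (e_ i) + t * (2 * x ord0 i) + dot x x.
  apply/funext => t; rewrite /line !(dotDr, dotDl, dotZr, dotZl) (dotC _ x) de.
  by ring.
by apply: is_derive_eq; rewrite /GRing.scale /=; ring.
Qed.

End partial_derivative.

(** * Rapid decay and polynomial growth, uniformly in a parameter *)

Section symbol_classes.
Context {R : realType} {d : nat} {P : Type}.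
Implicit Types (f g h : P -> 'rV[R]_d -> R[i]) (B : (P -> 'rV[R]_d -> R[i]) -> Prop).

(** The powers of a single weight, which dominates every coordinate, replace the family of all
    monomials. *)
Definition rapid h := forall k : nat, exists M : R,
  forall p x, cmod (h p x) * weight x ^+ k <= M.

Definition slow h := exists (k : nat) (M : R),
  forall p x, cmod (h p x) <= M * weight x ^+ k.

(* Families of functions whose derivatives up to order [n] satisfy the growth
   bound [B] uniformly in the parameter. *)
Fixpoint smooth_class B n h : Prop := [/\ B h, forall p, continuous (h p) &
  if n is n'.+1 then forall i, exists g, (forall p, has_partial i (h p) (g p)) /\ smooth_class B n' g
  else True].

Lemma smooth_classB B n h : smooth_class B n h -> B h.
Proof. by case: n => [|n] []. Qed.

Lemma smooth_class_continuous B n h : smooth_class B n h -> forall p, continuous (h p).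
Proof. by case: n => [|n] []. Qed.

Lemma smooth_classS B n h : smooth_class B n.+1 h -> smooth_class B n h.
Proof.
elim: n h => [|n IH] h /= [Bh ch dh]; first by split.
split=> // i; have [g [hg [Bg cg dg]]] := dh i; exists g; split=> //.
by apply: IH; split.
Qed.

Lemma rapidD f g : rapid f -> rapid g -> rapid (fun p x => f p x + g p x).
Proof.
move=> rf rg k; have [M1 h1] := rf k; have [M2 h2] := rg k; exists (M1 + M2) => p x.
rewrite (le_trans _ (lerD (h1 p x) (h2 p x)))// -mulrDl ler_wpM2r ?cmodD//.
by rewrite exprn_ge0// ltW// weight_gt0.
Qed.

Lemma weightX_ge0 (x : 'rV[R]_d) k : 0 <= weight x ^+ k.
Proof. by rewrite exprn_ge0// ltW// weight_gt0. Qed.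

Lemma weightX_le (x : 'rV[R]_d) k l : (k <= l)%N -> weight x ^+ k <= weight x ^+ l.
Proof. by move=> kl; apply: ler_weXn2l => //; exact: weight_ge1. Qed.

Lemma slowD f g : slow f -> slow g -> slow (fun p x => f p x + g p x).
Proof.
move=> [k1 [M1 h1]] [k2 [M2 h2]]; exists (maxn k1 k2), (`|M1| + `|M2|) => p x.
rewrite (le_trans (cmodD _ _))// mulrDl lerD//.
- rewrite (le_trans (h1 p x))// (le_trans (ler_wpM2r (weightX_ge0 _ _) (ler_norm M1)))//.
  by rewrite ler_wpM2l// weightX_le// leq_maxl.
- rewrite (le_trans (h2 p x))// (le_trans (ler_wpM2r (weightX_ge0 _ _) (ler_norm M2)))//.
  by rewrite ler_wpM2l// weightX_le// leq_maxr.
Qed.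

Lemma rapidM f g : rapid f -> slow g -> rapid (fun p x => f p x * g p x).
Proof.
move=> rf [l [M2 h2]] k; have [M1 h1] := rf (l + k)%N; exists (M1 * `|M2|) => p x.
rewrite cmodM.
have h2' : cmod (g p x) <= `|M2| * weight x ^+ l.
  by rewrite (le_trans (h2 p x))// ler_wpM2r ?weightX_ge0// ler_norm.
rewrite (@le_trans _ _ (cmod (f p x) * (`|M2| * weight x ^+ l) * weight x ^+ k))//.
  by rewrite ler_wpM2r ?weightX_ge0// ler_wpM2l// cmod_ge0.
rewrite (_ : _ * _ * _ = cmod (f p x) * (weight x ^+ l * weight x ^+ k) * `|M2|); last by ring.
by rewrite -exprD ler_wpM2r// h1.
Qed.

Lemma slowM f g : slow f -> slow g -> slow (fun p x => f p x * g p x).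
Proof.
move=> [k1 [M1 h1]] [k2 [M2 h2]]; exists (k1 + k2)%N, (M1 * M2) => p x.
by rewrite cmodM exprD mulrACA ler_pM ?cmod_ge0.
Qed.

Lemma smooth_classD B n f g :
  (forall u v, B u -> B v -> B (fun p x => u p x + v p x)) ->
  smooth_class B n f -> smooth_class B n g -> smooth_class B n (fun p x => f p x + g p x).
Proof.
move=> BD; elim: n f g => [|n IH] f g /= [Bf cf df] [Bg cg dg].
  by split; [exact: BD|move=> p; exact: continuous_addC|exact: I].
split; [exact: BD|by move=> p; exact: continuous_addC|move=> i].
have [f' [ff' cf']] := df i; have [g' [gg' cg']] := dg i.
exists (fun p x => f' p x + g' p x); split; last exact: IH.
by move=> p; exact: has_partialD.
Qed.

(** Leibniz rule. Keeping three bounds apart lets one proof serve for rapid times slow and for slow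
    times slow; in the induction the undifferentiated factor is lowered by one order. *)
Lemma smooth_classM B1 B2 B3 n f g :
  (forall u v, B3 u -> B3 v -> B3 (fun p x => u p x + v p x)) ->
  (forall u v, B1 u -> B2 v -> B3 (fun p x => u p x * v p x)) ->
  smooth_class B1 n f -> smooth_class B2 n g -> smooth_class B3 n (fun p x => f p x * g p x).
Proof.
move=> BD BM; elim: n f g => [|n IH] f g fn gn.
  have [Bf cf _] := fn; have [Bg cg _] := gn.
  by split; [exact: BM|move=> p; exact: continuous_mulC|exact: I].
have [Bf cf df] := fn; have [Bg cg dg] := gn.
split; [exact: BM|by move=> p; exact: continuous_mulC|move=> i].
have [f' [ff' cf']] := df i; have [g' [gg' cg']] := dg i.
exists (fun p x => f' p x * g p x + f p x * g' p x); split.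
  by move=> p; exact: has_partialM.
apply: smooth_classD => //; apply: IH => //; exact: smooth_classS.
Qed.

Lemma smooth_rapidM n f g : smooth_class rapid n f -> smooth_class slow n g ->
  smooth_class rapid n (fun p x => f p x * g p x).
Proof. exact: smooth_classM rapidD rapidM. Qed.

Lemma smooth_slowM n f g : smooth_class slow n f -> smooth_class slow n g ->
  smooth_class slow n (fun p x => f p x * g p x).
Proof. exact: smooth_classM slowD slowM. Qed.

Lemma smooth_rapidJ n f : smooth_class rapid n f ->
  smooth_class rapid n (fun p x => conjc (f p x)).
Proof.
have rJ h : rapid h -> rapid (fun p x => conjc (h p x)).
  by move=> Bh k; have [M hM] := Bh k; exists M => p x; rewrite cmodJ.
elim: n f => [|n IH] f /= [Bf cf df].
  by split; [exact: rJ|move=> p; exact: continuous_conjC|exact: I].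
split; [exact: rJ|by move=> p; exact: continuous_conjC|move=> i].
have [g [fg cg]] := df i; exists (fun p x => conjc (g p x)); split; last exact: IH.
by move=> p; exact: has_partialJ.
Qed.

Lemma smooth_slow_cst n (c : P -> R[i]) M : (forall p, cmod (c p) <= M) ->
  smooth_class slow n (fun p _ => c p).
Proof.
have cst k (e : P -> R[i]) L : (forall p, cmod (e p) <= L) -> slow (fun p _ => e p).
  by move=> eL; exists 0%N, L => p x; rewrite expr0 mulr1.
elim: n c M => [|n IH] c M cM; split.
- exact: cst cM.
- by move=> p; exact: continuous_cstC.
- by [].
- exact: cst cM.
- by move=> p; exact: continuous_cstC.
- move=> i; exists (fun _ _ => 0); split; first by move=> p; exact: has_partial_cst.
  by apply: (IH (fun=> 0) 0) => p; rewrite cmod0.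
Qed.

Lemma smooth_slow_coord n j : smooth_class slow n (fun _ x => (x ord0 j)%:C).
Proof.
have sl : slow (fun _ (x : 'rV[R]_d) => (x ord0 j)%:C).
  by exists 1%N, 1 => p x; rewrite expr1 mul1r cmod_real coord_le_weight.
have ct : continuous (fun x : 'rV[R]_d => (x ord0 j)%:C).
  by apply: continuous_realC; exact: continuous_coord.
case: n => [|n]; split=> // i; exists (fun _ _ => (i == j)%:R); split.
  by move=> p; exact: has_partial_coord.
by apply: (@smooth_slow_cst _ _ 1) => p; case: (i == j); rewrite ?cmod1 ?cmod0 ?ler01.
Qed.

(** Differentiation reproduces the exponential with a factor i r, so the induction on the order
    closes once [r] is slow to every order. Both the quadratic phase and the characters are of this
    kind. *)
Lemma smooth_slow_cexpi n (q : 'rV[R]_d -> R) (r : 'I_d -> 'rV[R]_d -> R) :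
  continuous q ->
  (forall i x, is_derive x (delta_mx ord0 i : 'rV[R]_d) q (r i x)) ->
  (forall i k, smooth_class slow k (fun _ x => (r i x)%:C)) ->
  smooth_class slow n (fun _ x => cexpi (q x)).
Proof.
move=> cq qr sr.
have sl : slow (fun _ (x : 'rV[R]_d) => cexpi (q x)).
  by exists 0%N, 1 => p x; rewrite expr0 mulr1 cmod_cexpi.
have ct := continuous_cexpi cq.
elim: n => [|n IH]; split=> // i.
exists (fun _ x => 'i * (r i x)%:C * cexpi (q x)); split.
  by move=> p; apply: has_partial_cexpi => x.
apply: smooth_slowM => //; apply: smooth_slowM => //.
by apply: (@smooth_slow_cst _ _ (cmod ('i : R[i]))) => p.
Qed.

End symbol_classes.

Section schwartz_class.
Context {R : realType} {d : nat}.
Implicit Types (f g h : 'rV[R]_d -> R[i]).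

Lemma rapid_integrable P (h : P -> 'rV[R]_d -> R[i]) p : rapid h -> continuous (h p) ->
  cintegrable (lebesgue_rV R d) (h p).
Proof.
move=> rh ch; have [M hM] := rh 1%N.
have iM : (lebesgue_rV R d).-integrable setT (EFin \o (fun x => M * (weight x)^-1)).
  exact: (integrableZl measurableT M (@integrable_weightV R d)).
apply: (cintegrable_le (continuous_cmeas ch) iM) => x.
by rewrite ler_pdivlMr ?weight_gt0// -[X in _ * X]expr1.
Qed.

Lemma monomial_le (a : 'I_d -> nat) (x : 'rV[R]_d) :
  `|monomial a x| <= weight x ^+ (\sum_(i < d) a i).
Proof.
rewrite /monomial normr_prod expr_sum; apply: ler_prod => i _.
by rewrite normr_ge0 /= normrX lerXn2r// ?nnegrE// ?coord_le_weight// ltW// weight_gt0.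
Qed.

(** Powers of the weight are built one factor 1 + x_j^2 at a time: the term 1 keeps the monomial,
    and the square raises its exponent at [j] by 2. This works because the bound is carried for all
    monomials simultaneously. *)
Lemma schwartz_rapid f : schwartz f -> rapid (fun _ : unit => f).
Proof.
move=> [_ sf].
have good_step (q : 'rV[R]_d -> R) (j : 'I_d) :
   (forall a : 'I_d -> nat, exists M, forall x, `|monomial a x| * `|q x| * cmod (f x) <= M) ->
   (forall a : 'I_d -> nat, exists M, forall x, `|monomial a x| * `|q x * (1 + x ord0 j ^+ 2)| * cmod (f x) <= M).
  move=> Hq a; have [M1 h1] := Hq a.
  pose a' i := (a i + (i == j) * 2)%N; have [M2 h2] := Hq a'.
  exists (M1 + M2) => x.
  have -> : `|monomial a x| * `|q x * (1 + x ord0 j ^+ 2)| * cmod (f x) =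
      `|monomial a x| * `|q x| * cmod (f x) + `|monomial a' x| * `|q x| * cmod (f x).
    have -> : monomial a' x = monomial a x * x ord0 j ^+ 2.
      rewrite /monomial (bigD1 j)//= [in RHS](bigD1 j)//= /a' eqxx mul1n exprD mulrAC.
      congr (_ * _ * _); apply: eq_bigr => i ij; by rewrite (negbTE ij) mul0n addn0.
    rewrite [`|q x * _|]normrM [`|monomial a x * _|]normrM [`|_ ^+ 2|]ger0_norm ?sqr_ge0//.
    by rewrite [`|1 + _|]ger0_norm ?addr_ge0 ?sqr_ge0//; ring.
  by rewrite lerD.
have good_seq (s : seq 'I_d) (q : 'rV[R]_d -> R) :
   (forall a : 'I_d -> nat, exists M, forall x, `|monomial a x| * `|q x| * cmod (f x) <= M) ->
   (forall a : 'I_d -> nat, exists M, forall x, `|monomial a x| *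
     `|q x * \prod_(j <- s) (1 + x ord0 j ^+ 2)| * cmod (f x) <= M).
  elim: s q => [|j s IH] q Hq a.
    have [M hM] := Hq a; exists M => x; rewrite big_nil mulr1; exact: hM.
  have [M hM] := IH _ (good_step q j Hq) a; exists M => x.
  by rewrite big_cons mulrA.
have good k : forall a : 'I_d -> nat, exists M, forall x,
    `|monomial a x| * `|weight x ^+ k| * cmod (f x) <= M.
  elim: k => [|k IH] a.
    have [M hM] := sf a [::]; exists M => x; rewrite expr0 normr1 mulr1; exact: hM.
  have [M hM] := good_seq (index_enum _) (fun x => weight x ^+ k) IH a; exists M => x; rewrite exprSr; exact: hM.
move=> k; have [M hM] := good k (fun=> 0%N); exists M => _ x.
rewrite mulrC; have := hM x; rewrite /monomial big1; last by move=> i _; rewrite expr0.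
by rewrite normr1 mul1r ger0_norm// weightX_ge0.
Qed.

Lemma schwartz_cpartial f i : schwartz f -> schwartz (cpartial i f).
Proof.
move=> [sm sf]; split=> [b|a b].
  by have := sm (rcons b i); rewrite /cpartials foldr_rcons.
by have := sf a (rcons b i); rewrite /cpartials foldr_rcons.
Qed.

(** The symbol classes have algebraic closure properties, whereas [schwartz] speaks of words of
    iterated partial derivatives; this equivalence moves between the two. From right to left the
    word is treated by induction, each letter consuming one order of smoothness. *)
Lemma schwartz_smooth_class f : schwartz f <->
  forall n, smooth_class rapid n (fun _ : unit => f).
Proof.
split=> [sf n|cf].
  elim: n f sf => [|n IH] f sf; split; try exact: schwartz_rapid.
  - by move=> _; have [/(_ [::])[]] := sf.
  - by [].
  - by move=> _; have [/(_ [::])[]] := sf.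
  move=> i; exists (fun _ => cpartial i f); split; last exact/IH/schwartz_cpartial.
  by move=> _; apply: cderivable_hpar => x; have [/(_ [::])[_ +] _] := sf; exact.
have cb : forall b n, smooth_class rapid n (fun _ : unit => cpartials b f).
  elim=> [|i b IH] n //=.
  have [_ _ /(_ i)[g [hg cg]]] := IH n.+1.
  rewrite (_ : (fun _ : unit => _) = g)//; apply/funext => -[].
  by rewrite -(has_partial_cpartial (hg tt)).
split=> [b|a b].
  split; first by have [_ + _] := cb b 0%N; apply.
  move=> i x; have [_ _ /(_ i)[g [hg _]]] := cb b 1%N.
  exact: (has_partial_cderivable (hg tt)).
have [rb _ _] := cb b 0%N; have [M hM] := rb (\sum_(i < d) a i)%N.
exists M => x; rewrite mulrC (le_trans _ (hM tt x))// ler_wpM2l ?cmod_ge0//.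
exact: monomial_le.
Qed.

End schwartz_class.

Section schwartz_families.
Context {R : realType} {d : nat}.
Implicit Types (f g h : 'rV[R]_d -> R[i]).

Lemma continuous_affineC f (c : R) (a : 'rV[R]_d) : continuous f ->
  continuous (fun x : 'rV[R]_d => f (c *: x + a)).
Proof.
move=> cf x.
have ca : {for x, continuous (fun y : 'rV[R]_d => c *: y + a)}.
  exact: (cvgD (@scaler_continuous _ _ c x) (cvg_cst a)).
exact: (continuous_comp ca (cf _)).
Qed.

Lemma continuous_translateC f (a : 'rV[R]_d) : continuous f ->
  continuous (fun x : 'rV[R]_d => f (x + a)).
Proof.
by move=> cf; have := continuous_affineC (c := 1) (a := a) cf; under eq_fun do rewrite scale1r.
Qed.

Lemma smooth_rapid_reparam P Q (s : Q -> P) n (h : P -> 'rV[R]_d -> R[i]) :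
  smooth_class rapid n h -> smooth_class rapid n (fun q => h (s q)).
Proof.
have rs (u : P -> 'rV[R]_d -> R[i]) : rapid u -> rapid (fun q => u (s q)).
  by move=> ru k; have [M hM] := ru k; exists M.
elim: n h => [|n IH] h [Bh ch dh].
  by split; [exact: rs|move=> q; exact: ch|].
split; [exact: rs|by move=> q; exact: ch|move=> i].
by have [g [hg cg]] := dh i; exists (fun q => g (s q)); split; [move=> q; exact: hg|exact: IH].
Qed.

(** By Peetre's inequality a fixed translation multiplies the bound of order [k] by the constant
    (2^d weight a)^k. *)
Lemma smooth_rapid_translate n f (a : 'rV[R]_d) :
  smooth_class rapid n (fun _ : unit => f) ->
  smooth_class rapid n (fun _ : unit => fun x => f (x + a)).
Proof.
have rt u : rapid (fun _ : unit => u) -> rapid (fun _ : unit => fun x : 'rV[R]_d => u (x + a)).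
  move=> ru k; have [M hM] := ru k; exists (M * (2 ^+ d * weight a) ^+ k) => p x.
  have W : weight x <= 2 ^+ d * weight a * weight (x + a).
    rewrite -(weightN a) -mulrA; apply: (le_trans _ (weightD _ _)).
    by rewrite addrC addrK.
  rewrite (@le_trans _ _ (cmod (u (x + a)) * (2 ^+ d * weight a * weight (x + a)) ^+ k))//.
    rewrite ler_wpM2l ?cmod_ge0// lerXn2r// nnegrE ?ltW ?weight_gt0//.
    by rewrite !mulr_gt0 ?weight_gt0// exprn_gt0.
  rewrite exprMn mulrCA mulrC ler_wpM2r ?hM// exprn_ge0// mulr_ge0 ?exprn_ge0//.
  by rewrite ltW// weight_gt0.
elim: n f => [|n IH] f [Bf cf df].
  by split; [exact: rt|move=> _; exact: (continuous_translateC (cf tt))|].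
split; [exact: rt|by move=> _; exact: (continuous_translateC (cf tt))|move=> i].
have [g [fg cg]] := df i; exists (fun _ x => g tt (x + a)); split; last first.
  by apply: IH; rewrite (_ : (fun _ => _) = g)//; apply/funext => -[].
move=> _ x; have := has_partial_affine 1 a (fg tt) x.
by rewrite mul1r scale1r; under [X in is_derive _ _ (_ \o X) _]eq_fun do rewrite scale1r;
  under [X in _ /\ is_derive _ _ (_ \o X) _]eq_fun do rewrite scale1r.
Qed.

(* Bounded dilations of a rapidly decreasing function are bounded uniformly in
   the translation, hence [slow]. *)
Lemma smooth_slow_affine P n f (e : P -> R) (a : P -> 'rV[R]_d) (M : R) :
  smooth_class rapid n (fun _ : unit => f) -> (forall p, `|e p| <= M) ->
  smooth_class slow n (fun p x => f (e p *: x + a p)).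
Proof.
move=> + eM.
have sl u : rapid (fun _ : unit => u) -> slow (fun p (x : 'rV[R]_d) => u (e p *: x + a p)).
  move=> ru; have [L hL] := ru 0%N; exists 0%N, L => p x.
  by rewrite expr0 mulr1; have := hL tt (e p *: x + a p); rewrite expr0 mulr1.
elim: n f => [|n IH] f [Bf cf df].
  by split; [exact: sl|move=> p; exact: (continuous_affineC (cf tt))|].
split; [exact: sl|by move=> p; exact: (continuous_affineC (cf tt))|move=> i].
have [g [fg cg]] := df i; exists (fun p x => (e p)%:C * g tt (e p *: x + a p)); split.
  by move=> p; apply: has_partial_affine.
apply: smooth_slowM.
  by apply: (@smooth_slow_cst _ _ _ _ (fun p => (e p)%:C) M) => p; rewrite cmod_real.
by apply: IH; rewrite (_ : (fun _ => _) = g)//; apply/funext => -[].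
Qed.

(* By Peetre's inequality the decay of a translate in the translation parameter
   costs only polynomial growth in the variable. *)
Lemma smooth_slow_weight_translate n f :
  smooth_class rapid n (fun _ : unit => f) ->
  smooth_class slow n (fun z x => (weight z)%:C * f (x + z)).
Proof.
have sl u : rapid (fun _ : unit => u) ->
    slow (fun z (x : 'rV[R]_d) => (weight z)%:C * u (x + z)).
  move=> ru; have [L hL] := ru 1%N; exists 1%N, (2 ^+ d * L) => z x.
  have W : weight z <= 2 ^+ d * (weight x * weight (x + z)).
    rewrite -(weightN x); apply: (le_trans _ (weightD _ _)).
    by rewrite addKr.
  rewrite cmodM cmod_real ger0_norm; last exact: ltW (weight_gt0 z).
  rewrite expr1.
  rewrite (@le_trans _ _ (2 ^+ d * (weight x * weight (x + z)) * cmod (u (x + z))))//.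
    by rewrite ler_wpM2r ?cmod_ge0.
  rewrite (_ : _ * _ * _ = 2 ^+ d * weight x * (cmod (u (x + z)) * weight (x + z) ^+ 1)); last first.
    by rewrite expr1; ring.
  rewrite [leRHS]mulrAC ler_wpM2l ?hL//.
  by rewrite mulr_ge0 ?exprn_ge0// ltW// weight_gt0.
have ct u (z : 'rV[R]_d) : continuous u -> continuous (fun x : 'rV[R]_d => (weight z)%:C * u (x + z)).
  move=> cu; apply: continuous_mulC; first exact: continuous_cstC.
  exact: continuous_translateC.
elim: n f => [|n IH] f [Bf cf df].
  by split; [exact: sl|move=> z; exact: (ct _ _ (cf tt))|].
split; [exact: sl|by move=> z; exact: (ct _ _ (cf tt))|move=> i].
have [g [fg cg]] := df i; exists (fun z x => (weight z)%:C * g tt (x + z)); split; last first.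
  by apply: IH; rewrite (_ : (fun _ => _) = g)//; apply/funext => -[].
move=> z; have tr : has_partial i (fun x => f (x + z)) (fun x => g tt (x + z)).
  move=> x; have := has_partial_affine 1 z (fg tt) x.
  by rewrite mul1r scale1r; under [X in is_derive _ _ (_ \o X) _]eq_fun do rewrite scale1r;
    under [X in _ /\ is_derive _ _ (_ \o X) _]eq_fun do rewrite scale1r.
move=> x; have := has_partialM (has_partial_cst i (weight z)%:C) tr x.
by rewrite mul0r add0r.
Qed.

End schwartz_families.

Lemma cintegrableB {R : realType} d (T : measurableType d) (mu : {measure set T -> \bar R})
    (f g : T -> R[i]) : cintegrable mu f -> cintegrable mu g ->
  cintegrable mu (fun x => f x - g x).
Proof.
move=> fi gi; have := cintegrableD fi (cintegrableZ (-1) gi).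
by under eq_fun do rewrite mulN1r.
Qed.

(** * Decay of Fourier integrals by integration by parts *)

Section fourier_decay.
Context {R : realType} {d : nat}.
Variable hbar : R.
Hypotheses (hbar_gt0 : 0 < hbar) (hbar_le1 : hbar <= 1).
Implicit Types (f g h : 'rV[R]_d -> R[i]).
Let mu := lebesgue_rV R d.
Local Notation e_ i := (delta_mx ord0 i : 'rV[R]_d).
Local Notation fourier := (fourier hbar).
Local Notation character := (character hbar).

Lemma weight_scale_delta (i : 'I_d) (s : R) : `|s| <= 1 -> weight (s *: e_ i) <= 2.
Proof.
move=> s1; rewrite /weight (bigD1 i)//= big1 ?mulr1; last first.
  by move=> j ji; rewrite !mxE (negbTE ji) andbF mulr0 expr0n addr0.
rewrite !mxE !eqxx mulr1 -[leRHS]/(1 + 1) lerD2l -real_normK ?num_real//.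
by rewrite expr_le1.
Qed.

(* Mean value theorem along the i-th coordinate. *)
Lemma difference_quotient_le (q r : 'rV[R]_d -> R) (i : 'I_d) (M t : R) x :
  (forall y, is_derive y (e_ i) q (r y)) ->
  (forall y, `|r y| <= M * (weight y)^-1) -> 0 < t <= 1 ->
  `|t^-1 * (q (t *: e_ i + x) - q x)| <= M * 2 ^+ d.+1 * (weight x)^-1.
Proof.
move=> qr rM /andP[t0 t1].
have dl (s : R) : is_derive s (1 : R) (line q x (e_ i)) (r (s *: e_ i + x)).
  by have /is_derive_line := qr (s *: e_ i + x).
have cl : {within `[0, t], continuous (line q x (e_ i))}.
  apply: continuous_subspaceT => s; apply: differentiable_continuous.
  by apply/derivable1_diffP; apply: ex_derive.
have [c ct E] := MVT t0 (fun s _ => dl s) cl.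
have -> : q x = line q x (e_ i) 0 by rewrite /line scale0r add0r.
rewrite -/(line q x (e_ i) t) E subr0 mulrCA mulVf ?gt_eqF// mulr1.
rewrite (le_trans (rM _))//.
have M0 : 0 <= M.
  by have := le_trans (normr_ge0 _) (rM x); rewrite pmulr_lge0// invr_gt0 weight_gt0.
rewrite -mulrA ler_wpM2l// ler_pdivlMr ?weight_gt0// mulrC ler_pdivrMr ?weight_gt0//.
have c1 : `|- c| <= 1.
  move: ct; rewrite in_itv/= => /andP[c0 ct]; rewrite normrN gtr0_norm// ltW//.
  exact: lt_le_trans ct t1.
(* Peetre's inequality moves the weight from the intermediate point back to [x]. It costs 2^d, and
   the displacement, of length at most 1 along one axis, has weight at most 2; together 2^(d+1). *)
have := weightD (c *: e_ i + x) ((- c) *: e_ i).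
rewrite addrAC scaleNr subrr add0r => /le_trans; apply.
rewrite exprSr -mulrA ler_wpM2l ?exprn_ge0// mulrC ler_wpM2r//.
  by rewrite ltW// weight_gt0.
by rewrite -scaleNr weight_scale_delta.
Qed.

(** Difference quotients of [h p] have integral 0 by translation invariance. They are dominated by a
    multiple of the inverse weight, by [difference_quotient_le], so the limit passes under the
    integral. *)
Lemma cintegral_partial0 P (h g : P -> 'rV[R]_d -> R[i]) (i : 'I_d) p :
  rapid h -> rapid g -> continuous (h p) -> continuous (g p) -> has_partial i (h p) (g p) ->
  cintegral mu (g p) = 0.
Proof.
move=> rh rg ch cg hg.
pose e (n : nat) : R := n.+1%:R^-1.
have e0 n : 0 < e n by rewrite invr_gt0.
have e1 n : e n <= 1 by rewrite invf_le1 ?ler1n.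
(* The derivative is a limit over punctured neighbourhoods, so the step sizes have to converge
   there. *)
have ecvg : e @ \oo --> (0 : R)^'.
  move=> A; rewrite /dnbhs /within /= => hA.
  have h0 : e @ \oo --> (0 : R) by exact: cvg_harmonic.
  have hA' : \forall y \near nbhs (0 : R), y != 0 -> A y by exact: hA.
  have H : \forall n \near \oo, e n != 0 -> A (e n) by exact: (h0 _ hA').
  suff : \forall n \near \oo, A (e n) by [].
  by apply: filterS H => n; apply; rewrite gt_eqF.
pose Q n y : R[i] := ((e n)^-1)%:C * (h p (y + e n *: e_ i) - h p y).
have ih := rapid_integrable rh ch.
have iQ n : cintegral mu (Q n) = 0.
  rewrite /Q cintegralZ; last first.
    exact: (cintegrableB (cintegrable_translate (e n *: e_ i) ih) ih).
  rewrite cintegralB//; last exact: cintegrable_translate.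
  by rewrite cintegral_translate// subrr mulr0.
have [M hM] := rg 1%N.
have gM y : cmod (g p y) <= M * (weight y)^-1.
  by rewrite ler_pdivlMr ?weight_gt0//; have := hM p y; rewrite expr1.
(* The factor 2 accounts for the real and imaginary parts, each bounded by
   [difference_quotient_le]. *)
pose u (y : 'rV[R]_d) := 2 * (M * 2 ^+ d.+1) * (weight y)^-1.
have iu : mu.-integrable setT (EFin \o u).
  exact: (integrableZl measurableT _ (@integrable_weightV R d)).
have ReQ n y : complex.Re (Q n y) =
    (e n)^-1 * ((@complex.Re R \o h p) (e n *: e_ i + y) - (@complex.Re R \o h p) y).
  by rewrite /Q ReM /= mul0r subr0 ReD ReN addrC [y + _]addrC [X in _ * X]addrC.
have ImQ n y : complex.Im (Q n y) =
    (e n)^-1 * ((@complex.Im R \o h p) (e n *: e_ i + y) - (@complex.Im R \o h p) y).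
  by rewrite /Q ImM /= mul0r addr0 ImD ImN [y + _]addrC.
have := @cdominated_convergence _ _ _ mu Q (g p) u.
have -> : (fun n => cintegral mu (Q n)) = (fun=> 0) by apply/funext => n; exact: iQ.
move=> Qg; suff L : (fun _ : nat => 0 : R[i]) @ \oo --> cintegral mu (g p).
  have L0 : (fun _ : nat => 0 : R[i]) @ \oo --> (0 : R[i]) by exact: cvg_cst.
  by rewrite (cvg_unique _ L L0)//; exact: norm_hausdorff.
apply: Qg; [move=> n| |move=> y|exact: iu|move=> n y].
- apply: cmeasM; first exact: cmeas_cst.
  apply: cmeasB; apply: continuous_cmeas; last exact: ch.
  exact: continuous_translateC ch.
- exact: continuous_cmeas.
- have [[d1 E1] [d2 E2]] := hg y; apply/ccvgP; split.
  + rewrite -E1; under [X in X @ _ --> _]funext do rewrite /= ReQ.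
    exact: (cvg_comp _ _ ecvg d1).
  + rewrite -E2; under [X in X @ _ --> _]funext do rewrite /= ImQ.
    exact: (cvg_comp _ _ ecvg d2).
- rewrite (le_trans (cmod_le_ReIm _))// /u -mulrA mulr_natl mulr2n ReQ ImQ lerD//.
  + apply: (difference_quotient_le (r := fun y => complex.Re (g p y))) => [z|z|].
    * by have [] := hg z.
    * exact: le_trans (Re_le_cmod _) (gM z).
    * by rewrite e0 e1.
  + apply: (difference_quotient_le (r := fun y => complex.Im (g p y))) => [z|z|].
    * by have [] := hg z.
    * exact: le_trans (Im_le_cmod _) (gM z).
    * by rewrite e0 e1.
Qed.

(** Integration by parts: the derivative of [h p] times the character has integral 0, and the
    Leibniz rule splits it into the two sides. *)
Lemma fourier_partial P (h g : P -> 'rV[R]_d -> R[i]) (i : 'I_d) p xi :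
  rapid h -> rapid g -> continuous (h p) -> continuous (g p) -> has_partial i (h p) (g p) ->
  fourier (g p) xi = - ('i * (xi ord0 i / hbar)%:C) * fourier (h p) xi.
Proof.
move=> rh rg ch cg hg.
have dq x : is_derive x (e_ i) (fun y => dot xi y / hbar) (xi ord0 i / hbar).
  apply/is_derive_line0.
  have /is_derive_line0 D := is_derive_dot i xi x.
  have -> : line (fun y => dot xi y / hbar) x (e_ i) = hbar^-1 \*: line (dot xi) x (e_ i).
    by apply/funext => t; rewrite /line /= mulrC.
  by apply: (is_derive_eq (is_deriveZ _ D)); rewrite mulrC.
have hc := has_partial_cexpi dq.
have H := has_partialM hg hc.
have sl : slow (fun (_ : P) y => character xi y).
  by exists 0%N, 1 => _ x; rewrite expr0 mulr1 cmod_character.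
have sl2 : slow (fun (_ : P) y => 'i * (xi ord0 i / hbar)%:C * character xi y).
  exists 0%N, (cmod ('i * (xi ord0 i / hbar)%:C)) => _ x.
  by rewrite expr0 mulr1 cmodM cmod_character mulr1.
have cc := @continuous_character R d hbar xi.
have cc2 : continuous (fun y => 'i * (xi ord0 i / hbar)%:C * character xi y).
  exact: (continuous_mulC (@continuous_cstC R _ _) cc).
have i1 := rapid_integrable (rapidM rg sl) (continuous_mulC cg cc).
have i2 := rapid_integrable (rapidM rh sl2) (continuous_mulC ch cc2).
have i3 := rapid_integrable (rapidM rh sl) (continuous_mulC ch cc).
have := @cintegral_partial0 P (fun p y => h p y * character xi y)
  (fun p y => g p y * character xi y + h p y * ('i * (xi ord0 i / hbar)%:C * character xi y)) i p
  (rapidM rh sl) (rapidD (rapidM rg sl) (rapidM rh sl2))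
  (continuous_mulC ch cc) (continuous_addC (continuous_mulC cg cc) (continuous_mulC ch cc2)) H.
rewrite cintegralD// => /eqP; rewrite addr_eq0 => /eqP; rewrite /fourier => ->.
rewrite -cintegralZ// -mulN1r -cintegralZ//; congr cintegral.
by apply/funext => y; ring.
Qed.

(** Each index [j] is paid for with two derivatives: the transform of h - d_j^2 h is (1 + (xi_j /
    hbar)^2) times that of h. *)
Lemma fourier_decay_seq P (s : seq 'I_d) (h : P -> 'rV[R]_d -> R[i]) :
  smooth_class rapid (size s + size s) h ->
  exists M : R, forall p xi,
    cmod (fourier (h p) xi) * \prod_(j <- s) (1 + (xi ord0 j / hbar) ^+ 2) <= M.
Proof.
elim: s h => [|j s IH] h.
  move=> [rh ch _]; have [M hM] := rh 1%N.
  have iM : mu.-integrable setT (EFin \o (fun x => M * (weight x)^-1)).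
    exact: (integrableZl measurableT M (@integrable_weightV R d)).
  exists (2 * \int[mu]_x (M * (weight x)^-1)) => p xi; rewrite big_nil mulr1.
  apply: cmod_cintegral_le => //.
    apply: continuous_cmeas; apply: continuous_mulC => //.
    exact: continuous_character.
  move=> x; rewrite cmodM cmod_character mulr1 ler_pdivlMr ?weight_gt0//.
rewrite [size _]/= addSn addnS => ch.
have [rh cth /(_ j)[g [hg cg]]] := ch.
have [rg ctg /(_ j)[k [gk ck]]] := cg.
have rk := smooth_classB ck; have ctk := smooth_class_continuous ck.
(* The subtraction is written as a product with the constant -1, to fit the closure of the classes
   under sums and products. *)
have sm1 : smooth_class slow (size s + size s) (fun (_ : P) (_ : 'rV[R]_d) => - 1 : R[i]).
  by apply: (@smooth_slow_cst _ _ _ _ (fun=> -1) 1) => p; rewrite cmodN cmod1.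
have ck' := smooth_rapidM ck sm1.
have [M hM] := IH _ (smooth_classD rapidD (smooth_classS (smooth_classS ch)) ck').
exists M => p xi; have := hM p xi; rewrite big_cons.
suff -> : fourier (fun x => h p x + k p x * -1) xi =
    (1 + (xi ord0 j / hbar) ^+ 2)%:C * fourier (h p) xi.
  rewrite cmodM cmod_real ger0_norm; last by rewrite addr_ge0// sqr_ge0.
  by rewrite mulrA [cmod _ * _]mulrC.
have E1 := fourier_partial xi rh rg (cth p) (ctg p) (hg p).
have E2 := fourier_partial xi rg rk (ctg p) (ctk p) (gk p).
have -> : fourier (fun x => h p x + k p x * -1) xi = fourier (h p) xi - fourier (k p) xi.
  rewrite /fourier -cintegralB; last 2 first.
  - by apply: cintegrable_character; exact: rapid_integrable rh (cth p).
  - by apply: cintegrable_character; exact: rapid_integrable rk (ctk p).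
  by congr cintegral; apply/funext => x; ring.
rewrite E2 E1 rmorphD rmorphXn /= rmorph1.
set z := real_complex _ _; set F := fourier _ _.
have i2 : 'i * 'i = -1 :> R[i] by rewrite -expr2 sqr_i.
transitivity (F - ('i * 'i) * (z ^+ 2 * F)); first by ring.
by rewrite i2; ring.
Qed.

(** Every coordinate is used once, at a cost of d + d derivatives; since [hbar <= 1], each (xi_j /
    hbar)^2 is at least xi_j^2. *)
Lemma fourier_decay P (h : P -> 'rV[R]_d -> R[i]) :
  smooth_class rapid (d + d) h ->
  exists2 M : R, 0 <= M & forall p xi, cmod (fourier (h p) xi) <= M * (weight xi)^-1.
Proof.
move=> ch.
have sz : size (enum 'I_d) = d by rewrite size_enum_ord.
have [|M hM] := @fourier_decay_seq P (enum 'I_d) h; first by rewrite sz.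
exists `|M| => // p xi; rewrite ler_pdivlMr ?weight_gt0//.
apply: (le_trans _ (le_trans (hM p xi) (ler_norm _))).
rewrite ler_wpM2l ?cmod_ge0// big_enum /=; apply: ler_prod => j _.
rewrite addr_ge0 ?sqr_ge0//= lerD2l exprMn ler_peMr ?sqr_ge0//.
by rewrite exprVn invf_ge1 ?exprn_gt0// exprn_ile1// ltW.
Qed.

End fourier_decay.

(** * Windowed Fourier integrals *)

Section sigma_finite_product.
Context {R : realType} d1 (T1 : measurableType d1) d2 (T2 : measurableType d2).
Variable m1 : {sigma_finite_measure set T1 -> \bar R}.
Variable m2 : {sigma_finite_measure set T2 -> \bar R}.

(* The library attaches the sigma-finiteness of [m1 \x m2] to a structure that
   canonical inference does not find, so it is declared on an alias. *)
Definition sf_product : set (T1 * T2)%type -> \bar R := (m1 \x m2)%E.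

HB.instance Definition _ := Measure.copy sf_product
  (lebesgue_integral_fubini_product_measure1__canonical__measure_function_Measure m1 m2).

Let sf_product_sigma_finite : sigma_finite setT sf_product.
Proof.
have [F TF Foo] := sigma_finiteT m1; have [G TG Goo] := sigma_finiteT m2.
exists (fun n => if unpickle n is Some ij then F ij.1 `*` G ij.2 else set0).
  apply/seteqP; split => // -[x y] _.
  have : (\bigcup_n F n) x by rewrite -TF.
  have : (\bigcup_n G n) y by rewrite -TG.
  move=> [j _ Gy] [i _ Fx]; exists (pickle (i, j)) => //.
  by rewrite pickleK.
move=> n; case: (unpickle n) => [[i j]|]; last by rewrite measure0; split.
have [mF Fi] := Foo i; have [mG Gj] := Goo j; split; first exact: measurableX.
rewrite /sf_product product_measure1E//.
by rewrite lte_mul_pinfty// ge0_fin_numE.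
Qed.

HB.instance Definition _ := Measure_isSigmaFinite.Build _ _ _ sf_product
  sf_product_sigma_finite.

End sigma_finite_product.

Section tensor_and_convolution.
Context {R : realType}.

Lemma Rintegral_tensor d1 (T1 : measurableType d1) d2 (T2 : measurableType d2)
    (m1 : {sigma_finite_measure set T1 -> \bar R})
    (m2 : {sigma_finite_measure set T2 -> \bar R}) (a : T1 -> R) (b : T2 -> R) :
  m1.-integrable setT (EFin \o a) -> m2.-integrable setT (EFin \o b) ->
  (forall x, 0 <= a x) -> (forall y, 0 <= b y) ->
  \int[(m1 \x m2)%E]_z (a z.1 * b z.2) = (\int[m1]_x a x) * \int[m2]_y b y.
Proof.
move=> ia ib a0 b0; rewrite Rfubini12/=; last exact: integrable_tensor.
under eq_Rintegral do rewrite RintegralZl//.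
by rewrite RintegralZr.
Qed.

Lemma integrable_Rfubini d1 (T1 : measurableType d1) d2 (T2 : measurableType d2)
    (m1 : {sigma_finite_measure set T1 -> \bar R})
    (m2 : {sigma_finite_measure set T2 -> \bar R}) (t : T1 * T2 -> R) :
  (m1 \x m2)%E.-integrable setT (EFin \o t) ->
  m1.-integrable setT (EFin \o (fun x => \int[m2]_y t (x, y))).
Proof.
move=> it; have iF := integrable_fubini_F it.
apply: (le_integrable measurableT _ _ iF).
  apply/measurable_EFinP; apply: measurable_Rintegral.
  by apply/measurable_EFinP; exact: measurable_int it.
move=> x _ /=; rewrite /Rintegral /fubini_F.
by case: (\int[m2]_y _)%E => [r| |] //=; rewrite ?normr0 ?leey.
Qed.

(** By translation invariance each slice integrates in x to a fixed multiple of [s], so Tonelli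
    applies. Such products serve as majorants on phase space. *)
Lemma integrable_convolution d (s w : 'rV[R]_d -> R) :
  (lebesgue_rV R d).-integrable setT (EFin \o s) ->
  (lebesgue_rV R d).-integrable setT (EFin \o w) ->
  (forall x, 0 <= s x) -> (forall x, 0 <= w x) ->
  (lebesgue_rV R d \x lebesgue_rV R d)%E.-integrable setT
    (EFin \o (fun z => s z.2 * w (z.1 - z.2))).
Proof.
move=> is_ iw s0 w0.
have ms : measurable_fun setT s by apply/measurable_EFinP; exact: measurable_int is_.
have mw : measurable_fun setT w by apply/measurable_EFinP; exact: measurable_int iw.
have iwt y : (lebesgue_rV R d).-integrable setT (EFin \o (fun x => w (x - y))).
  exact: (integrable_translate (- y) iw).
apply: integrable_prod21 => /=.
- apply: measurable_funM; first exact: (measurableT_comp ms measurable_snd).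
  apply: (measurableT_comp mw).
  exact: (measurable_rV_sub measurable_fst measurable_snd).
- by move=> z; rewrite mulr_ge0.
- by move=> y; exact: (integrableZl measurableT (s y) (iwt y)).
- have E y : \int[lebesgue_rV R d]_x (s y * w (x - y)) = (\int[lebesgue_rV R d]_x w x) * s y.
    rewrite (RintegralZl _ _ (iwt y))// mulrC; congr (_ * _).
    have := congr1 (@complex.Re R) (cintegral_translate (- y) (cintegrable_real iw)).
    by [].
  under eq_fun do rewrite E.
  exact: (integrableZl measurableT _ is_).
Qed.

End tensor_and_convolution.

(** * The reconstruction identity and the change of window *)

Section reconstruction.
Context {R : realType} {d : nat}.
Variable hbar : R.
Hypotheses (hbar_gt0 : 0 < hbar) (hbar_le1 : hbar <= 1).
Let mu := lebesgue_rV R d.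
Local Notation fourier := (fourier hbar).
Local Notation character := (character hbar).
Variable f : 'rV[R]_d -> R[i].
Variable Mf : R.
Hypotheses (cf : continuous f) (fM : forall x, cmod (f x) <= Mf).
Implicit Types (g k : 'rV[R]_d -> R[i]) (S : 'rV[R]_d -> R) (x y xi : 'rV[R]_d).

(* Up to the factor (2 pi hbar)^(-d/2), this is the calligraphic transform of
   [f], and the Gabor transform with window [conj g] at (x, - xi). *)
Definition windowed g x xi : R[i] := fourier (fun y => f y * g (y - x)) xi.

Lemma rapid_cintegrable k : rapid (fun _ : unit => k) -> continuous k -> cintegrable mu k.
Proof. by move=> rk ck; exact: (@rapid_integrable _ _ unit (fun _ => k) tt rk ck). Qed.

Lemma cintegrable_windowed g x : rapid (fun _ : unit => g) -> continuous g ->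
  cintegrable mu (fun y => f y * g (y - x)).
Proof.
move=> rg cg; have ig := cintegrable_translate (- x) (rapid_cintegrable rg cg).
have iu := integrableZl measurableT Mf (integrable_cmod ig).
apply: (cintegrable_le (u := fun y => Mf * cmod (g (y - x)))).
- apply: cmeasM; apply: continuous_cmeas; first exact: cf.
  exact: (continuous_translateC (a := - x) cg).
- exact: iu.
- by move=> y; rewrite cmodM ler_wpM2r ?cmod_ge0.
Qed.

Lemma cmeas_windowed g : continuous g ->
  cmeas (fun z : 'rV[R]_d * 'rV[R]_d => windowed g z.1 z.2).
Proof.
move=> cg; rewrite /windowed.
apply: (@cmeas_fourier R d hbar _ _ (fun p : ('rV[R]_d * 'rV[R]_d) * 'rV[R]_d =>
  f p.2 * g (p.2 - p.1.1)) snd); last exact: measurable_snd.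
apply: cmeasM; first exact: (cmeas_comp (continuous_cmeas cf) measurable_snd).
apply: (cmeas_comp (continuous_cmeas cg)); apply: measurable_rV_sub.
  exact: measurable_snd.
exact: (measurableT_comp measurable_fst measurable_fst).
Qed.

Lemma windowed_inversion g S x y : rapid (fun _ : unit => g) -> continuous g ->
  mu.-integrable setT (EFin \o S) -> (forall x xi, cmod (windowed g x xi) <= S xi) ->
  cintegral mu (fun xi => windowed g x xi * conjc (character xi y)) =
  ((2 * pi * hbar) ^+ d)%:C * (f y * g (y - x)).
Proof.
move=> rg cg iS gS; have [Mg hMg] := rg 0%N.
have ch : continuous (fun y => f y * g (y - x)).
  by apply: (continuous_mulC cf); exact: (continuous_translateC (a := - x) cg).
apply: (@fourier_inversion R d hbar hbar_gt0 (fun y => f y * g (y - x)) (Mf * Mg) y ch).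
- move=> z; rewrite cmodM ler_pM ?cmod_ge0//.
  by have := hMg tt (z - x); rewrite expr0 mulr1.
- exact: cintegrable_windowed.
- apply: (cintegrable_le _ iS (gS x)).
  exact: (cmeas_comp (cmeas_windowed cg) (@measurable_pair1 _ _ _ _ x)).
Qed.

(** The integral over (y, x, xi) converges absolutely, with majorant |theta(y)| |k(y - x)| S(xi).
    Integrating over y first gives the left side. Integrating over (x, xi) first, inversion in xi
    produces f(y) g(y - x), and the remaining x-integral is a constant. *)
Lemma reconstruction g k S (theta : 'rV[R]_d -> R[i]) :
  rapid (fun _ : unit => g) -> continuous g -> rapid (fun _ : unit => k) -> continuous k ->
  mu.-integrable setT (EFin \o S) -> (forall x xi, cmod (windowed g x xi) <= S xi) ->
  cintegrable mu theta ->
  cintegral (mu \x mu)%E (fun z => windowed g z.1 z.2 *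
     fourier (fun y => theta y * k (y - z.1)) (- z.2)) =
  ((2 * pi * hbar) ^+ d)%:C * cintegral mu (fun y => g y * k y) *
    cintegral mu (fun y => f y * theta y).
Proof.
move=> rg cg rk ck iS gS itheta.
have S0 xi : 0 <= S xi by exact: le_trans (cmod_ge0 _) (gS 0 xi).
have ik := rapid_cintegrable rk ck.
have [Mk hMk] := rk 0%N.
have kM y : cmod (k y) <= Mk by have := hMk tt y; rewrite expr0 mulr1.
have ikr y := integrable_cmod (cintegrable_reflect y ik).
have mth := cintegrable_cmeas itheta.
(* The integrand at fixed [y], without [theta]: its integral over (x, xi) recovers a multiple of
   [f y]. *)
pose B y (z : 'rV[R]_d * 'rV[R]_d) : R[i] :=
  k (y - z.1) * (windowed g z.1 z.2 * conjc (character z.2 y)).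
have Bbound y z : cmod (B y z) <= cmod (k (y - z.1)) * S z.2.
  rewrite /B !cmodM cmodJ cmod_character mulr1.
  by rewrite ler_wpM2l ?cmod_ge0.
have mB : cmeas (fun p : 'rV[R]_d * ('rV[R]_d * 'rV[R]_d) => B p.1 p.2).
  apply: cmeasM.
    apply: (cmeas_comp (continuous_cmeas ck)); apply: measurable_rV_sub.
      exact: measurable_fst.
    exact: (measurableT_comp measurable_fst measurable_snd).
  apply: cmeasM; first exact: (cmeas_comp (cmeas_windowed cg) measurable_snd).
  apply: cmeasJ; apply: cmeas_character.
    exact: (measurableT_comp measurable_snd measurable_snd).
  exact: measurable_fst.
have iBt y := integrable_tensor (ikr y) iS (fun _ => cmod_ge0 _) S0.
have iB y : cintegrable (mu \x mu)%E (B y).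
  apply: (cintegrable_le _ (iBt y) (Bbound y)).
  exact: (cmeas_comp mB (@measurable_pair1 _ _ _ _ y)).
have Bint y : cintegral (mu \x mu)%E (B y) =
    ((2 * pi * hbar) ^+ d)%:C * cintegral mu (fun y => g y * k y) * f y.
  rewrite (cfubini12 (iB y)).
  have igk : cintegrable mu (fun y => g y * k y).
    apply: (cintegrable_le (u := fun y => Mk * cmod (g y))).
    - by apply: cmeasM; apply: continuous_cmeas; [exact: cg|exact: ck].
    - exact: (integrableZl measurableT Mk (integrable_cmod (rapid_cintegrable rg cg))).
    - by move=> z; rewrite cmodM mulrC ler_wpM2r ?cmod_ge0.
  (* The substitution x -> y - x writes int g k as the x-integral of g(y - x) k(y - x), which is
     what inversion produces. *)
  rewrite -(cintegral_reflect y igk) -mulrA [_ * f y]mulrC mulrA -cintegralZ; last first.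
    exact: (cintegrable_reflect y igk).
  congr cintegral; apply/funext => x; rewrite /B /= cintegralZ; last first.
    apply: (cintegrable_mul_unimod (u := fun xi => conjc (character xi y))).
    - apply: (cintegrable_le _ iS (gS x)).
      exact: (cmeas_comp (cmeas_windowed cg) (@measurable_pair1 _ _ _ _ x)).
    - apply: cmeasJ; apply: cmeas_character; first exact: measurable_id.
      exact: measurable_cst.
    - by move=> xi; rewrite cmodJ cmod_character.
  rewrite (windowed_inversion x y rg cg iS gS); ring.
pose G (p : 'rV[R]_d * ('rV[R]_d * 'rV[R]_d)) : R[i] := theta p.1 * B p.1 p.2.
pose u (p : 'rV[R]_d * ('rV[R]_d * 'rV[R]_d)) : R :=
  cmod (theta p.1) * (cmod (k (p.1 - p.2.1)) * S p.2.2).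
have mS : measurable_fun setT S by apply/measurable_EFinP; exact: measurable_int iS.
have mu_ : measurable_fun setT u.
  apply: measurable_funM.
    exact: (measurable_cmod (cmeas_comp mth measurable_fst)).
  apply: measurable_funM.
    apply: measurable_cmod; apply: (cmeas_comp (continuous_cmeas ck)).
    apply: measurable_rV_sub; first exact: measurable_fst.
    exact: (measurableT_comp measurable_fst measurable_snd).
  exact: (measurableT_comp mS (measurableT_comp measurable_snd measurable_snd)).
(* The pair (x, xi) is treated as a single variable, so its measure has to be sigma-finite for the
   exchange with y. *)
pose mu2 : {sigma_finite_measure set ('rV[R]_d * 'rV[R]_d)%type -> \bar R} := sf_product mu mu.
have iu : (mu \x mu2)%E.-integrable setT (EFin \o u).
  apply: (integrable_prod12 mu_).
  - by move=> z; rewrite !mulr_ge0 ?cmod_ge0.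
  - by move=> y; exact: (integrableZl measurableT (cmod (theta y)) (iBt y)).
  - have E y : \int[(mu \x mu)%E]_z u (y, z) =
        ((\int[mu]_x cmod (k x)) * \int[mu]_xi S xi) * cmod (theta y).
      transitivity (cmod (theta y) * \int[(mu \x mu)%E]_z (cmod (k (y - z.1)) * S z.2)).
        exact: (RintegralZl (cmod (theta y)) measurableT (iBt y)).
      rewrite (Rintegral_tensor (ikr y) iS)//; last by move=> x; exact: cmod_ge0.
      rewrite mulrC; congr (_ * _ * _).
      have := congr1 (@complex.Re R) (cintegral_reflect y (cintegrable_real (integrable_cmod ik))).
      by [].
    under eq_fun do rewrite E.
    exact: (integrableZl measurableT _ (integrable_cmod itheta)).
have iG : cintegrable (mu \x mu2)%E G.
  apply: (cintegrable_le _ iu).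
    by apply: cmeasM => //; exact: (cmeas_comp mth measurable_fst).
  by move=> p; rewrite cmodM ler_wpM2l ?cmod_ge0 ?Bbound.
transitivity (cintegral (mu \x mu2)%E G).
  rewrite (cfubini21 iG); congr cintegral; apply/funext => z.
  rewrite /fourier -cintegralZ; last first.
    apply: cintegrable_character.
    apply: (cintegrable_le (u := fun y => Mk * cmod (theta y))).
    - apply: cmeasM => //; apply: continuous_cmeas.
      exact: (continuous_translateC (a := - z.1) ck).
    - exact: (integrableZl measurableT Mk (integrable_cmod itheta)).
    - by move=> y; rewrite cmodM mulrC ler_wpM2r ?cmod_ge0.
  congr cintegral; apply/funext => y.
  transitivity (theta y * (k (y - z.1) * (windowed g z.1 z.2 * conjc (character z.2 y)))).
    by rewrite characterNl; ring.
  by [].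
rewrite (cfubini12 iG) -cintegralZ; last first.
  apply: (cintegrable_le (u := fun y => Mf * cmod (theta y))).
  - by apply: cmeasM => //; exact: continuous_cmeas.
  - exact: (integrableZl measurableT Mf (integrable_cmod itheta)).
  - by move=> y; rewrite cmodM ler_wpM2r ?cmod_ge0.
congr cintegral; apply/funext => y; rewrite /G /= cintegralZ// Bint.
ring.
Qed.

Lemma fourier_translate h a zeta : cintegrable mu h ->
  fourier (fun y => h (y - a)) zeta = character zeta a * fourier h zeta.
Proof.
move=> ih; have ihc := cintegrable_character hbar zeta ih.
rewrite /fourier -cintegralZ// -[RHS](cintegral_translate (- a)); last exact: cintegrableZ.
congr cintegral; apply/funext => y.
by rewrite mulrCA -characterDr [a + _]addrC subrK.
Qed.

(** The new majorant is a multiple of the convolution of [S] with the inverse weight. It does not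
    depend on [x0], which enters only through the decay in x - x0, and this is integrated over all
    x. *)
Lemma window_change g k g1 S :
  rapid (fun _ : unit => g) -> continuous g ->
  smooth_class rapid (d + d) (fun _ : unit => k) ->
  smooth_class rapid (d + d) (fun _ : unit => g1) ->
  mu.-integrable setT (EFin \o S) -> (forall x xi, cmod (windowed g x xi) <= S xi) ->
  cintegral mu (fun y => g y * k y) != 0 ->
  exists2 S1 : 'rV[R]_d -> R, mu.-integrable setT (EFin \o S1) &
    forall x xi, cmod (windowed g1 x xi) <= S1 xi.
Proof.
move=> rg cg sk sg1 iS gS c0.
have S0 xi : 0 <= S xi by exact: le_trans (cmod_ge0 _) (gS 0 xi).
have mS : measurable_fun setT S by apply/measurable_EFinP; exact: measurable_int iS.
have mw : measurable_fun [set: 'rV[R]_d] (fun x : 'rV[R]_d => (weight x)^-1).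
  exact: continuous_measurable_rV (@continuous_weightV R d).
have iw := @integrable_weightV R d.
have [rk ck] : rapid (fun _ : unit => k) /\ continuous k.
  by split; [exact: smooth_classB sk|exact: (@smooth_class_continuous _ _ _ _ _ _ sk tt)].
have [rg1 cg1] : rapid (fun _ : unit => g1) /\ continuous g1.
  by split; [exact: smooth_classB sg1|exact: (@smooth_class_continuous _ _ _ _ _ _ sg1 tt)].
(* Multiplication by [weight z] leaves the family of translates slow uniformly in [z], so one decay
   estimate in the frequency also yields the decay in [z]. *)
have sh := smooth_rapidM (smooth_rapid_reparam (fun _ : 'rV[R]_d => tt) sk)
  (smooth_slow_weight_translate sg1).
have [M M0 hM] := fourier_decay hbar_gt0 hbar_le1 sh.
have ih (z : 'rV[R]_d) : cintegrable mu (fun u : 'rV[R]_d => k u * g1 (u + z)).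
  have [Mk hMk] := rk 0%N.
  have ig1 := cintegrable_translate z (rapid_cintegrable rg1 cg1).
  apply: (cintegrable_le (u := fun u : 'rV[R]_d => Mk * cmod (g1 (u + z)))).
  - by apply: cmeasM; [exact: continuous_cmeas|exact: cintegrable_cmeas ig1].
  - exact: (integrableZl measurableT Mk (integrable_cmod ig1)).
  - move=> u; rewrite cmodM ler_wpM2r ?cmod_ge0//.
    by have := hMk tt u; rewrite expr0 mulr1.
have decay (z zeta : 'rV[R]_d) : cmod (fourier (fun u => k u * g1 (u + z)) zeta) <=
    M * (weight z)^-1 * (weight zeta)^-1.
  rewrite mulrAC ler_pdivlMr ?weight_gt0//; apply: le_trans (hM z zeta).
  have wz : weight z = cmod (weight z)%:C by rewrite cmod_real gtr0_norm// weight_gt0.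
  rewrite [X in _ * X]wz mulrC -cmodM.
  rewrite /fourier -cintegralZ; last exact: cintegrable_character.
  by rewrite le_eqVlt; apply/orP; left; apply/eqP; congr (cmod (cintegral _ _));
    apply/funext => u; ring.
pose C : R := cmod (((2 * pi * hbar) ^+ d)%:C * cintegral mu (fun y => g y * k y)).
have C0 : 0 < C.
  rewrite lt_neqAle cmod_ge0 andbT eq_sym cmod_eq0 mulf_neq0//.
  by rewrite (inj_eq (@complexI R) _ 0) gt_eqF// exprn_gt0// !mulr_gt0// pi_gt0.
pose Wint := \int[mu]_x (weight x)^-1 : R.
pose conv xi0 : R := \int[mu]_xi (S xi * (weight (xi0 - xi))^-1).
(* [C^-1] undoes the constant of [reconstruction], 2 comes from [cmod_cintegral_le], and [M * Wint]
   is the integral over x. *)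
exists (fun xi0 => C^-1 * (2 * (M * Wint)) * conv xi0).
  have iconv := integrable_Rfubini (integrable_convolution iS iw S0 (@weightV_ge0 R d)).
  exact: (integrableZl measurableT _ iconv).
move=> x0 xi0.
pose theta y := g1 (y - x0) * character xi0 y.
have itheta : cintegrable mu theta.
  apply: cintegrable_character.
  exact: (cintegrable_translate (- x0) (rapid_cintegrable rg1 cg1)).
have E := reconstruction rg cg rk ck iS gS itheta.
have -> : windowed g1 x0 xi0 = cintegral mu (fun y => f y * theta y).
  by congr cintegral; apply/funext => y; rewrite /theta mulrA.
rewrite mulrAC -mulrA mulrC ler_pdivlMr// mulrC -cmodM -E.
have thetaE (z : 'rV[R]_d * 'rV[R]_d) :
    cmod (fourier (fun y => theta y * k (y - z.1)) (- z.2)) <=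
    M * (weight (z.1 - x0))^-1 * (weight (xi0 - z.2))^-1.
  (* The substitution y = u + z.1 leaves a factor of modulus 1; the modulation of [theta] shifts the
     frequency [- z.2] by [xi0]. *)
  rewrite (_ : fourier _ _ = character (xi0 - z.2) z.1 *
     fourier (fun u => k u * g1 (u + (z.1 - x0))) (xi0 - z.2)).
    by rewrite cmodM cmod_character mul1r decay.
  rewrite -fourier_translate//; congr cintegral; apply/funext => y.
  by rewrite characterDl /theta addrA subrK; ring.
pose a x := M * (weight (x - x0))^-1.
pose b xi := S xi * (weight (xi0 - xi))^-1.
have ia : mu.-integrable setT (EFin \o a).
  exact: (integrableZl measurableT M (integrable_translate (- x0) iw)).
have ib : mu.-integrable setT (EFin \o b).
  apply: (integrable_le _ iS).
    apply: measurable_funM; first exact: mS.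
    apply: (measurableT_comp mw).
    by apply: measurable_rV_sub; [exact: measurable_cst|exact: measurable_id].
  move=> xi; rewrite normrM !ger0_norm ?weightV_ge0 ?S0//.
  by rewrite ler_piMr// weightV_le1.
have a0 x : 0 <= a x by rewrite mulr_ge0// weightV_ge0.
have b0 xi : 0 <= b xi by rewrite mulr_ge0// weightV_ge0.
have iab := integrable_tensor ia ib a0 b0.
rewrite (le_trans (cmod_cintegral_le (u := fun z => a z.1 * b z.2) _ iab _))//.
- apply: cmeasM; first exact: cmeas_windowed.
  apply: (@cmeas_fourier R d hbar _ _ (fun p : ('rV[R]_d * 'rV[R]_d) * 'rV[R]_d =>
    theta p.2 * k (p.2 - p.1.1)) (fun z => - z.2)).
    apply: cmeasM; first exact: (cmeas_comp (cintegrable_cmeas itheta) measurable_snd).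
    apply: (cmeas_comp (continuous_cmeas ck)); apply: measurable_rV_sub.
      exact: measurable_snd.
    exact: (measurableT_comp measurable_fst measurable_fst).
  under eq_fun do rewrite -[- _]sub0r.
  by apply: measurable_rV_sub; [exact: measurable_cst|exact: measurable_snd].
- move=> z; rewrite cmodM /a /b.
  rewrite [leRHS](_ : _ = S z.2 * (M * (weight (z.1 - x0))^-1 * (weight (xi0 - z.2))^-1)).
    by apply: ler_pM; rewrite ?cmod_ge0.
  by ring.
- rewrite Rintegral_tensor//.
  have -> : \int[mu]_x a x = M * Wint.
    rewrite /a (RintegralZl M measurableT (integrable_translate (- x0) iw)); congr (_ * _).
    exact: (congr1 (@complex.Re R) (cintegral_translate (- x0) (cintegrable_real iw))).
  by rewrite [leLHS]mulrA [leLHS]mulrC.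
Qed.

End reconstruction.

(** * Fresnel integrals *)

Section fresnel_limit.
Context {R : realType} {d : nat}.
Variable hbar : R.
Hypotheses (hbar_gt0 : 0 < hbar) (hbar_le1 : hbar <= 1).
Let mu := lebesgue_rV R d.
Local Notation fourier := (fourier hbar).
Local Notation character := (character hbar).
Local Notation phase := (@fresnel_phase R d hbar).
Implicit Types (k phi : 'rV[R]_d -> R[i]) (x y xi zeta : 'rV[R]_d).

Lemma continuous_phase : continuous phase.
Proof.
apply: continuous_cexpi; apply: continuous_mulR; first exact: continuous_dotxx.
exact: continuous_cstR.
Qed.

Lemma cmod_phase x : cmod (phase x) = 1.
Proof. exact: cmod_cexpi. Qed.

Lemma phaseD x y : phase (x + y) = phase x * phase y * character y x.
Proof.
rewrite /fresnel_phase /character -!cexpiD !(dotDr, dotDl) (dotC y x); congr cexpi.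
by field; rewrite gt_eqF.
Qed.

(** The gradient of |x|^2 / (2 hbar) is x / hbar, so the derivatives of the phase grow polynomially;
    a rapidly decreasing window absorbs this growth. *)
Lemma smooth_slow_phase P n : smooth_class slow n (fun _ : P => phase).
Proof.
apply: (@smooth_slow_cexpi R d P n _ (fun i (x : 'rV[R]_d) => (2 * hbar)^-1 * (2 * x ord0 i))).
- by apply: continuous_mulR; [exact: continuous_dotxx|exact: continuous_cstR].
- move=> i x.
  have -> : (fun x : 'rV[R]_d => dot x x / (2 * hbar)) = (2 * hbar)^-1 \*: (fun y => dot y y).
    by apply/funext => y; rewrite mulrC.
  exact: (is_deriveZ _ (is_derive_dotxx i x)).
- move=> i m.
  have -> : (fun (_ : P) (x : 'rV[R]_d) => ((2 * hbar)^-1 * (2 * x ord0 i))%:C) =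
      (fun _ (x : 'rV[R]_d) => ((2 * hbar)^-1 * 2)%:C * (x ord0 i)%:C).
    by apply/funext => _; apply/funext => x; rewrite -rmorphM mulrA.
  apply: smooth_slowM; last exact: smooth_slow_coord.
  by apply: (@smooth_slow_cst _ _ _ _ (fun=> _) (cmod ((2 * hbar)^-1 * 2)%:C)).
Qed.

Definition damped phi (e : R) y : R[i] := phase y * phi (e *: y).

(** The range |e| <= B includes e = 0, so one estimate covers the regularized integrands and their
    limit. In the variable u = y - x the damping becomes phi(e u + e x), whose derivatives in u are
    bounded uniformly in (e, x). *)
Lemma fresnel_windowed_decay k phi (B : R) :
  smooth_class rapid (d + d) (fun _ : unit => k) ->
  smooth_class rapid (d + d) (fun _ : unit => phi) ->
  exists2 M : R, 0 <= M & forall e x zeta, `|e| <= B ->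
    cmod (fourier (fun y => damped phi e y * k (y - x)) zeta) <= M * (weight (x + zeta))^-1.
Proof.
move=> sk sphi.
(* The bound on the damping is built into the parameter type, because the symbol classes are uniform
   over the whole type. *)
pose P := ({e : R | `|e| <= B} * 'rV[R]_d)%type.
have sh := smooth_rapidM (smooth_rapid_reparam (fun _ : P => tt) sk)
  (smooth_slowM (smooth_slow_phase P (d + d))
    (smooth_slow_affine (e := fun p : P => sval p.1) (fun p : P => sval p.1 *: p.2)
       sphi (fun p => svalP p.1))).
have [M M0 hM] := fourier_decay hbar_gt0 hbar_le1 sh.
exists M => // e x zeta eB.
pose h u := damped phi e (u + x) * k u.
pose h' u := k u * (phase u * phi (e *: u + e *: x)).
have ih' : cintegrable mu h'.
  have rh := smooth_classB sh.
  have ch := @smooth_class_continuous _ _ _ _ _ _ sh (exist _ e eB, x).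
  exact: (rapid_integrable rh ch).
have hE u : h u = phase x * (h' u * character x u).
  by rewrite /h /h' /damped phaseD scalerDr; ring.
have ih : cintegrable mu h.
  rewrite (_ : h = fun u => phase x * (h' u * character x u)); last exact/funext.
  exact: (cintegrableZ (phase x) (cintegrable_character hbar x ih')).
have -> : fourier (fun y => damped phi e y * k (y - x)) zeta =
    character zeta x * (phase x * fourier h' (x + zeta)).
  transitivity (fourier (fun y => h (y - x)) zeta).
    by congr cintegral; apply/funext => y; rewrite /h subrK.
  rewrite fourier_translate//; congr (_ * _).
  rewrite /fourier -cintegralZ; last exact: cintegrable_character.
  by congr cintegral; apply/funext => u; rewrite hE characterDl; ring.
rewrite !cmodM cmod_character cmod_phase !mul1r.
exact: (hM (exist _ e eB, x)).
Qed.

Variables (f : 'rV[R]_d -> R[i]) (Mf : R).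
Hypotheses (cf : continuous f) (fM : forall x, cmod (f x) <= Mf).

Lemma cintegrable_dilate phi (e : R) : 0 < e -> rapid (fun _ : unit => phi) -> continuous phi ->
  cintegrable mu (fun y => phi (e *: y)).
Proof.
move=> e0 rp cp; have e_neq0 : e != 0 by rewrite gt_eqF.
have := cintegrable_affine 0 e_neq0 (rapid_cintegrable rp cp).
by under eq_fun do rewrite addr0.
Qed.

Lemma continuous_dilate phi (e : R) : continuous phi -> continuous (fun y : 'rV[R]_d => phi (e *: y)).
Proof.
move=> cp; have := continuous_affineC (c := e) (a := 0) cp.
by under eq_fun do rewrite addr0.
Qed.

Lemma continuous_damped phi e : continuous phi -> continuous (damped phi e).
Proof. by move=> cp; exact: (continuous_mulC continuous_phase (continuous_dilate (e := e) cp)). Qed.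

Lemma cintegrable_damped phi (e : R) : 0 < e -> rapid (fun _ : unit => phi) ->
  continuous phi -> cintegrable mu (damped phi e).
Proof.
move=> e0 rp cp.
apply: (cintegrable_le _ (integrable_cmod (cintegrable_dilate e0 rp cp))).
  exact: continuous_cmeas (continuous_damped (e := e) cp).
by move=> y; rewrite cmodM cmod_phase mul1r.
Qed.

Lemma fresnel_regularizedE phi e :
  fresnel_regularized hbar f phi e = fun y => f y * damped phi e y.
Proof. by apply/funext => y; rewrite /fresnel_regularized /damped; ring. Qed.

Lemma cintegrable_regularized phi (e : R) : 0 < e -> rapid (fun _ : unit => phi) ->
  continuous phi -> cintegrable mu (fresnel_regularized hbar f phi e).
Proof.
move=> e0 rp cp; rewrite fresnel_regularizedE.
have idp := integrable_cmod (cintegrable_damped e0 rp cp).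
apply: (cintegrable_le (u := fun y => Mf * cmod (damped phi e y))).
- exact: continuous_cmeas (continuous_mulC cf (continuous_damped (e := e) cp)).
- exact: (integrableZl measurableT Mf idp).
- by move=> y; rewrite cmodM ler_wpM2r ?cmod_ge0.
Qed.

(** The pointwise limit of the regularized integrands. With [gamma] for [g] and the conjugate of [g]
    for [k] it is the integrand of the final formula up to a constant factor. *)
Definition fresnel_pairing g k (z : 'rV[R]_d * 'rV[R]_d) : R[i] :=
  windowed hbar f g z.1 z.2 * fourier (fun y => phase y * k (y - z.1)) (- z.2).

Lemma cmeas_windowed_phase (g k theta : 'rV[R]_d -> R[i]) :
  continuous g -> continuous k -> continuous theta ->
  cmeas (fun z : 'rV[R]_d * 'rV[R]_d => windowed hbar f g z.1 z.2 *
    fourier (fun y => theta y * k (y - z.1)) (- z.2)).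
Proof.
move=> cg ck ct; apply: cmeasM; first exact: cmeas_windowed.
apply: (@cmeas_fourier R d hbar _ _ (fun p : ('rV[R]_d * 'rV[R]_d) * 'rV[R]_d =>
    theta p.2 * k (p.2 - p.1.1)) (fun z => - z.2)).
  apply: cmeasM; first exact: (cmeas_comp (continuous_cmeas ct) measurable_snd).
  apply: (cmeas_comp (continuous_cmeas ck)); apply: measurable_rV_sub.
    exact: measurable_snd.
  exact: (measurableT_comp measurable_fst measurable_fst).
under eq_fun do rewrite -[- _]sub0r.
by apply: measurable_rV_sub; [exact: measurable_cst|exact: measurable_snd].
Qed.

Section damping_limit.
Variables (g k phi : 'rV[R]_d -> R[i]) (S : 'rV[R]_d -> R).
Hypotheses (rg : rapid (fun _ : unit => g)) (cg : continuous g).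
Hypothesis sk : smooth_class rapid (d + d) (fun _ : unit => k).
Hypothesis sphi : smooth_class rapid (d + d) (fun _ : unit => phi).
Hypothesis phi0 : phi 0 = 1.
Hypothesis iS : mu.-integrable setT (EFin \o S).
Hypothesis gS : forall x xi, cmod (windowed hbar f g x xi) <= S xi.

Let rk : rapid (fun _ : unit => k). Proof. exact: smooth_classB sk. Qed.
Let ck : continuous k. Proof. exact: (@smooth_class_continuous _ _ _ _ _ _ sk tt). Qed.
Let rphi : rapid (fun _ : unit => phi). Proof. exact: smooth_classB sphi. Qed.
Let cphi : continuous phi. Proof. exact: (@smooth_class_continuous _ _ _ _ _ _ sphi tt). Qed.

Let S0 xi : 0 <= S xi. Proof. exact: le_trans (cmod_ge0 _) (gS 0 xi). Qed.

Lemma damped0 : damped phi 0 = phase.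
Proof. by apply/funext => y; rewrite /damped scale0r phi0 mulr1. Qed.

Lemma integrable_dominating (M : R) : (mu \x mu)%E.-integrable setT
  (EFin \o (fun z => M * (S z.2 * (weight (z.1 - z.2))^-1))).
Proof.
have iC := integrable_convolution iS (@integrable_weightV R d) S0 (@weightV_ge0 R d).
exact: (integrableZl measurableT M iC).
Qed.

Lemma cintegrable_fresnel_pairing : cintegrable (mu \x mu)%E (fresnel_pairing g k).
Proof.
(* The radius 0 is enough here: since [phi 0 = 1], damping with e = 0 leaves the phase itself. *)
have [M M0 hM] := fresnel_windowed_decay 0 sk sphi.
apply: (cintegrable_le _ (integrable_dominating M)).
  exact: (cmeas_windowed_phase cg ck continuous_phase).
move=> z; rewrite /fresnel_pairing cmodM -damped0.
rewrite [leRHS](_ : _ = S z.2 * (M * (weight (z.1 - z.2))^-1)); last by ring.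
by apply: ler_pM; [exact: cmod_ge0|exact: cmod_ge0|exact: gS|apply: hM; rewrite normr0].
Qed.

(** [reconstruction] turns each term into a double integral, dominated through the decay estimate
    for |e| <= 1. The pointwise convergence of its second factor is another dominated convergence,
    in y, which uses that phi is bounded. *)
Lemma regularized_sequence_cvg (e : nat -> R) : (forall n, 0 < e n <= 1) ->
  e @ \oo --> (0 : R) ->
  (fun n => ((2 * pi * hbar) ^+ d)%:C * cintegral mu (fun y => g y * k y) *
     cintegral mu (fresnel_regularized hbar f phi (e n))) @ \oo -->
  cintegral (mu \x mu)%E (fresnel_pairing g k).
Proof.
move=> e01 ecvg.
have [M M0 hM] := fresnel_windowed_decay 1 sk sphi.
pose Fn n (z : 'rV[R]_d * 'rV[R]_d) := windowed hbar f g z.1 z.2 *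
  fourier (fun y => damped phi (e n) y * k (y - z.1)) (- z.2).
have -> : (fun n => ((2 * pi * hbar) ^+ d)%:C * cintegral mu (fun y => g y * k y) *
     cintegral mu (fresnel_regularized hbar f phi (e n))) =
    (fun n => cintegral (mu \x mu)%E (Fn n)).
  apply/funext => n; have /andP[en0 _] := e01 n.
  rewrite fresnel_regularizedE.
  exact/esym/(reconstruction hbar_gt0 cf fM rg cg rk ck iS gS (cintegrable_damped en0 rphi cphi)).
have scvg y : (e n *: y) @[n --> \oo] --> (0 : 'rV[R]_d).
  by rewrite -(scale0r y); exact: (cvg_comp _ _ ecvg (@scalel_continuous R 'rV[R]_d y 0)).
have pcvg (y : 'rV[R]_d) : phi (e n *: y) @[n --> \oo] --> phi 0.
  have c0 : phi @ (0 : 'rV[R]_d) --> phi 0 by exact: cphi.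
  apply: (@cvg_comp _ _ _ (fun n => e n *: y) phi); first exact: (scvg y).
  exact: c0.
have ik := rapid_cintegrable rk ck.
have [Mp hMp] := rphi 0%N.
have phiM y : cmod (phi y) <= Mp by have := hMp tt y; rewrite expr0 mulr1.
apply: (cdominated_convergence _ _ _ (integrable_dominating M)).
- by move=> n; exact: (cmeas_windowed_phase cg ck (continuous_damped (e := e n) cphi)).
- exact: (cmeas_windowed_phase cg ck continuous_phase).
- move=> z; apply: cvgM; first exact: cvg_cst.
  have ikz := integrable_cmod (cintegrable_translate (- z.1) ik).
  apply: (cdominated_convergence (u := fun y => Mp * cmod (k (y - z.1)))).
  + move=> n; apply: continuous_cmeas; apply: continuous_mulC; last exact: continuous_character.
    apply: continuous_mulC; first exact: continuous_damped.
    exact: (continuous_translateC (a := - z.1) ck).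
  + apply: continuous_cmeas; apply: continuous_mulC; last exact: continuous_character.
    apply: continuous_mulC; first exact: continuous_phase.
    exact: (continuous_translateC (a := - z.1) ck).
  + move=> y; apply: cvgM; last exact: cvg_cst.
    apply: cvgM; last exact: cvg_cst.
    rewrite -[X in _ --> X]mulr1 -phi0; apply: cvgM; first exact: cvg_cst.
    exact: pcvg.
  + exact: (integrableZl measurableT Mp ikz).
  + move=> n y; rewrite !cmodM cmod_phase cmod_character mulr1 mul1r.
    by rewrite ler_wpM2r ?cmod_ge0.
- move=> n z; rewrite cmodM.
  rewrite [leRHS](_ : _ = S z.2 * (M * (weight (z.1 - z.2))^-1)); last by ring.
  have /andP[en0 en1] := e01 n.
  by apply: ler_pM; [exact: cmod_ge0|exact: cmod_ge0|exact: gS|apply: hM; rewrite gtr0_norm].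
Qed.

(** Limits at 0 from the right are tested on positive sequences tending to 0; a tail of each lies in
    the range 0 < e <= 1 of the uniform estimate. *)
Lemma regularized_cvg (C : R[i]) : cintegral mu (fun y => g y * k y) != 0 ->
  C * cintegral mu (fresnel_regularized hbar f phi e) @[e --> 0^'+] -->
  C * ((((2 * pi * hbar) ^+ d)%:C * cintegral mu (fun y => g y * k y))^-1 *
    cintegral (mu \x mu)%E (fresnel_pairing g k)).
Proof.
move=> c0; set D := ((2 * pi * hbar) ^+ d)%:C * _.
have D0 : D != 0.
  rewrite mulf_neq0// (inj_eq (@complexI R) _ 0) gt_eqF// exprn_gt0//.
  by rewrite !mulr_gt0// pi_gt0.
have seq (e : nat -> R) : (forall n, 0 < e n) -> e @ \oo --> (0 : R) ->
    (fun n => C * cintegral mu (fresnel_regularized hbar f phi (e n))) @ \oo -->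
    C * (D^-1 * cintegral (mu \x mu)%E (fresnel_pairing g k)).
  move=> e0 ecvg.
  have [N _ hN] : \forall n \near \oo, e n <= 1.
    have /cvgrPdist_le/(_ 1 ltr01) := ecvg; apply: filterS => n.
    by rewrite sub0r normrN gtr0_norm.
  have eN : (fun n => e (n + N)%N) @ \oo --> (0 : R) by rewrite (cvg_shiftn N).
  have := regularized_sequence_cvg (e := fun n => e (n + N)%N) _ eN.
  move=> H; have {}H : (fun n => D * cintegral mu (fresnel_regularized hbar f phi (e (n + N)%N))) @ \oo -->
      cintegral (mu \x mu)%E (fresnel_pairing g k).
    by apply: H => n; rewrite e0 hN//= leq_addl.
  rewrite -(cvg_shiftn N); apply: cvgM; first exact: cvg_cst.
  have -> : (fun n => cintegral mu (fresnel_regularized hbar f phi (e (n + N)%N))) =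
      (fun n => D^-1 * (D * cintegral mu (fresnel_regularized hbar f phi (e (n + N)%N)))).
    by apply/funext => n; rewrite mulKf.
  by apply: cvgM; [exact: cvg_cst|exact: H].
apply/ccvgP; split; apply/cvg_at_rightP => u [u0 ucvg].
- by have /ccvgP[] := seq u u0 ucvg.
- by have /ccvgP[] := seq u u0 ucvg.
Qed.

End damping_limit.

End fresnel_limit.

(** * Gabor transforms and the Sjostrand norm *)

Lemma cvg_cmod {R : realType} (T : Type) (F : set_system T) {FF : Filter F}
    (f : T -> R[i]) (l : R[i]) : f @ F --> l -> cmod (f x) @[x --> F] --> cmod l.
Proof.
move=> fl; have c : continuous (fun z : R[i] => cmod z).
  by apply: continuous_cmod => z; exact: cvg_id.
exact: (@cvg_comp _ _ _ f (@cmod R) _ _ _ fl (c l)).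
Qed.

(* Makes the supremum over x countable, hence measurable in a parameter. *)
Lemma ereal_sup_rational {R : realType} {d : nat} (H : 'rV[R]_d -> R) :
  (forall (x : 'rV[R]_d) (q : nat -> 'rV[R]_d),
     (forall n i, `|x ord0 i - q n ord0 i| < n.+1%:R^-1) -> H \o q @ \oo --> H x) ->
  ereal_sup [set (H x)%:E | x in setT] =
  esups (fun n => (H (map_mx ratr (odflt 0 (unpickle n : option 'rV[rat]_d))))%:E) 0%N.
Proof.
move=> Hc; apply/le_anti/andP; split.
  apply: ge_ereal_sup => _ [x _ <-].
  have /choice[q xq] n : exists q : 'rV[rat]_d,
      forall i, `|x ord0 i - ratr (q ord0 i)| < n.+1%:R^-1.
    by apply: rV_rat_approx; rewrite invr_gt0.
  have Hcq : H (map_mx ratr (q n)) @[n --> \oo] --> H x.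
    by apply: Hc => n i; rewrite mxE.
  have Hcq' : (fun n => (H (map_mx ratr (q n)))%:E) @ \oo --> (H x)%:E.
    by apply: cvg_EFin; [exact: nearW|exact: Hcq].
  rewrite -(cvg_lim _ Hcq')//; apply: lime_le.
    by apply/cvg_ex; exists (H x)%:E.
  apply: nearW => n; apply: ereal_sup_ubound.
  by exists (pickle (q n)) => //; rewrite pickleK.
by apply: ge_ereal_sup => _ [n _ <-]; apply: ereal_sup_ubound; eexists.
Qed.

Section gabor_transforms.
Context {R : realType} {d : nat}.
Variable hbar : R.
Hypotheses (hbar_gt0 : 0 < hbar) (hbar_le1 : hbar <= 1).
Let mu := lebesgue_rV R d.
Local Notation fourier := (fourier hbar).
Local Notation character := (character hbar).
Local Notation c1 := ((2 * pi * hbar) `^ (- (d%:R / 2))).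
Implicit Types (g k gamma : 'rV[R]_d -> R[i]) (x y xi : 'rV[R]_d) (T : functional R d).

Lemma c1_gt0 : 0 < c1.
Proof. by rewrite powR_gt0// !mulr_gt0// pi_gt0. Qed.

Lemma schwartz_continuous g : schwartz g -> continuous g.
Proof. by move=> [/(_ [::])[]]. Qed.

Lemma schwartz_conjc g : schwartz g -> schwartz (fun y => conjc (g y)).
Proof.
move=> /schwartz_smooth_class sg; apply/schwartz_smooth_class => n.
exact: (smooth_rapidJ (sg n)).
Qed.

Lemma smooth_slow_character P n xi : smooth_class slow n (fun _ : P => character xi).
Proof.
apply: (@smooth_slow_cexpi R d P n _ (fun i _ => hbar^-1 * xi ord0 i)).
- by apply: continuous_mulR; [exact: continuous_dot|exact: continuous_cstR].
- move=> i x.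
  have -> : (fun x : 'rV[R]_d => dot xi x / hbar) = hbar^-1 \*: dot xi.
    by apply/funext => y; rewrite mulrC.
  exact: (is_deriveZ _ (is_derive_dot i xi x)).
- move=> i m; exact: (@smooth_slow_cst _ _ _ _ (fun=> _) (cmod (hbar^-1 * xi ord0 i)%:C)).
Qed.

Lemma schwartz_time_freq_shift x xi g : schwartz g -> schwartz (time_freq_shift hbar x xi g).
Proof.
move=> /schwartz_smooth_class sg; apply/schwartz_smooth_class => n.
have -> : time_freq_shift hbar x xi g = fun y => g (y + - x) * (c1%:C * character xi y).
  by apply/funext => y; rewrite /time_freq_shift mulrC.
apply: (smooth_rapidM (smooth_rapid_translate (- x) (sg n))).
apply: smooth_slowM; last exact: smooth_slow_character.
exact: (@smooth_slow_cst _ _ _ _ (fun=> _) (cmod c1%:C)).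
Qed.

Lemma time_freq_shiftJ x xi g y : conjc (time_freq_shift hbar x xi g y) =
  c1%:C * (character (- xi) y * conjc (g (y - x))).
Proof. by rewrite /time_freq_shift !rmorphM /= oppr0 characterNl mulrA. Qed.

Section bounded_symbol.
Variables (f : 'rV[R]_d -> R[i]) (Mf : R).
Hypotheses (cf : continuous f) (fM : forall x, cmod (f x) <= Mf).
Variable T : functional R d.
Hypothesis fT : represents f T.
Local Notation windowed := (windowed hbar f).

Lemma cintegrable_windowed_character g x xi : schwartz g ->
  cintegrable mu (fun y => f y * g (y - x) * character xi y).
Proof.
move=> sg; apply: cintegrable_character.
exact: (cintegrable_windowed cf fM x (schwartz_rapid sg) (schwartz_continuous sg)).
Qed.

Lemma gaborE g x xi : schwartz g ->
  gabor hbar g T x xi = c1%:C * windowed (fun y => conjc (g y)) x (- xi).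
Proof.
move=> sg; rewrite /gabor /pairing fT; last first.
  exact/schwartz_conjc/schwartz_time_freq_shift.
rewrite /windowed /fourier -cintegralZ; last first.
  exact: (cintegrable_windowed_character x (- xi) (schwartz_conjc sg)).
congr cintegral; apply/funext => y; rewrite time_freq_shiftJ.
by rewrite mulrCA; congr (_ * _); rewrite mulrCA mulrC -mulrA.
Qed.

Lemma gabor_barE g x xi : schwartz g -> gabor_bar hbar g T x xi = c1%:C * windowed g x xi.
Proof.
move=> sg; rewrite /gabor_bar /gabor /pairing /conj_distr conjcK.
have -> : (fun y => conjc (conjc (time_freq_shift hbar x xi g y))) = time_freq_shift hbar x xi g.
  by apply/funext => y; rewrite conjcK.
rewrite fT; last exact: schwartz_time_freq_shift.
rewrite /windowed /fourier -cintegralZ; last exact: cintegrable_windowed_character.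
by congr cintegral; apply/funext => y; rewrite /time_freq_shift -/(character xi y); ring.
Qed.

Lemma windowed_le g x xi : schwartz g ->
  cmod (windowed g x xi) <= 2 * (Mf * \int[mu]_y cmod (g y)).
Proof.
move=> sg; have ig := rapid_cintegrable (schwartz_rapid sg) (schwartz_continuous sg).
have igx := integrable_cmod (cintegrable_translate (- x) ig).
have /(congr1 (@complex.Re R)) /= <- :=
  cintegral_translate (- x) (cintegrable_real (integrable_cmod ig)).
rewrite -(RintegralZl _ measurableT igx).
apply: cmod_cintegral_le; last first.
- by move=> y; rewrite !cmodM cmod_character mulr1 ler_wpM2r ?cmod_ge0.
- exact: (integrableZl measurableT Mf igx).
- exact: (cintegrable_cmeas (cintegrable_windowed_character x xi sg)).
Qed.

(** Continuity in the translation, in the sequential form required by [ereal_sup_rational]. The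
    translated windows have a common majorant: the coordinates of q n - x are at most 1 in modulus,
    so its weight is at most 2^d, and Peetre's inequality adds another 2^d. *)
Lemma windowed_cvg g x xi (q : nat -> 'rV[R]_d) : schwartz g ->
  (forall n i, `|x ord0 i - q n ord0 i| < n.+1%:R^-1) ->
  (fun n => windowed g (q n) xi) @ \oo --> windowed g x xi.
Proof.
move=> sg xq; have cg := schwartz_continuous sg.
have [M hM] := schwartz_rapid sg 1%N.
have gM y : cmod (g y) <= M * (weight y)^-1.
  by rewrite ler_pdivlMr ?weight_gt0//; have := hM tt y; rewrite expr1.
have M0 : 0 <= M by have := hM tt 0; apply: le_trans; rewrite expr1 mulr_ge0 ?cmod_ge0// ltW// weight_gt0.
have qcvg : q @ \oo --> x.
  apply/cvg_ballP => e e0; near=> n; apply/rV_ballP => // i.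
  apply: lt_trans (xq n i) _; near: n; exact: near_infty_natSinv_lt (PosNum e0).
have wq n : weight (q n - x) <= 2 ^+ d.
  rewrite /weight -[d in 2 ^+ d]card_ord -prodr_const; apply: ler_prod => i _.
  rewrite addr_ge0 ?sqr_ge0//= !mxE (_ : 2 = 1 + 1)// lerD2l.
  rewrite -(expr1n _ 2) -real_normK ?num_real// lerXn2r ?nnegrE//.
  by rewrite distrC (le_trans (ltW (xq n i)))// invf_le1// ler1n.
have iw := integrable_translate (- x) (@integrable_weightV R d).
apply: (cdominated_convergence (u := fun y => Mf * (M * (2 ^+ d * 2 ^+ d)) * (weight (y - x))^-1)).
- by move=> n; exact: (cintegrable_cmeas (cintegrable_windowed_character (q n) xi sg)).
- exact: (cintegrable_cmeas (cintegrable_windowed_character x xi sg)).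
- move=> y; apply: cvgM; last exact: cvg_cst.
  apply: cvgM; first exact: cvg_cst.
  have yq : (fun n => (y : 'rV[R]_d) - q n) @ \oo --> (y : 'rV[R]_d) - x.
    by apply: cvgB; [exact: cvg_cst|exact: qcvg].
  have c0 : g @ ((y : 'rV[R]_d) - x) --> g (y - x) by exact: cg.
  apply: (@cvg_comp _ _ _ (fun n => (y : 'rV[R]_d) - q n) g); first exact: yq.
  exact: c0.
- exact: (integrableZl measurableT _ iw).
- move=> n y; rewrite !cmodM cmod_character mulr1 -mulrA.
  apply: ler_pM; [exact: cmod_ge0|exact: cmod_ge0|exact: fM|].
  apply: (le_trans (gM _)); rewrite -mulrA ler_wpM2l//.
  rewrite ler_pdivlMr ?weight_gt0// ler_pdivrMl ?weight_gt0//.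
  have : weight (y - x) <= 2 ^+ d * (weight (y - q n) * weight (q n - x)).
    by rewrite -(subrKA (q n) y); exact: weightD.
  move=> /le_trans; apply; rewrite [leRHS]mulrCA [leRHS]mulrA -[leRHS]mulrA.
  rewrite !ler_wpM2l ?exprn_ge0//.
  by rewrite ltW// weight_gt0.
Unshelve. all: by end_near. Qed.

Lemma cmod_gabor g x xi : schwartz g ->
  cmod (gabor hbar g T x xi) = c1 * cmod (windowed (fun y => conjc (g y)) x (- xi)).
Proof. by move=> sg; rewrite gaborE// cmodM cmod_real gtr0_norm ?c1_gt0. Qed.

(** Needed to turn the finiteness of the Sjostrand norm into integrability of the supremum;
    continuity in x reduces the supremum to rational points. *)
Lemma measurable_sup_gabor g : schwartz g ->
  measurable_fun setT (fun xi => ereal_sup [set (cmod (gabor hbar g T x xi))%:E | x in setT]).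
Proof.
move=> sg; have sgJ := schwartz_conjc sg.
under eq_fun => xi.
  rewrite (@ereal_sup_rational R d (fun x => cmod (gabor hbar g T x xi))); last first.
    move=> x q xq; rewrite cmod_gabor//.
    under eq_cvg do rewrite /= cmod_gabor//.
    apply: cvgM; first exact: cvg_cst.
    exact: (cvg_cmod (windowed_cvg sgJ xq)).
  over.
apply: measurable_fun_esups => n; apply/measurable_EFinP.
under eq_fun do rewrite cmod_gabor//.
apply: measurable_funM; first exact: measurable_cst.
apply: (measurable_cmod (f := fun xi => windowed (fun y => conjc (g y))
  (map_mx ratr (odflt 0 (unpickle n : option 'rV[rat]_d))) (- xi))).
apply: (cmeas_comp (cmeas_windowed hbar cf (schwartz_continuous sgJ))
  (phi := fun xi : 'rV[R]_d => (_, - xi))).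
apply/measurable_fun_pairP; split; first exact: measurable_cst.
rewrite [X in measurable_fun _ X](_ : _ = fun xi : 'rV[R]_d => -1 *: xi + 0).
  exact: measurable_rV_affine.
by apply/funext => xi /=; rewrite scaleN1r addr0.
Qed.

(** The Gabor transform at xi is a windowed integral at - xi with the conjugate window, whence the
    reflection and the factor [c1^-1] in [S]. Since f is bounded, the supremum is finite at every
    xi, so [fine] loses nothing. *)
Lemma sjostrand_window : sjostrand hbar T -> exists g S,
  [/\ schwartz g, g <> cst 0, mu.-integrable setT (EFin \o S) &
    forall x xi, cmod (windowed (fun y => conjc (g y)) x xi) <= S xi].
Proof.
move=> [_ [g [sg g0 gS]]]; exists g; have sgJ := schwartz_conjc sg.
pose s xi := ereal_sup [set (cmod (gabor hbar g T x xi))%:E | x in setT].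
have s_ub x xi : ((cmod (gabor hbar g T x xi))%:E <= s xi)%E.
  by apply: ereal_sup_ubound; exists x.
have s_ge0 xi : (0 <= s xi)%E.
  by apply: (le_trans _ (s_ub 0 xi)); rewrite lee_fin; exact: cmod_ge0.
have s_fin xi : s xi \is a fin_num.
  rewrite ge0_fin_numE//.
  apply: (le_lt_trans _ (ltry (c1 * (2 * (Mf * \int[mu]_y cmod (conjc (g y))))))).
  apply: ge_ereal_sup => _ [x _ <-]; rewrite lee_fin cmod_gabor//.
  by rewrite ler_wpM2l ?windowed_le// ltW// c1_gt0.
have is_ : mu.-integrable setT (EFin \o (fine \o s)).
  rewrite (_ : EFin \o _ = s); last by apply/funext => xi /=; rewrite fineK.
  apply/integrableP; split; first exact: measurable_sup_gabor.
  by under eq_integral do rewrite gee0_abs//.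
have [isr _] := cintegrable_reflect 0 (cintegrable_real is_).
exists (fun xi => c1^-1 * fine (s (0 - xi))); split=> //.
  exact: (integrableZl measurableT c1^-1 isr).
move=> x xi; rewrite ler_pdivlMl ?c1_gt0// sub0r.
have := s_ub x (- xi); rewrite cmod_gabor// opprK -(fineK (s_fin _)) lee_fin.
by [].
Qed.

End bounded_symbol.

Lemma gabor_FplusE g x xi : schwartz g ->
  gabor hbar g (distr_of (F_plus hbar)) x xi =
  fresnel_const d hbar * c1%:C *
    fourier (fun y => fresnel_phase hbar y * conjc (g (y - x))) (- xi).
Proof.
move=> sg; rewrite /gabor /pairing /distr_of /fourier -cintegralZ.
  congr cintegral; apply/funext => y; rewrite time_freq_shiftJ /F_plus.
  by rewrite mulrACA -[X in _ = _ * X]mulrA; congr (_ * (_ * _)); exact: mulrC.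
apply: cintegrable_character.
have ig := rapid_cintegrable (schwartz_rapid (schwartz_conjc sg))
  (schwartz_continuous (schwartz_conjc sg)).
have igx := cintegrable_translate (- x) ig.
apply: (cintegrable_le _ (integrable_cmod igx)).
  apply: cmeasM; last exact: cintegrable_cmeas igx.
  exact: continuous_cmeas (@continuous_phase R d hbar).
by move=> y; rewrite cmodM cmod_phase mul1r.
Qed.

End gabor_transforms.

(** * The Fresnel integral as an integral over phase space *)

Section fresnel_representation.
Context {R : realType} {d : nat}.
Let mu := lebesgue_rV R d.
Implicit Types (g : 'rV[R]_d -> R[i]).

Lemma rV_ballE (x : 'rV[R]_d) (e : R) : 0 < e ->
  ball x e = [set y | forall i, `]x ord0 i - e, x ord0 i + e[%classic (y ord0 i)].
Proof.
move=> e0; apply/seteqP; split=> y.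
  by move=> /(rV_ballP _ _ e0) xy i; have := xy i; rewrite distrC ltr_distl /= in_itv/=.
move=> xy; apply/(rV_ballP _ _ e0) => i; rewrite distrC ltr_distl.
by have := xy i; rewrite /= in_itv/=.
Qed.

Lemma lebesgue_rV_ball_gt0 (x : 'rV[R]_d) (e : R) : 0 < e -> (0 < mu (ball x e))%E.
Proof.
move=> e0; rewrite rV_ballE//.
rewrite /mu (@lebesgue_rV_box R d (fun i => `]x ord0 i - e, x ord0 i + e[%classic)); last first.
  by move=> i; exact: measurable_itv.
apply: (big_ind (fun z : \bar R => (0 < z)%E)) => [||i _].
- exact: lte01.
- by move=> a b a0 b0; exact: mule_gt0.
- rewrite lebesgue_measure_itv/= lte_fin -EFinD.
  by rewrite (_ : x ord0 i - e < x ord0 i + e) ?lte_fin; lra.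
Qed.

(** If the integral of |g|^2 vanished, g would be 0 outside a null set; by continuity a nonzero
    value persists on a ball, which has positive measure. *)
Lemma integral_normsqr_neq0 g : continuous g -> rapid (fun _ : unit => g) -> g <> cst 0 ->
  cintegral mu (fun y => conjc (g y) * g y) != 0.
Proof.
move=> cg rg g0; apply/eqP => I0; apply: g0; apply/funext => y /=; apply/eqP.
apply/negPn/negP => gy0.
have gE z : conjc (g z) * g z = (cmod (g z) ^+ 2)%:C by rewrite mulrC cmulJ.
have [M hM] := rg 0%N.
pose u (z : 'rV[R]_d) : R := cmod (g z) ^+ 2.
have iu : mu.-integrable setT (EFin \o u).
  have ig := integrable_cmod (rapid_cintegrable rg cg).
  apply: (integrable_le _ (integrableZl measurableT M ig)).
    apply: measurable_funX; exact: (measurable_cmod (continuous_cmeas cg)).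
  move=> z; rewrite /u ger0_norm ?sqr_ge0// expr2 ler_wpM2r ?cmod_ge0//.
  by have := hM tt z; rewrite expr0 mulr1.
have mu_ : measurable_fun setT (EFin \o u) by exact: measurable_int iu.
have Iu : (\int[mu]_z `|(EFin \o u) z| = 0)%E.
  have {}I0 : \int[mu]_z u z = 0.
    have /(congr1 (@complex.Re R)) /= := I0.
    by under eq_Rintegral do rewrite gE/=.
  under eq_integral do rewrite /= ger0_norm ?sqr_ge0//.
  rewrite -[LHS]fineK; last exact: (integrable_fin_num measurableT iu).
  by rewrite -[RHS]/(0%:E) -I0.
have /(ae_eq_integral_abs mu measurableT mu_)[N [mN N0 NB]] := Iu.
have /cvgrPdist_lt/(_ (cmod (g y))) : (cmod (g z) @[z --> y] --> cmod (g y)) by exact: (continuous_cmod cg).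
rewrite lt0r cmod_ge0 cmod_eq0 gy0 => /(_ isT)/nbhs_ballP[e /= e0 yB].
have : (mu (ball y e) <= mu N)%E.
  apply: le_measure; [rewrite inE|by rewrite inE|].
    rewrite rV_ballE//.
    by apply: (@measurable_box R d (fun i => `]y ord0 i - e, y ord0 i + e[%classic)) => i; exact: measurable_itv.
  move=> z /yB /= yz; apply: NB => /= /(_ Logic.I) [] /eqP.
  rewrite sqrf_eq0 => /eqP z0; move: yz.
  by rewrite z0 subr0 ger0_norm ?cmod_ge0// ltxx.
by rewrite N0 leNgt lebesgue_rV_ball_gt0.
Qed.

(** Without a Schwartz function equal to 1 at the origin, the defining condition of a Fresnel
    integral would hold vacuously for every value. A nonzero window provides one: a point where it
    does not vanish is moved to the origin and the value there normalized. *)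
Lemma schwartz_test_function g : schwartz g -> g <> cst 0 ->
  exists2 phi : 'rV[R]_d -> R[i], schwartz phi & phi 0 = 1.
Proof.
move=> /schwartz_smooth_class sg g0.
have [x gx] : exists x, g x != 0.
  apply/not_existsP => g0'; apply: g0; apply/funext => x /=.
  by apply/eqP/negPn/negP; exact: g0'.
exists (fun y => g (y + x) * (g x)^-1); last by rewrite add0r mulfV.
apply/schwartz_smooth_class => n.
apply: (smooth_rapidM (smooth_rapid_translate x (sg n))).
exact: (@smooth_slow_cst _ _ _ _ (fun=> _) (cmod (g x)^-1)).
Qed.

Lemma has_fresnel_integral_unique (hbar : R) (f phi : 'rV[R]_d -> R[i]) l1 l2 :
  schwartz phi -> phi 0 = 1 ->
  has_fresnel_integral hbar f l1 -> has_fresnel_integral hbar f l2 -> l1 = l2.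
Proof.
move=> sphi phi0 /(_ phi sphi phi0)[_ /ccvgP[r1 i1]] /(_ phi sphi phi0)[_ /ccvgP[r2 i2]].
by apply: cplx_eq; [exact: cvg_unique r1 r2|exact: cvg_unique i1 i2].
Qed.

Variable hbar : R.
Hypotheses (hbar_gt0 : 0 < hbar) (hbar_le1 : hbar <= 1).
Local Notation c1 := ((2 * pi * hbar) `^ (- (d%:R / 2))).

(** The normalizations of the two Gabor transforms together cancel the factor (2 pi hbar)^d produced
    by Fourier inversion. *)
Lemma gabor_normalization : c1 * c1 = ((2 * pi * hbar) ^+ d)^-1.
Proof.
have h0 : 0 < 2 * pi * hbar by rewrite !mulr_gt0// pi_gt0.
rewrite -powRD; last by rewrite (gt_eqF h0) implybT.
rewrite -opprD -splitr powRN powR_mulrn// ltW//.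
Qed.

(** [gamma] is the window on [f] and the conjugate of [g] the window on the phase, so the constant
    of [reconstruction] is the inner product of [gamma] and [g]. The test function assumed to exist
    gives the integrability of [F]; the limit is then taken for every admissible damping. *)
Lemma gabor_fresnel_representation (T : functional R d) f Mf g gamma S :
  continuous f -> (forall x, cmod (f x) <= Mf) -> represents f T ->
  schwartz g -> schwartz gamma -> inner gamma g != 0 ->
  mu.-integrable setT (EFin \o S) ->
  (forall x xi, cmod (windowed hbar f gamma x xi) <= S xi) ->
  (exists2 phi : 'rV[R]_d -> R[i], schwartz phi & phi 0 = 1) ->
  let F z := gabor hbar g (distr_of (F_plus hbar)) z.1 z.2 *
             gabor_bar hbar gamma T z.1 z.2 in
  cintegrable (mu \x mu)%E F /\
  has_fresnel_integral hbar f ((inner gamma g)^-1 * cintegral (mu \x mu)%E F).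
Proof.
move=> cf fM fT sg sgam c0 iS gS [phi0 sphi0 phi00] F.
have skJ := schwartz_conjc sg.
have sk := (schwartz_smooth_class _).1 skJ (d + d)%N.
have rgam := schwartz_rapid sgam; have cgam := schwartz_continuous sgam.
have sphi (phi : 'rV[R]_d -> R[i]) : schwartz phi -> smooth_class rapid (d + d) (fun _ : unit => phi).
  by move=> s; exact: (schwartz_smooth_class _).1 s (d + d)%N.
have FE : F = fun z => fresnel_const d hbar * (c1 * c1)%:C *
    fresnel_pairing hbar f gamma (fun y => conjc (g y)) z.
  apply/funext => z; rewrite /F gabor_FplusE// (gabor_barE hbar cf fM fT)//.
  rewrite /fresnel_pairing rmorphM /=.
  set A := fourier _ _ _; set B := windowed _ _ _ _ _.
  by rewrite mulrACA -[_ * _ * c1%:C]mulrA [A * B]mulrC.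
have ip := cintegrable_fresnel_pairing hbar_gt0 hbar_le1 cf cgam sk (sphi _ sphi0) phi00 iS gS.
split; first by rewrite FE; exact: cintegrableZ.
move=> phi sph ph1; split.
  move=> e e0; exact: (cintegrable_regularized hbar cf fM e0 (schwartz_rapid sph)
    (schwartz_continuous sph)).
have H := regularized_cvg (C := fresnel_const d hbar) hbar_gt0 hbar_le1 cf fM rgam cgam sk
  (sphi _ sph) ph1 iS gS c0.
move: H; rewrite -/(inner gamma g); set P := cintegral (mu \x mu)%E (fresnel_pairing _ _ _ _).
have -> : cintegral (mu \x mu)%E F =
    fresnel_const d hbar * (((2 * pi * hbar) ^+ d)^-1)%:C * P.
  by rewrite FE -gabor_normalization; exact: (cintegralZ _ ip).
have -> : (inner gamma g)^-1 * (fresnel_const d hbar * (((2 * pi * hbar) ^+ d)^-1)%:C * P) =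
    fresnel_const d hbar * ((((2 * pi * hbar) ^+ d)%:C * inner gamma g)^-1 * P).
  have AC (a b c p : R[i]) : b * (c * a * p) = c * (a * b * p) by ring.
  by rewrite invfM fmorphV; exact: AC.
by [].
Qed.

End fresnel_representation.

(** [T] is the element of the Sjostrand class as a distribution and [f] the bounded continuous
    function identified with it. The integrability of [F] belongs to the conclusion, so that the
    double integral is not a default value. *)
Theorem theorem3p4 (R : realType) (hbar : R) (hbar_gt0 : 0 < hbar)
    (hbar_le1 : hbar <= 1) (d : nat) (d_ge1 : (1 <= d)%N)
    (T : functional R d) (T_sjostrand : sjostrand hbar T)
    (f : 'rV[R]_d -> R[i]) (f_cont : continuous f)
    (f_bounded : exists M : R, forall x, cmod (f x) <= M)
    (f_T : represents f T) :
  fresnel_integrable hbar f /\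
  forall g gamma : 'rV[R]_d -> R[i], schwartz g -> schwartz gamma ->
    inner gamma g != 0 ->
    let F z := gabor hbar g (distr_of (F_plus hbar)) z.1 z.2 *
               gabor_bar hbar gamma T z.1 z.2 in
    cintegrable (lebesgue_rV R d \x lebesgue_rV R d)%E F /\
    fresnel_integral hbar f =
      (inner gamma g)^-1 * cintegral (lebesgue_rV R d \x lebesgue_rV R d)%E F.
Proof.
have [Mf fM] := f_bounded.
have [g0 [S0 [sg0 g0_neq0 iS0 gS0]]] := sjostrand_window hbar_gt0 f_cont fM f_T T_sjostrand.
have test := schwartz_test_function sg0 g0_neq0.
have sg0J := schwartz_conjc sg0.
have cg0 := schwartz_continuous sg0.
(* The available majorant is for the conjugate of [g0]; the choice [k = g0] makes the constant in
   the change of window int |g0|^2. *)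
have I0 : cintegral (lebesgue_rV R d) (fun y => conjc (g0 y) * g0 y) != 0.
  exact: (integral_normsqr_neq0 cg0 (schwartz_rapid sg0) g0_neq0).
have rep g gamma : schwartz g -> schwartz gamma -> inner gamma g != 0 ->
    let F z := gabor hbar g (distr_of (F_plus hbar)) z.1 z.2 *
               gabor_bar hbar gamma T z.1 z.2 in
    cintegrable (lebesgue_rV R d \x lebesgue_rV R d)%E F /\
    has_fresnel_integral hbar f
      ((inner gamma g)^-1 * cintegral (lebesgue_rV R d \x lebesgue_rV R d)%E F).
  move=> sg sgam c0.
  have [S iS gS] := window_change hbar_gt0 hbar_le1 f_cont fM (schwartz_rapid sg0J)
    (schwartz_continuous sg0J) ((schwartz_smooth_class _).1 sg0 (d + d)%N)
    ((schwartz_smooth_class _).1 sgam (d + d)%N) iS0 gS0 I0.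
  exact: (gabor_fresnel_representation hbar_gt0 hbar_le1 f_cont fM f_T sg sgam c0 iS gS test).
split.
  (* Fresnel integrability asks for some value of the limit; the pair [g0], [g0] provides one. *)
  have I0' : inner g0 g0 != 0.
    by move: I0; congr (_ != _); congr cintegral; apply/funext => y; exact: mulrC.
  by have [_ H] := rep g0 g0 sg0 sg0 I0'; eexists; exact: H.
move=> g gamma sg sgam c0 F; have [iF hF] := rep g gamma sg sgam c0.
split; first exact: iF.
have [phi sphi phi0] := test.
(* [fresnel_integral] is a choice among the possible values; uniqueness of the limit identifies it
   with the computed one. *)
have hget : has_fresnel_integral hbar f (fresnel_integral hbar f).
  by apply: getPex; eexists; exact: hF.
exact: (has_fresnel_integral_unique sphi phi0 hget hF).
Qed.
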